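(* Let $\Gamma$ be a countable discrete group acting on a locally compact second countable Hausdorff space $X$, and let $Y$ be a clopen subset of $X$ such that $\Gamma Y=X$. Let $N\colon\Gamma\to(0,\infty)$ be a multiplicative homomorphism and let $c(\gamma,y)=\log N(\gamma)$, for $(\gamma,y)\in\Gamma\boxtimes Y$, be the associated $1$-cocycle on $\Gamma\boxtimes Y$. Then: (1) the boundary set of $c$ is $$Y_0:=Y\setminus\Big(\bigcup_{\gamma\colon N(\gamma)>1}\gamma Y\Big);$$ (2) the boundary groupoid $\Gamma\boxtimes Y_0$ coincides with $(\ker N)\boxtimes Y_0$; (3) both $c^{-1}(0)=(\ker N)\boxtimes Y$ and $(\ker N)\boxtimes Y_0$ are étale groupoids; (4) if $Y_0\neq\emptyset$, then the map $\psi\mapsto\varphi_\psi$ defined by $$\varphi_\psi(f)=\psi(f|_{(\ker N)\boxtimes Y_0})\quad\text{for } f\in C_c(\Gamma\boxtimes Y)$$ is an affine isomorphism of the state space of $C^*((\ker N)\boxtimes Y_0)$ onto the $\sigma^c$-ground state space of $C^*(\Gamma\boxtimes Y)$; (5) if $Y_0=\emptyset$, there are no $\sigma^c$-ground states on $C^*(\Gamma\boxtimes Y)$.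
   Context: The transformation groupoid $\Gamma\times X$ has product $(\gamma',\gamma x)(\gamma,x)=(\gamma'\gamma,x)$ and unit space $X$ (so $s(\gamma,x)=x$, $r(\gamma,x)=\gamma x$). For a subgroup (or subset closed appropriately) $\Lambda\subset\Gamma$ and a subset $W\subset X$, $\Lambda\boxtimes W:=\{(\gamma,w)\in\Lambda\times W : \gamma w\in W\}$ with the restricted product; in particular $\Gamma\boxtimes Y$ is the reduction of $\Gamma\times X$ by $Y$. For a locally compact second countable Hausdorff étale groupoid $G$ (étale: range and source maps $r,s$ are local homeomorphisms), $C^*(G)$ is the full groupoid $C^*$-algebra, i.e. the enveloping $C^*$-algebra of $C_c(G)$ with convolution $(f_1*f_2)(g)=\sum_{h\in r^{-1}(r(g))}f_1(h)f_2(h^{-1}g)$ and involution $f^*(g)=\overline{f(g^{-1})}$. A continuous $1$-cocycle $c\colon G\to\mathbb{R}$ (continuous groupoid homomorphism to $(\mathbb R,+)$) defines the dynamics $\sigma^c$ on $C^*(G)$ by $\sigma^c_t(f)(g)=e^{itc(g)}f(g)$ for $f\in C_c(G)$; here $\sigma^c_t(f)(\gamma,y)=N(\gamma)^{it}f(\gamma,y)$. The boundary set of $c$ is $Z=\{x\in G^{(0)} : c\le0\text{ on }r^{-1}(x)\}$ and the boundary groupoid is the reduction $G_Z=\{g : r(g),s(g)\in Z\}$. A state $\varphi$ on a $C^*$-algebra $A$ with continuous one-parameter automorphism group $\sigma$ is a $\sigma$-ground state iff for every smooth compactly supported $F$ on $\mathbb{R}$ with support in $(-\infty,0)$ one has $\varphi(\sigma_{\check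 F}(a)^*\sigma_{\check F}(a))=0$ for all $a\in A$, where $\check F(x)=\frac1{2\pi}\int_{\mathbb{R}}F(y)e^{-ixy}dy$ and $\sigma_{\check F}(a)=\int_{\mathbb{R}}\check F(t)\sigma_t(a)dt$. *)

(* Defs.v *)
From HB Require Import structures.
From mathcomp Require Import all_boot all_order all_algebra.
From mathcomp Require Import complex.
From mathcomp Require Import all_classical all_reals all_analysis.

Set Implicit Arguments.
Unset Strict Implicit.
Unset Printing Implicit Defensive.

Import Order.TTheory GRing.Theory Num.Theory.
Import numFieldNormedType.Exports.

Local Open Scope classical_set_scope.
Local Open Scope ring_scope.

(* [R[i]] packed as a [numClosedFieldType]: the topology of MathComp-Analysis is
   attached to that structure, not to [complex R]. *)
Definition Cplx (R : realType) : numClosedFieldType := R[i].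

Section Complex.
Variable R : realType.

Definition cRe (z : Cplx R) : R := complex.Re z.
Definition cIm (z : Cplx R) : R := complex.Im z.
Definition ofR (x : R) : Cplx R := (x%:C)%C.
Definition expi (x : R) : Cplx R := (cos x +i* sin x)%C.

Definition cintegrable (f : R -> Cplx R) : Prop :=
  (@lebesgue_measure R).-integrable setT (fun t => (cRe (f t))%:E) /\
  (@lebesgue_measure R).-integrable setT (fun t => (cIm (f t))%:E).

Definition cintegral (f : R -> Cplx R) : Cplx R :=
  (Rintegral (@lebesgue_measure R) setT (fun t => cRe (f t)) +i*
   Rintegral (@lebesgue_measure R) setT (fun t => cIm (f t)))%C.

Definition smooth (F : R -> Cplx R) : Prop :=
  forall (n : nat) (x : R),
    derivable (derive1n n (fun t => cRe (F t))) x 1 /\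
    derivable (derive1n n (fun t => cIm (F t))) x 1.

(* With this sign and normalization, the integral of
   [inv_fourier F t * expi (s * t)] over [t] is [F s]. *)
Definition inv_fourier (F : R -> Cplx R) (x : R) : Cplx R :=
  ofR (2 * pi)^-1 * cintegral (fun y => F y * expi (- (x * y))).

End Complex.

Definition fsupp (T : topologicalType) (C : numFieldType) (f : T -> C) : set T :=
  closure [set x | f x != 0].

Record cstarAlgebra (R : realType) := CstarAlgebra {
  cs_sort :> completeNormedModType (Cplx R);
  cmul : cs_sort -> cs_sort -> cs_sort;
  cstar : cs_sort -> cs_sort;
  cmulA : associative cmul;
  cmul_linl : forall (k : Cplx R) a b x,
    cmul (k *: a + b) x = k *: cmul a x + cmul b x;
  cmul_linr : forall (k : Cplx R) a b x,
    cmul x (k *: a + b) = k *: cmul x a + cmul x b;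
  cstarK : involutive cstar;
  cstar_lin : forall (k : Cplx R) a b,
    cstar (k *: a + b) = k^* *: cstar a + cstar b;
  cstarM : forall a b, cstar (cmul a b) = cmul (cstar b) (cstar a);
  cnormM : forall a b, `|cmul a b| <= `|a| * `|b|;
  cnorm_star : forall a, `|cmul (cstar a) a| = `|a| ^+ 2 }.

Section Cstar.
Variables (R : realType) (A : cstarAlgebra R).

Definition linear_functional (phi : A -> Cplx R) : Prop :=
  forall (k : Cplx R) a b, phi (k *: a + b) = k * phi a + phi b.

(* [sup] is [0] on unbounded sets, so [fun_norm phi = 1] entails that [phi] is
   bounded. *)
Definition fun_norm (phi : A -> Cplx R) : R :=
  sup [set cRe `|phi a| | a in [set a : A | `|a| <= 1]].

Definition state_space : set (A -> Cplx R) :=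
  [set phi | [/\ linear_functional phi,
                 forall a, 0 <= phi (cmul (cstar a) a) &
                 fun_norm phi = 1]].

Definition one_param_group (sigma : R -> A -> A) : Prop :=
  [/\ forall a, sigma 0 a = a,
      forall s t a, sigma (s + t) a = sigma s (sigma t a),
      forall t (k : Cplx R) a b, sigma t (k *: a + b) = k *: sigma t a + sigma t b,
      forall t, {morph sigma t : a b / cmul a b} /\ {morph sigma t : a / cstar a} &
      forall a, continuous (fun t : R => sigma t a)].

(* [b] is the (weak, or Pettis) integral of [h : R -> A]. *)
Definition is_weak_integral (h : R -> A) (b : A) : Prop :=
  forall omega : A -> Cplx R, linear_functional omega -> continuous omega ->
    cintegrable (fun t => omega (h t)) /\
    omega b = cintegral (fun t => omega (h t)).

(* The integrals [b] below always exist and are unique: [inv_fourier F] is a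
   Schwartz function and [t |-> sigma t a] is continuous and bounded. *)
Definition ground_states (sigma : R -> A -> A) : set (A -> Cplx R) :=
  [set phi | state_space phi /\
     forall F : R -> Cplx R,
       smooth F -> compact (fsupp F) -> fsupp F `<=` [set x | x < 0] ->
     forall a b : A,
       is_weak_integral (fun t => inv_fourier F t *: sigma t a) b ->
       phi (cmul (cstar b) b) = 0].

End Cstar.

Definition affine_iso (R : realType) (A B : Type)
    (S : set (A -> Cplx R)) (S' : set (B -> Cplx R))
    (Phi : (A -> Cplx R) -> (B -> Cplx R)) : Prop :=
  set_bij S S' Phi /\
  forall (t : R) psi1 psi2, 0 <= t <= 1 -> S psi1 -> S psi2 ->
    Phi (fun a => ofR t * psi1 a + ofR (1 - t) * psi2 a) =
    (fun b => ofR t * Phi psi1 b + ofR (1 - t) * Phi psi2 b).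

(* The operations are total; [gmul g h] is meaningful only if [src g = rng h]. *)
Record groupoidData := GroupoidData {
  arr : topologicalType;
  obj : topologicalType;
  src : arr -> obj;
  rng : arr -> obj;
  gmul : arr -> arr -> arr;
  ginv : arr -> arr }.

Definition groupoid_laws (G : groupoidData) (unit : obj G -> arr G) : Prop :=
  (forall x, src (unit x) = x /\ rng (unit x) = x) /\
  (forall g : arr G, gmul g (unit (src g)) = g /\ gmul (unit (rng g)) g = g) /\
  (forall g h : arr G, src g = rng h ->
     src (gmul g h) = src h /\ rng (gmul g h) = rng g) /\
  (forall g h k : arr G, src g = rng h -> src h = rng k ->
     gmul g (gmul h k) = gmul (gmul g h) k) /\
  (forall g : arr G, src (ginv g) = rng g /\ rng (ginv g) = src g) /\
  (forall g : arr G, gmul (ginv g) g = unit (src g) /\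
                     gmul g (ginv g) = unit (rng g)).

Definition topological_groupoid (G : groupoidData) : Prop :=
  continuous (@src G) /\ continuous (@rng G) /\ continuous (@ginv G) /\
  {within [set p : arr G * arr G | src p.1 = rng p.2],
     continuous (fun p : arr G * arr G => gmul p.1 p.2)} /\
  exists2 unit : obj G -> arr G, groupoid_laws unit & continuous unit.

Definition local_homeo (S T : topologicalType) (f : S -> T) : Prop :=
  continuous f /\
  forall x, exists U : set S,
    [/\ open U, U x, {in U &, injective f} &
        forall V, open V -> V `<=` U -> open (f @` V)].

Definition etale_groupoid (G : groupoidData) : Prop :=
  [/\ locally_compact [set: arr G], @second_countable (arr G),
      hausdorff_space (arr G), topological_groupoid G &
      local_homeo (@src G) /\ local_homeo (@rng G)].

Section GroupoidAlgebra.
Variables (R : realType) (G : groupoidData).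
Notation C := (Cplx R).

Definition Cc : set (arr G -> C) :=
  [set f | continuous f /\ compact (fsupp f)].

(* The sum has finitely many nonzero terms when [G] is etale and [f1] is in
   [Cc]. *)
Definition conv (f1 f2 : arr G -> C) : arr G -> C :=
  fun g => \sum_(h \in [set h | rng h = rng g]) f1 h * f2 (gmul (ginv h) g).

Definition invol (f : arr G -> C) : arr G -> C := fun g => (f (ginv g))^*.

Definition cstar_seminorm (p : (arr G -> C) -> R) : Prop :=
  (forall f, Cc f -> 0 <= p f) /\
  (forall f1 f2, Cc f1 -> Cc f2 -> p (fun g => f1 g + f2 g) <= p f1 + p f2) /\
  (forall (k : C) f, Cc f -> p (fun g => k * f g) = cRe `|k| * p f) /\
  (forall f1 f2, Cc f1 -> Cc f2 -> p (conv f1 f2) <= p f1 * p f2) /\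
  (forall f, Cc f -> p (conv (invol f) f) = p f ^+ 2).

(* [(A, iota)] is [C^*(G)], the Hausdorff completion of the *-algebra [C_c(G)]
   in its largest C*-seminorm, and [iota] is the canonical map; the values of
   [iota] outside [Cc] are irrelevant. *)
Definition is_groupoid_Cstar (A : cstarAlgebra R) (iota : (arr G -> C) -> A)
    : Prop :=
  (forall (k : C) f1 f2, Cc f1 -> Cc f2 ->
     iota (fun g => k * f1 g + f2 g) = k *: iota f1 + iota f2) /\
  (forall f1 f2, Cc f1 -> Cc f2 ->
     iota (conv f1 f2) = cmul (iota f1) (iota f2)) /\
  (forall f, Cc f -> iota (invol f) = cstar (iota f)) /\
  dense (iota @` Cc) /\
  (forall p, cstar_seminorm p -> forall f, Cc f -> ofR (p f) <= `|iota f|).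

(* [sigma] is the dynamics [sigma^c] on [A = C^*(G)]. *)
Definition is_cocycle_dynamics (A : cstarAlgebra R) (iota : (arr G -> C) -> A)
    (c : arr G -> R) (sigma : R -> A -> A) : Prop :=
  one_param_group sigma /\
  forall t f, Cc f -> sigma t (iota f) = iota (fun g => expi (t * c g) * f g).

Definition boundary_set (c : arr G -> R) : set (obj G) :=
  [set x | forall g, rng g = x -> c g <= 0].

Definition reduction (Z : set (obj G)) : set (arr G) :=
  [set g | Z (rng g) /\ Z (src g)].

Definition boundary_groupoid (c : arr G -> R) : set (arr G) :=
  reduction (boundary_set c).

End GroupoidAlgebra.

Arguments Cc {R G}.

Definition continuous_action (Gam : groupType) (X : topologicalType)
    (act : Gam -> X -> X) : Prop :=
  [/\ forall x, act 1%g x = x,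
      forall g h x, act (g * h)%g x = act g (act h x) &
      forall g, continuous (act g)].

Section Box.
Variables (Gam : groupType) (X : topologicalType) (act : Gam -> X -> X).

Definition boxset (L : set Gam) (W : set X) : set (discrete_topology Gam * X) :=
  [set p | [/\ L p.1, W p.2 & W (act p.1 p.2)]].

Variables (L : set Gam) (W : set X).
Notation B := (boxset L W).

Lemma box_src_subproof (p : set_type B) : (val p).2 \in W.
Proof. by rewrite inE; have := set_valP p; case. Qed.

Lemma box_rng_subproof (p : set_type B) : act (val p).1 (val p).2 \in W.
Proof. by rewrite inE; have := set_valP p; case. Qed.

Definition box_src (p : set_type B) : set_type W :=
  exist _ (val p).2 (box_src_subproof p).

Definition box_rng (p : set_type B) : set_type W :=
  exist _ (act (val p).1 (val p).2) (box_rng_subproof p).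

(* [insubd p u] is [u] if [u] lies in [Lambda ⊠ W], which is the case for
   composable pairs (resp. inverses) when [L] is a subgroup and [act] an action,
   and the junk value [p] otherwise. *)
Definition box_mul (p q : set_type B) : set_type B :=
  insubd p (((val p).1 * (val q).1)%g : discrete_topology Gam, (val q).2).

Definition box_inv (p : set_type B) : set_type B :=
  insubd p (((val p).1^-1)%g : discrete_topology Gam, act (val p).1 (val p).2).

(* All topologies are induced from [Gam * X] with [Gam] discrete; the
   transformation groupoid [Gam * X] itself is [box setT setT]. *)
Definition box : groupoidData :=
  @GroupoidData (set_type B) (set_type W) box_src box_rng box_mul box_inv.

End Box.

Section BoxData.
Variables (R : realType) (Gam : groupType) (X : topologicalType).
Variables (act : Gam -> X -> X) (N : Gam -> R) (Y : set X).

Definition kerN : set Gam := [set g | N g = 1].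

Definition log_cocycle (p : arr (box act setT Y)) : R := ln (N (set_val p).1).

Definition Yzero : set X :=
  Y `\` \bigcup_(g in [set g | 1 < N g]) (act g @` Y).

Lemma boxset_ker_sub : boxset act kerN Yzero `<=` boxset act setT Y.
Proof. by move=> p [_ [? _] [? _]]. Qed.

Definition box_incl (p : arr (box act kerN Yzero)) : arr (box act setT Y) :=
  exist _ (val p) (mem_set (boxset_ker_sub (set_valP p))).

Definition restrict_ker (f : arr (box act setT Y) -> Cplx R) :
    arr (box act kerN Yzero) -> Cplx R :=
  fun p => f (box_incl p).

End BoxData.

(* Main.v *)
Require Import Defs.
From HB Require Import structures.
From mathcomp Require Import all_boot all_order all_algebra.
From mathcomp Require Import complex.
From mathcomp Require Import all_classical all_reals all_analysis.
From mathcomp Require Import measurable_realfun.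
From mathcomp Require Import ring lra.

(** Every [f] in [C_c (L ⊠ W)] is a finite sum of functions [el g a] supported on
    one slice [{g} * W], so that a functional on [C_c] is the restriction of a
    state of the full C*-algebra iff it is positive and its values on the squares
    of cutoff functions have supremum [1]: from such a functional one recovers a
    state because the GNS construction yields a C*-seminorm that dominates it.

    The element [el g a] is an eigenvector of the dynamics with frequency
    [ln (N g)]. By Fourier inversion a state is therefore a ground state iff it
    vanishes on [(el g a)^* * el g a] whenever [N g < 1].

    Such a state sees only [(ker N) ⊠ Y0]. On [C_c(Y)] it vanishes on functions
    supported in [Y `&` g^-1 Y] with [N g < 1], and [Y0] is what remains of [Y]
    after these sets are removed. By Cauchy-Schwarz it vanishes on [el g a] for
    [N g <> 1]. Conversely, restriction to [(ker N) ⊠ Y0] preserves positivity: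
    in [(f^* * f)|], with [f] the sum of the [el g_i a_i], the products of
    [el g_i a_i] and [el g_j a_j] with [N g_i <> N g_j] disappear, and the rest,
    cut along disjoint pieces of the ranges [g_l Y], is a sum of squares
    [w_l^* * w_l] in [C_c ((ker N) ⊠ Y0)]. *)

Import Order.TTheory GRing.Theory Num.Theory.
Import numFieldNormedType.Exports.

Set Implicit Arguments.
Unset Strict Implicit.
Unset Printing Implicit Defensive.

Local Open Scope classical_set_scope.
Local Open Scope ring_scope.

(** * Complex numbers *)

(** [is_groupoid_Cstar] offers only density of [C_c] and maximality of the norm. To extend a
    functional it must be shown that left multiplication is bounded for its form, and this uses
    explicit square roots of coefficients. Norm estimates inside a C*-algebra rest on one
    construction, a self-adjoint [w] with [(1 + w)^2 = 1 - a^2], which stands in for functional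
    calculus and does not leave the algebra.

    Since [Y] is clopen, its indicator is continuous and products of slices stay in [C_c]. But [Y0]
    is merely closed: a function vanishing on [Y0] need not vanish near it, which forces a
    truncation at height [eps], and functions on the boundary groupoid are handled through
    coefficients defined on all of [X].

    The norm of a state is a supremum, with no unit at which to read it off. Cutoff functions act as
    an approximate unit, and the two cutoff conditions of [algebraic_state] pass through
    restriction, lifting and convex combination.

    On the Fourier side two facts suffice: the integral vanishes off the support, and it is nonzero
    at the centre of a bump. *)

Section ComplexNumbers.
Context {R : realType}.
Notation C := (Cplx R).
Implicit Types (z w : C) (x y : R).

Definition iC : C := (0 +i* 1)%C.
Definition cmod z : R := cRe `|z|.

Lemma cplxP z w : cRe z = cRe w -> cIm z = cIm w -> z = w.
Proof. by case: z w => a b [c d] /= -> ->. Qed.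
Lemma cplxE z : z = ofR (cRe z) + iC * ofR (cIm z).
Proof. exact: complexE. Qed.
Lemma cReD z w : cRe (z + w) = cRe z + cRe w. Proof. by case: z w => a b []. Qed.
Lemma cImD z w : cIm (z + w) = cIm z + cIm w. Proof. by case: z w => a b []. Qed.
Lemma cReN z : cRe (- z) = - cRe z. Proof. by case: z. Qed.
Lemma cImN z : cIm (- z) = - cIm z. Proof. by case: z. Qed.
Lemma cReM z w : cRe (z * w) = cRe z * cRe w - cIm z * cIm w.
Proof. by case: z w => a b []. Qed.
Lemma cImM z w : cIm (z * w) = cRe z * cIm w + cIm z * cRe w.
Proof. by case: z w => a b []. Qed.
Lemma cReofR x : cRe (ofR x) = x. Proof. by []. Qed.
Lemma cImofR x : cIm (ofR x) = 0. Proof. by []. Qed.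
Lemma cRe_conj z : cRe z^* = cRe z. Proof. by case: z. Qed.
Lemma cIm_conj z : cIm z^* = - cIm z. Proof. by case: z. Qed.
Lemma cRe0 : cRe (0 : C) = 0. Proof. by []. Qed.
Lemma cIm0 : cIm (0 : C) = 0. Proof. by []. Qed.
Lemma cRe1 : cRe (1 : C) = 1. Proof. by []. Qed.
Lemma cIm1 : cIm (1 : C) = 0. Proof. by []. Qed.
Lemma ofRD x y : ofR (x + y) = ofR x + ofR y. Proof. exact: rmorphD. Qed.
Lemma ofRB x y : ofR (x - y) = ofR x - ofR y. Proof. exact: rmorphB. Qed.
Lemma ofRM x y : ofR (x * y) = ofR x * ofR y. Proof. exact: rmorphM. Qed.
Lemma ofR0 : ofR (0 : R) = 0. Proof. by []. Qed.
Lemma ofR1 : ofR (1 : R) = 1. Proof. by []. Qed.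
Lemma conj_ofR x : (ofR x)^* = ofR x. Proof. exact: conjc_real. Qed.
Lemma ofR_inj : injective (@ofR R). Proof. by move=> x y []. Qed.

Definition cRIE := (cReD, cImD, cReN, cImN, cReM, cImM, cReofR, cImofR,
  cRe_conj, cIm_conj, cRe0, cIm0, cRe1, cIm1).

Lemma ler_ofR x y : (ofR x <= ofR y) = (x <= y). Proof. exact: lecR. Qed.
Lemma ltr_ofR x y : (ofR x < ofR y) = (x < y). Proof. exact: ltcR. Qed.

Lemma normC_ofR z : `|z| = ofR (cmod z).
Proof. by rewrite /cmod normc_def. Qed.
Lemma cmodE z : cmod z = Num.sqrt (cRe z ^+ 2 + cIm z ^+ 2).
Proof. by rewrite /cmod normc_def. Qed.
Lemma cmod_ge0 z : 0 <= cmod z.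
Proof. by rewrite cmodE sqrtr_ge0. Qed.
Lemma cmodD z w : cmod (z + w) <= cmod z + cmod w.
Proof. by rewrite -ler_ofR ofRD -!normC_ofR ler_normD. Qed.
Lemma cmodM z w : cmod (z * w) = cmod z * cmod w.
Proof. by apply: ofR_inj; rewrite ofRM -!normC_ofR normrM. Qed.
Lemma cmodN z : cmod (- z) = cmod z.
Proof. by rewrite /cmod normrN. Qed.
Lemma cmod0 : cmod 0 = 0. Proof. by rewrite /cmod normr0. Qed.
Lemma cmod1 : cmod 1 = 1. Proof. by rewrite /cmod normr1. Qed.
Lemma cmod_eq0 z : cmod z = 0 -> z = 0.
Proof. by move=> h; apply/eqP; rewrite -normr_eq0 normC_ofR h. Qed.
Lemma cmod_ofR x : cmod (ofR x) = `|x|.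
Proof. by rewrite cmodE cReofR cImofR expr0n addr0 sqrtr_sqr. Qed.
Lemma cmod_sqr z : cmod z ^+ 2 = cRe z ^+ 2 + cIm z ^+ 2.
Proof. by rewrite cmodE sqr_sqrtr // addr_ge0 // sqr_ge0. Qed.
Lemma mulC_conj z : z^* * z = ofR (cmod z ^+ 2).
Proof. by apply: cplxP; rewrite !cRIE ?cmod_sqr; ring. Qed.
Lemma cRe_le_norm z : `|cRe z| <= cmod z.
Proof. by rewrite cmodE -sqrtr_sqr ler_wsqrtr // lerDl sqr_ge0. Qed.
Lemma cIm_le_norm z : `|cIm z| <= cmod z.
Proof. by rewrite cmodE -sqrtr_sqr ler_wsqrtr // lerDr sqr_ge0. Qed.
Lemma cmod_iC : cmod iC = 1.
Proof. by rewrite cmodE /= /cRe /cIm /= expr0n expr1n add0r sqrtr1. Qed.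
Lemma cmod_le z : cmod z <= `|cRe z| + `|cIm z|.
Proof.
rewrite {1}[z]cplxE (le_trans (cmodD _ _)) // cmodM cmod_iC mul1r.
by rewrite !cmod_ofR.
Qed.
Lemma iC_sqr : iC * iC = -1.
Proof. by apply: cplxP; rewrite !cRIE /cRe /cIm /=; ring. Qed.
Lemma conj_iC : iC^* = - iC.
Proof. by apply: cplxP; rewrite !cRIE /cRe /cIm /= ?oppr0. Qed.
Lemma cge0P z : 0 <= z <-> 0 <= cRe z /\ cIm z = 0.
Proof.
rewrite lecE; split=> [/andP[/eqP h ?]|[? h]]; first by split.
by apply/andP; split => //; apply/eqP.
Qed.
Lemma cge0E z : 0 <= z -> z = ofR (cRe z).
Proof. by move/cge0P => [_ h]; apply: cplxP. Qed.

Lemma ball_ofR z x w : ball z (ofR x) w <-> cmod (z - w) < x.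
Proof. by rewrite -ball_normE /= normC_ofR ltr_ofR. Qed.

(** Balls of [C] have radii in [C]; a positive element of [C] is real, so real radii suffice. *)
Lemma nbhsC_P z (P : set C) :
  nbhs z P <-> exists2 e : R, 0 < e & forall w, cmod (z - w) < e -> P w.
Proof.
split=> [/nbhs_ballP [e /= e0 he]|[e e0 he]].
  have eE : e = ofR (cRe e) by apply: cge0E; exact: ltW.
  exists (cRe e); first by rewrite -ltr_ofR -eE.
  by move=> w hw; apply: he; rewrite eE; apply/ball_ofR.
apply/nbhs_ballP; exists (ofR e); first by rewrite /= -(ltr_ofR 0) in e0 *.
by move=> w /ball_ofR; exact: he.
Qed.

Lemma continuous_cRe : continuous (@cRe R).
Proof.
move=> z; apply/(@cvgrPdist_lt _ R^o _ (nbhs z) (nbhs_filter z)) => e e0; apply/nbhsC_P; exists e => // w hw.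
by apply: le_lt_trans hw; rewrite -cReN -cReD; exact: cRe_le_norm.
Qed.
Lemma continuous_cIm : continuous (@cIm R).
Proof.
move=> z; apply/(@cvgrPdist_lt _ R^o _ (nbhs z) (nbhs_filter z)) => e e0; apply/nbhsC_P; exists e => // w hw.
by apply: le_lt_trans hw; rewrite -cImN -cImD; exact: cIm_le_norm.
Qed.
Lemma cmod_dist z w : `|cmod z - cmod w| <= cmod (z - w).
Proof.
have h u v : cmod u - cmod v <= cmod (u - v).
  by rewrite lerBlDr; have := cmodD (u - v) v; rewrite subrK.
rewrite ler_norml h andbT lerNl opprB (le_trans (h _ _)) //.
by rewrite -cmodN opprB.
Qed.
Lemma continuous_cmod : continuous cmod.
Proof.
move=> z; apply/(@cvgrPdist_lt _ R^o _ (nbhs z) (nbhs_filter z)) => e e0.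
by apply/nbhsC_P; exists e => // w; apply: le_lt_trans; exact: cmod_dist.
Qed.

Section Continuity.
Context {T : topologicalType}.
Implicit Types f : T -> C.

Lemma cvgC_P (F : set_system T) {FF : Filter F} f z :
  (@cRe R \o f) @ F --> cRe z -> (@cIm R \o f) @ F --> cIm z -> f @ F --> z.
Proof.
move=> hr hi P /nbhsC_P [e e0 hP].
have e2 : 0 < e / 2 by rewrite divr_gt0.
move/cvgrPdist_lt : hr => /(_ _ e2); move/cvgrPdist_lt : hi => /(_ _ e2).
apply: filterS2 => t /= h1 h2; apply: hP; apply: le_lt_trans (cmod_le _) _.
by rewrite !cRIE (splitr e) ltrD.
Qed.

Lemma continuousC_P f :
  continuous (@cRe R \o f) -> continuous (@cIm R \o f) -> continuous f.
Proof. by move=> hr hi t; apply: cvgC_P; [exact: hr|exact: hi]. Qed.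

Lemma continuous_ofR_comp (f : T -> R) : continuous f -> continuous (@ofR R \o f).
Proof. by move=> cf; apply: continuousC_P => //= x; exact: cvg_cst. Qed.

Lemma continuous_conj_comp f : continuous f -> continuous (fun t => (f t)^*).
Proof.
move=> cf; apply: continuousC_P.
  rewrite (_ : _ \o _ = @cRe R \o f); last by apply/funext => t /=; rewrite cRe_conj.
  by move=> t; apply: continuous_comp; [exact: cf|exact: continuous_cRe].
rewrite (_ : _ \o _ = (fun t => - cIm (f t))); last by apply/funext => t /=; rewrite cIm_conj.
move=> t; apply: (@cvgN _ R^o); apply: (continuous_comp (f := f)); first exact: cf.
exact: continuous_cIm.
Qed.

Lemma continuous_mulC f g : continuous f -> continuous g ->
  continuous (fun t => f t * g t).
Proof. by move=> cf cg t; apply: cvgM; [exact: cf|exact: cg]. Qed.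
Lemma continuous_addC f g : continuous f -> continuous g ->
  continuous (fun t => f t + g t).
Proof. by move=> cf cg t; apply: cvgD; [exact: cf|exact: cg]. Qed.
End Continuity.
End ComplexNumbers.

(** The positive expression has imaginary part zero at [l = 1], which relates the imaginary parts of
    [z1] and [z2], and at [l = iC], which relates their real parts. *)
Lemma hermitian_of_ge0 (R : realType) (p q z1 z2 : Cplx R) :
  0 <= p -> 0 <= q ->
  (forall l, 0 <= p + l * z1 + l^* * z2 + l^* * l * q) -> z2 = z1^*.
Proof.
move=> /cge0P[p0 pi] /cge0P[q0 qi] h.
have /cge0P[_] := h 1; have /cge0P[_] := h iC.
rewrite !cRIE /= pi qi /cRe /cIm /=; case: z1 z2 {h} => a b [c d] /=.
move=> h1 h2; apply: cplxP; rewrite !cRIE /cRe /cIm /=; lra.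
Qed.

(** Along [l = t * z1^*] with [t] real, the hypothesis becomes a real quadratic inequality in
    [t]. *)
Lemma cauchy_schwarz_of_ge0 (R : realType) (p q z1 z2 : Cplx R) :
  0 <= p -> 0 <= q ->
  (forall l, 0 <= p + l * z1 + l^* * z2 + l^* * l * q) ->
  cmod z1 ^+ 2 <= cRe p * cRe q.
Proof.
move=> hp hq h; have z2E := hermitian_of_ge0 hp hq h.
move: hp hq => /cge0P[p0 pi] /cge0P[q0 qi].
have {}h (t : R) : 0 <= cRe p + 2 * t * cmod z1 ^+ 2
    + t ^+ 2 * (cmod z1 ^+ 2) * cRe q.
  have /cge0P[+ _] := h (ofR t * z1^*); rewrite z2E cmod_sqr !cRIE ?pi ?qi.
  by congr (_ <= _); ring.
(* For [q = 0] the expression is affine in [t] with slope [2 * n], so it takes negative values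
   unless [n = 0]. *)
have [q00|qn0] := eqVneq (cRe q) 0.
  rewrite q00 mulr0; set n := _ ^+ 2 in h *.
  have [->//|nn0] := eqVneq n 0.
  have := h (- (cRe p + 1) / n); rewrite q00 mulr0 addr0.
  have -> : 2 * (- (cRe p + 1) / n) * n = - 2 * (cRe p + 1) by field.
  by move=> ?; lra.
have {}q0 : 0 < cRe q by rewrite lt_neqAle eq_sym qn0.
(* The minimum of the quadratic is attained at this [t]. *)
have := h (- (cRe q)^-1); set n := _ ^+ 2.
have -> : cRe p + 2 * - (cRe q)^-1 * n + (- (cRe q)^-1) ^+ 2 * n * cRe q =
  cRe p - n / cRe q by field.
by rewrite subr_ge0 ler_pdivrMr.
Qed.

(** * Locally compact Hausdorff spaces *)

Section LocallyCompactHausdorff.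
Context {R : realType} {X : topologicalType}.
Hypothesis X_lc : locally_compact [set: X].
Hypothesis X_haus : hausdorff_space X.
Let opc := one_point_compactification X.

(** A locally compact Hausdorff space need not be normal; Urysohn and Tietze are applied in its
    one-point compactification, which is. *)
Lemma opc_normal : normal_space opc.
Proof.
apply: compact_normal; first exact: one_point_compactification_hausdorff.
exact: one_point_compactification_compact.
Qed.

Lemma closed_opc_image (K : set X) : compact K -> closed (Some @` K : set opc).
Proof.
move=> cK; apply: compact_closed.
  exact: one_point_compactification_hausdorff.
apply: continuous_compact cK; apply: continuous_subspaceT.
exact: one_point_compactification_some_continuous.
Qed.

(** A closed set missing the point at infinity avoids a neighbourhood of it, hence lies in a compact
    subset of [X]. *)
Lemma compact_opc_preimage (D : set opc) :
  closed D -> ~ D None -> compact ((Some : X -> opc) @^-1` D).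
Proof.
move=> cD DN; have oD : open (~` D) by rewrite openC.
have := open_nbhs_nbhs (conj oD DN); rewrite {1}/nbhs /= => -[U [cU _] UD].
apply: subclosed_compact cU _.
  apply: preimage_closed => // x _.
  exact: one_point_compactification_some_continuous.
move=> x Dx; apply: contrapT => Ux.
by apply: (UD (Some x)) Dx; left; exists x.
Qed.

Lemma urysohn_compact (K : set X) : compact K ->
  exists e : X -> R, [/\ continuous e, forall x, 0 <= e x <= 1,
    forall x, K x -> e x = 1 &
    exists2 K', compact K' & forall x, ~ K' x -> e x = 0].
Proof.
move=> cK.
have [||f [cf f0 f1 f01]] := @urysohn_ext_itv opc R opc_normal [set None]
  (Some @` K) 0 1 _ (closed_opc_image cK) _ ltr01.
- apply: accessible_closed_set1; apply: hausdorff_accessible.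
  exact: one_point_compactification_hausdorff.
- by rewrite -subset0 => -[x|] [] // _ [].
have {}f0 : f None = 0 by apply: f0; exists None.
have {}f1 x : K x -> f (Some x) = 1.
  by move=> Kx; apply: f1; exists (Some x) => //; exists x.
have {}f01 y : 0 <= f y <= 1.
  by have := f01 (f y); rewrite /= in_itv; apply; exists y.
(* Vanishing at infinity does not give compact support. Doubling and truncating kills the function
   where [f] is at most one half; what remains lies in a closed set that avoids infinity. *)
exists (fun x => Num.max 0 (2 * f (Some x) - 1)); split.
- move=> x; apply: (@continuous_max R X (fun=> 0)); first exact: cvg_cst.
  apply: (@cvgB _ R^o); last exact: cvg_cst.
  apply: cvgM; first exact: cvg_cst.
  apply: (continuous_comp (f := (Some : X -> opc))); last exact: cf.
  exact: one_point_compactification_some_continuous.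
- move=> x; rewrite le_max lexx /= ge_max ler01 /=.
  by have /andP[_ ?] := f01 (Some x); lra.
- by move=> x /f1 ->; rewrite (_ : 2 * 1 - 1 = 1); [rewrite max_r|ring].
exists ((Some : X -> opc) @^-1` (f @^-1` [set r | 2^-1 <= r])).
  apply: compact_opc_preimage => /=; last by rewrite f0; apply/negP; rewrite -ltNge.
  by apply: preimage_closed => [? _|]; [exact: cf|exact: closed_ge].
move=> x /= /negP; rewrite -ltNge => h; rewrite max_l //; lra.
Qed.

(** The image of [D] need not be closed in the compactification. So [f] is extended from the part of
    [D] in a compact set off which a cutoff vanishes; the cutoff is [1] on [K], and multiplying by
    it preserves the values on [D]. *)
Lemma tietze_compact (D K : set X) (f : X -> R) :
  closed D -> {within D, continuous f} -> compact K ->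
  (forall x, D x -> ~ K x -> f x = 0) ->
  exists g : X -> R, [/\ continuous g, forall x, D x -> g x = f x &
    exists2 K', compact K' & forall x, ~ K' x -> g x = 0].
Proof.
move=> cD cf cK f0; have [e [ce e01 e1 [K' cK' e0]]] := urysohn_compact cK.
pose F (o : opc) : R := if o is Some x then f x else 0.
have cDK : compact (D `&` K') by rewrite setIC; exact: compact_closedI.
pose E : set opc := Some @` (D `&` K').
have cE : closed E by exact: closed_opc_image.
have cfDK : {within D `&` K', continuous f}.
  by apply: continuous_subspaceW cf => x [].
have [M [_ fM]] : bounded_set (f @` (D `&` K')).
  by apply: compact_bounded; exact: continuous_compact.
pose M' := Num.max 1 (M + 1).
have M'0 : 0 < M' by rewrite lt_max ltr01.
have {}fM x : (D `&` K') x -> `|f x| <= M'.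
  move=> h; apply: (fM M'); last by exists x.
  by rewrite /M' lt_max; apply/orP; right; rewrite ltrDl.
have cF : {within E, continuous F}.
  apply/subspace_continuousP => o -[x Dx <-].
  move/subspace_continuousP : cfDK => /(_ x Dx) cfx P /cfx.
  rewrite /nbhs /= /within /=; apply: filterS => y h [z Dz [zy]].
  by move: h; rewrite -zy => /(_ Dz).
have FM o : E o -> `|F o| <= M' by case=> x Dx <-; exact: fM.
have [G [GF cG _]] := @continuous_bounded_extension opc R opc_normal E cE F M'
  M'0 cF FM.
exists (fun x => e x * G (Some x)); split.
- move=> x; apply: cvgM; first exact: ce.
  apply: (continuous_comp (f := (Some : X -> opc))); last exact: cG.
  exact: one_point_compactification_some_continuous.
- move=> x Dx; have [K'x|nK'x] := pselect (K' x); last first.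
    rewrite e0 // mul0r f0 // => Kx; have := e1 _ Kx; rewrite e0 //.
    by move/eqP; rewrite eq_sym oner_eq0.
  rewrite -(GF (Some x)); last by rewrite inE; exists x.
  rewrite /F; have [Kx|nKx] := pselect (K x); first by rewrite e1 // mul1r.
  by rewrite f0 // mulr0.
by exists K' => // x nK; rewrite e0 // mul0r.
Qed.

End LocallyCompactHausdorff.

(** * Topology of subsets seen as types *)

Section SetType.
Context {T : topologicalType} {B : set T}.

Lemma nbhs_set_typeP (x : set_type B) (U : set (set_type B)) :
  nbhs x U <-> exists2 V : set T, nbhs (set_val x) V & set_val @^-1` V `<=` U.
Proof.
split=> [|[V nV VU]].
  rewrite nbhsE => -[W [[V oV <-] Wx] WU].
  by exists V => //; exists V => //; split.
apply: (filterS VU); exact: (@initial_continuous (set_type B) T set_val).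
Qed.

Lemma continuous_set_val : continuous (set_val : set_type B -> T).
Proof. exact: initial_continuous. Qed.

Lemma set_val_inj : injective (set_val : set_type B -> T).
Proof. exact: val_inj. Qed.

Lemma hausdorff_set_type : hausdorff_space T -> hausdorff_space (set_type B).
Proof.
move=> hT x y xy; apply: set_val_inj; apply: hT => U V nU nV.
have [z [Uz Vz]] : (set_val @^-1` U : set (set_type B)) `&` set_val @^-1` V !=set0.
  by apply: xy; apply: continuous_set_val.
by exists (set_val z).
Qed.

(** The cluster point found in [K] belongs to [B], because the filter lives on [B] and [B] is
    closed. *)
Lemma compact_set_type (K : set T) : closed B -> compact K ->
  compact (set_val @^-1` K : set (set_type B)).
Proof.
move=> cB cK F PF FK; have FK' : (set_val @ F) K by [].
have [p [Kp clp]] := cK _ (fmap_proper_filter _ PF) FK'.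
have Bp : B p.
  apply: cB => U nU; have [|q []] := clp B U _ nU; last by exists q.
  apply: (@filterS _ F _ setT); [by move=> z _; exact: set_valP|exact: filterT].
exists (exist _ p (mem_set Bp)); split => //= U V FU /nbhs_set_typeP [W nW WV].
have [|q [[z Uz zq] Wq]] := clp (set_val @` U) W _ nW.
  by apply: (@filterS _ F _ U) => // z Uz; exists z.
by exists z; split => //; apply: WV; rewrite /= zq.
Qed.

Lemma second_countable_set_type :
  @second_countable T -> @second_countable (set_type B).
Proof.
move=> [D cD [oD bD]].
exists ((fun U => set_val @^-1` U : set (set_type B)) @` D).
  exact: sub_countable (card_image_le _ _) cD.
split=> [_ [U DU <-]|x U /nbhs_set_typeP [V nV VU]].
  by apply: open_comp (oD _ DU) => x _; exact: continuous_set_val.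
have [W [DW Wx] WV] := bD _ _ nV.
exists (set_val @^-1` W); first by split => //; exists W.
by apply: subset_trans VU => y /WV.
Qed.

Lemma locally_compact_set_type : closed B -> locally_compact [set: T] ->
  locally_compact [set: set_type B].
Proof.
move=> cB lT x _; have [K] := lT (set_val x) I; rewrite withinET => Kx [cK clK].
exists (set_val @^-1` K); first by rewrite withinET; exact: continuous_set_val.
split; first exact: compact_set_type.
by apply: preimage_closed => // y _; exact: continuous_set_val.
Qed.

End SetType.

(** * Products with a discrete space *)

Section DiscreteProduct.
Context {I : choiceType} {X : topologicalType}.
Notation D := (discrete_topology I).

Lemma nbhs_discrete_prodP (p : D * X) (U : set (D * X)) :
  nbhs p U <-> exists2 V : set X, nbhs p.2 V & forall x, V x -> U (p.1, x).
Proof.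
split=> [[[P Q] /= [nP nQ] PQ]|[V nV VU]].
  exists Q => // x Qx; apply: PQ; split => //=.
  exact: nbhs_singleton nP.
exists ([set p.1], V) => /=; first by split => //; exact: discrete_set1.
by move=> [i x] /= [-> /VU].
Qed.

Lemma second_countable_discrete_prod : countable [set: I] ->
  @second_countable X -> @second_countable (D * X)%type.
Proof.
move=> cI [E cE [oE bE]].
exists ((fun q : I * set X => [set q.1] `*` q.2 : set (D * X)) @` ([set: I] `*` E)).
  by apply: sub_countable (card_image_le _ _) _; exact: countableX.
split=> [_ [[i U] /= [_ EU] <-]|p U /nbhs_discrete_prodP [V nV VU]].
  move: (oE _ EU); rewrite !openE => oU p [/= pi Up].
  apply/nbhs_discrete_prodP; exists U; first exact: oU.
  by move=> x Ux; split.
have [W [EW Wx] WV] := bE _ _ nV.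
exists ([set p.1] `*` W); first by split => //; exists (p.1, W).
by move=> [i x] [/= -> /WV/VU].
Qed.

Lemma locally_compact_discrete_prod : locally_compact [set: X] ->
  locally_compact [set: (D * X)%type].
Proof.
move=> lX [i x] _; have [K] := lX x Logic.I; rewrite withinET => Kx [cK clK].
exists ([set i] `*` K).
  by rewrite withinET; apply/nbhs_discrete_prodP; exists K.
split; first by apply: compact_setX => //; exact: compact_set1.
rewrite (_ : _ `*` _ = fst @^-1` [set i] `&` snd @^-1` K) //.
apply: closedI; apply: preimage_closed => //.
- by move=> ? _; exact: cvg_fst.
- exact: (@discrete_closed D).
- by move=> ? _; exact: cvg_snd.
Qed.

Lemma hausdorff_discrete_prod : hausdorff_space X -> hausdorff_space (D * X)%type.
Proof.
move=> hX [i x] [j y] xy.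
have h U V : nbhs x U -> nbhs y V -> i = j /\ U `&` V !=set0.
  move=> nU nV; have [||[k z] [[/= <- Uz] [<- Vz]]] := xy ([set i] `*` U) ([set j] `*` V).
  - by apply/nbhs_discrete_prodP; exists U.
  - by apply/nbhs_discrete_prodP; exists V.
  by split => //; exists z.
have [<- _] := h _ _ filterT filterT.
by congr (_, _); apply: hX => U V nU nV; have [] := h U V nU nV.
Qed.

End DiscreteProduct.

(** * The groupoids [L ⊠ W] *)

(* The situation common to the groupoids of the theorem: [L ⊠ W] is the
   reduction of [L ⊠ Y] to a closed subset [W] of [Y] that is invariant under
   the partial action of [L] on [Y]. *)
Record invariant_reduction (Gam : groupType) (X : topologicalType)
    (act : Gam -> X -> X) (Y : set X) (L : set Gam) (W : set X) : Prop := {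
  ir_lc : locally_compact [set: X];
  ir_haus : hausdorff_space X;
  ir_act : continuous_action act;
  ir_open : open Y;
  ir_closed : closed Y;
  ir_closedW : closed W;
  ir_sub : W `<=` Y;
  ir_1 : L 1%g;
  ir_M : forall g h, L g -> L h -> L (g * h)%g;
  ir_V : forall g, L g -> L g^-1%g;
  ir_inv : forall g w, L g -> W w -> Y (act g w) -> W (act g w) }.

Section Action.
Context {Gam : groupType} {X : topologicalType} (act : Gam -> X -> X).
Hypothesis act_cont : continuous_action act.

Lemma act1 x : act 1%g x = x. Proof. by case: act_cont. Qed.
Lemma actM g h x : act (g * h)%g x = act g (act h x). Proof. by case: act_cont. Qed.
Lemma act_continuous g : continuous (act g). Proof. by case: act_cont. Qed.
Lemma actK g x : act g^-1%g (act g x) = x. Proof. by rewrite -actM mulVg act1. Qed.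
Lemma actVK g x : act g (act g^-1%g x) = x. Proof. by rewrite -actM mulgV act1. Qed.
End Action.

Section Box.
Context {Gam : groupType} {X : topologicalType} (act : Gam -> X -> X).
Context (L : set Gam) (W : set X).
Notation G := (box act L W).
Implicit Types p q : arr G.

Definition gam p : Gam := (set_val p).1.
Definition pt p : X := (set_val p).2.

Lemma gamP p : L (gam p). Proof. by case: (set_valP p). Qed.
Lemma ptP p : W (pt p). Proof. by case: (set_valP p). Qed.
Lemma actP p : W (act (gam p) (pt p)). Proof. by case: (set_valP p). Qed.

Lemma arr_inj p q : gam p = gam q -> pt p = pt q -> p = q.
Proof.
move=> h1 h2; apply: val_inj; rewrite [LHS]surjective_pairing.
by rewrite [RHS]surjective_pairing; congr (_, _).
Qed.

Definition mkarr g x (gL : L g) (xW : W x) (gxW : W (act g x)) : arr G :=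
  exist _ (g : discrete_topology Gam, x) (mem_set (And3 gL xW gxW)).

Lemma gam_mkarr g x gL xW gxW : gam (@mkarr g x gL xW gxW) = g. Proof. by []. Qed.
Lemma pt_mkarr g x gL xW gxW : pt (@mkarr g x gL xW gxW) = x. Proof. by []. Qed.

Lemma nbhs_arrP p U : nbhs p U <->
  exists2 V, nbhs (pt p) V & forall q, gam q = gam p -> V (pt q) -> U q.
Proof.
split=> [/nbhs_set_typeP [V /nbhs_discrete_prodP [V' nV' V'V] VU]|[V nV VU]].
  exists V' => // q qp V'q; apply: VU => /=.
  by have := V'V _ V'q; rewrite -[X in V (X, _)]qp -surjective_pairing.
apply/nbhs_set_typeP; exists [set z | z.1 = (set_val p).1 /\ V z.2].
  by apply/nbhs_discrete_prodP; exists V.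
by move=> q [qp Vq]; exact: VU.
Qed.

Lemma src_val p : set_val (src p) = pt p. Proof. by []. Qed.
Lemma rng_val p : set_val (rng p) = act (gam p) (pt p). Proof. by []. Qed.
Lemma objP (x y : obj G) : set_val x = set_val y -> x = y.
Proof. exact: val_inj. Qed.

Context {Y : set X} (ir : invariant_reduction act Y L W).
Let ac := ir_act ir.

(** Composability and closure of [L] under products place the product in the box, so that [insubd]
    returns it. *)
Lemma gmulE p q : src p = rng q ->
  gam (gmul p q) = (gam p * gam q)%g /\ pt (gmul p q) = pt q.
Proof.
move=> /(congr1 set_val); rewrite src_val rng_val => pq.
rewrite /gam /pt; suff -> : set_val (gmul p q) = ((gam p * gam q)%g : discrete_topology Gam, pt q).
  by [].
rewrite /= /box_mul /= set_valE val_insubd ifT // inE; split => /=.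
- by apply: ir_M; [exact: ir|exact: gamP|exact: gamP].
- exact: ptP.
- by rewrite actM // -pq; exact: actP.
Qed.

Lemma ginvE p : gam (ginv p) = (gam p)^-1%g /\ pt (ginv p) = act (gam p) (pt p).
Proof.
rewrite /gam /pt; suff -> : set_val (ginv p) =
  (((gam p)^-1)%g : discrete_topology Gam, act (gam p) (pt p)) by [].
rewrite /= /box_inv /= set_valE val_insubd ifT // inE; split => /=.
- by apply: ir_V; [exact: ir|exact: gamP].
- exact: actP.
- by rewrite actK //; exact: ptP.
Qed.

Lemma box_unit_subproof (x : obj G) : W (act 1%g (set_val x)).
Proof. by rewrite act1 //; exact: set_valP. Qed.

Definition box_unit (x : obj G) : arr G :=
  mkarr (ir_1 ir) (set_valP x) (box_unit_subproof x).

Lemma box_groupoid_laws : groupoid_laws box_unit.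
Proof.
split=> [x|].
  by split; apply: objP; rewrite ?rng_val /= ?gam_mkarr ?pt_mkarr ?act1.
split=> [g|].
  have h1 : src g = rng (box_unit (src g)) by apply: objP; rewrite rng_val /= act1.
  have h2 : src (box_unit (rng g)) = rng g by apply: objP.
  have [h3 h4] := gmulE h1; have [h5 h6] := gmulE h2.
  by split; apply: arr_inj; rewrite ?h3 ?h4 ?h5 ?h6 ?gam_mkarr ?mulg1 ?mul1g.
have srcmul (g h : arr G) : src g = rng h -> src (gmul g h) = src h.
  by move=> gh; have [_ h2] := gmulE gh; apply: objP.
have rngmul (g h : arr G) : src g = rng h -> rng (gmul g h) = rng g.
  move=> gh; have [h1 h2] := gmulE gh; apply: objP; rewrite rng_val h1 h2 actM //.
  by rewrite -rng_val -gh.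
split=> [g h gh|]; first by rewrite srcmul // rngmul.
split=> [g h k gh hk|].
  have h1 : src g = rng (gmul h k) by rewrite rngmul.
  have h2 : src (gmul g h) = rng k by rewrite srcmul.
  have [e1 e2] := gmulE gh; have [e3 e4] := gmulE hk.
  have [e5 e6] := gmulE h1; have [e7 e8] := gmulE h2.
  by apply: arr_inj; rewrite ?e5 ?e6 ?e7 ?e8 ?e1 ?e3 ?e4 ?mulgA.
split=> g.
  have [e1 e2] := ginvE g; split; apply: objP; first by rewrite src_val e2.
  by rewrite rng_val e1 e2 actK.
have [e1 e2] := ginvE g.
have h1 : src (ginv g) = rng g by apply: objP; rewrite src_val e2.
have h2 : src g = rng (ginv g) by apply: objP; rewrite rng_val e1 e2 actK.
have [e3 e4] := gmulE h1; have [e5 e6] := gmulE h2.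
split; apply: arr_inj; rewrite ?e3 ?e4 ?e5 ?e6 ?e1 ?e2 ?gam_mkarr ?mulVg ?mulgV //.
Qed.

Lemma continuous_src : continuous (@src G).
Proof.
move=> p U /nbhs_set_typeP [V nV VU].
by apply/nbhs_arrP; exists V => // q _ Vq; exact: VU.
Qed.

Lemma continuous_rng : continuous (@rng G).
Proof.
move=> p U /nbhs_set_typeP [V nV VU]; apply/nbhs_arrP.
exists (act (gam p) @^-1` V); first exact: act_continuous.
by move=> q qp Vq; apply: VU => /=; rewrite rng_val qp.
Qed.

Lemma continuous_ginv : continuous (@ginv G).
Proof.
move=> p U /nbhs_arrP [V]; have [e1 e2] := ginvE p; rewrite e1 e2 => nV VU.
apply/nbhs_arrP; exists (act (gam p) @^-1` V); first exact: act_continuous.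
move=> q qp Vq; apply: VU => /=; have [e3 e4] := ginvE q; rewrite ?e3 ?e4 qp //.
Qed.

Lemma box_topological_groupoid : topological_groupoid G.
Proof.
split; first exact: continuous_src.
split; first exact: continuous_rng.
split; first exact: continuous_ginv.
split.
  apply/subspace_continuousP => -[p q] /= pq U /= /nbhs_arrP [V].
  have [e1 e2] := gmulE pq; rewrite e1 e2 => nV VU.
  exists ([set p' | gam p' = gam p], [set q' | gam q' = gam q /\ V (pt q')]).
    by split; apply/nbhs_arrP; [exists setT => //; exact: filterT|exists V].
  move=> [p' q'] [/= pp [qq Vq]] pq'; apply: VU => /=.
    by have [-> _] := gmulE pq'; rewrite pp qq.
  by have [_ ->] := gmulE pq'.
exists box_unit; first exact: box_groupoid_laws.
move=> x U /nbhs_arrP [V nV VU]; apply/nbhs_set_typeP; exists V => // y Vy.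
exact: VU.
Qed.

(** [W] need not be open in [X], but by invariance a point of [W] is sent by [g] into [W] as soon as
    it is sent into the open set [Y]. The domain of the partial action is thus relatively open. *)
Lemma open_obj_fix g (V : set X) : L g -> open V ->
  open [set x : obj G | V (set_val x) /\ W (act g (set_val x))].
Proof.
move=> Lg; rewrite !openE => oV x /= [Vx Wx]; apply/nbhs_set_typeP.
exists (V `&` act g @^-1` Y).
  apply: filterI; first exact: oV.
  apply: act_continuous => //; apply: open_nbhs_nbhs.
  by split; [exact: ir_open ir|exact: ir_sub ir _ Wx].
move=> y [Vy Yy]; split=> //; apply: (ir_inv ir) => //; exact: set_valP.
Qed.

(** The open slice over a fixed group element serves as the neighbourhood: the source is injective
    there, and [open_obj_fix] makes its images open. *)
Lemma box_local_homeo_src : local_homeo (@src G).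
Proof.
split; first exact: continuous_src.
move=> p; exists [set q | gam q = gam p]; split => //.
- rewrite openE => q qp; apply/nbhs_arrP; exists setT; first exact: filterT.
  by move=> q' /= ->.
- move=> q q'; rewrite !inE => /= qp q'p /(congr1 set_val); rewrite !src_val.
  by apply: arr_inj; rewrite qp q'p.
move=> V oV VU; rewrite openE => _ [q Vq <-].
have : nbhs q V by apply: open_nbhs_nbhs.
move=> /nbhs_arrP [V' + V'V]; rewrite nbhsE => -[V2 [oV2 V2q] V2V'].
exists [set x : obj G | V2 (set_val x) /\ W (act (gam q) (set_val x))].
  split; first by apply: open_obj_fix => //; exact: gamP.
  by split=> //; exact: actP.
move=> x [V2x Wx]; exists (mkarr (gamP q) (set_valP x) Wx); last exact: objP.
by apply: V'V => //; exact: V2V'.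
Qed.

Lemma local_homeo_comp_inv (S T U : topologicalType) (f : S -> T) (i : U -> S)
    (j : S -> U) : continuous i -> continuous j -> cancel i j -> cancel j i ->
  local_homeo f -> local_homeo (f \o i).
Proof.
move=> ci cj ij ji [cf hf]; split.
  by move=> x; apply: continuous_comp; [exact: ci|exact: cf].
move=> x; have [V [oV Vx injV homV]] := hf (i x).
exists (i @^-1` V); split => //.
- by apply: open_comp oV => y _; exact: ci.
- move=> y z; rewrite !inE => Vy Vz /= /injV; rewrite !inE => /(_ Vy Vz).
  by move/(congr1 j); rewrite !ij.
move=> O oO OV; rewrite -image_comp; apply: homV.
  rewrite (_ : i @` O = j @^-1` O); first by apply: open_comp oO => y _; exact: cj.
  apply/seteqP; split=> [_ [y Oy <-]|s Os] /=; first by rewrite ij.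
  by exists (j s).
by move=> _ [y Oy <-]; exact: OV.
Qed.

(** The range is the source composed with inversion, a homeomorphism. *)
Lemma box_local_homeo_rng : local_homeo (@rng G).
Proof.
have srcinv (p : arr G) : src (ginv p) = rng p.
  by have [_ e2] := ginvE p; apply: objP; rewrite src_val e2.
have invK : cancel (@ginv G) (@ginv G).
  move=> p; have [e1 e2] := ginvE p; have [e3 e4] := ginvE (ginv p).
  by apply: arr_inj; rewrite ?e3 ?e4 e1 ?invgK ?e2 ?actK.
rewrite (_ : @rng G = @src G \o @ginv G); last by apply/funext => p; rewrite -srcinv.
by apply: local_homeo_comp_inv box_local_homeo_src => //; exact: continuous_ginv.
Qed.

Lemma closed_boxset : closed (boxset act L W).
Proof.
move=> [g x] clp; have gL : L g.
  have [|q [[? _ _] /= [<- _]]] := clp ([set g] `*` setT) => //.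
  by apply/nbhs_discrete_prodP; exists setT => //; exact: filterT.
have h (V : set X) : nbhs x V -> exists y, [/\ V y, W y & W (act g y)].
  move=> nV; have [|[k y] [[/= _ Wy Wky] [/= <- Vy]]] := clp ([set g] `*` V).
    by apply/nbhs_discrete_prodP; exists V.
  by exists y.
split => //=.
  by apply: (ir_closedW ir) => V /h [y [? ? _]]; exists y.
apply: (ir_closedW ir) => V /(act_continuous ac) /h [y [? _ ?]].
by exists (act g y).
Qed.

Lemma box_etale : countable [set: Gam] -> @second_countable X ->
  etale_groupoid G.
Proof.
move=> cG sX; split.
- apply: locally_compact_set_type; first exact: closed_boxset.
  by apply: locally_compact_discrete_prod; exact: ir_lc ir.
- by apply: second_countable_set_type; exact: second_countable_discrete_prod.
- by apply: hausdorff_set_type; apply: hausdorff_discrete_prod; exact: ir_haus ir.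
- exact: box_topological_groupoid.
- by split; [exact: box_local_homeo_src|exact: box_local_homeo_rng].
Qed.

End Box.

(** * The convolution algebra *)

Section CompactlySupported.
Context {R : realType} {X : topologicalType}.
Notation C := (Cplx R).
Implicit Types (a b : X -> C).

(** Coefficients live on all of [X] instead of [W], so that one function serves for several slices
    and for both groupoids. *)
Definition cc (a : X -> C) : Prop :=
  continuous a /\ exists2 K, compact K & forall x, ~ K x -> a x = 0.

Definition ind (Y : set X) (x : X) : C := (x \in Y)%:R.

Lemma ind1 Y x : Y x -> ind Y x = 1. Proof. by move=> h; rewrite /ind mem_set. Qed.
Lemma ind0 Y x : ~ Y x -> ind Y x = 0. Proof. by move=> h; rewrite /ind memNset. Qed.
Lemma ind_idem Y x : ind Y x * ind Y x = ind Y x.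
Proof. by rewrite /ind; case: (x \in Y); rewrite ?mulr1 ?mulr0. Qed.
Lemma conj_ind Y x : (ind Y x)^* = ind Y x.
Proof. by rewrite /ind; case: (x \in Y); rewrite ?rmorph1 ?rmorph0. Qed.

Lemma continuous_ind Y : open Y -> closed Y -> continuous (ind Y).
Proof.
move=> oY cY x P nP; rewrite nbhs_simpl /=.
have [Yx|nYx] := pselect (Y x).
  have : nbhs x Y by apply: open_nbhs_nbhs.
  apply: filterS => y Yy /=; rewrite ind1 //; rewrite ind1 // in nP.
  exact: nbhs_singleton nP.
have : nbhs x (~` Y) by apply: open_nbhs_nbhs; split => //; rewrite openC.
apply: filterS => y Yy /=; rewrite ind0 //; rewrite ind0 // in nP.
exact: nbhs_singleton nP.
Qed.

Lemma cc0 : cc (fun=> 0).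
Proof. by split; [move=> x; exact: cvg_cst|exists set0 => //; exact: compact0]. Qed.

Lemma ccD a b : cc a -> cc b -> cc (fun x => a x + b x).
Proof.
move=> [ca [K cK a0]] [cb [K' cK' b0]]; split; first exact: continuous_addC.
exists (K `|` K'); first exact: compactU.
by move=> x nK; rewrite a0 ?b0 ?addr0 // => ?; apply: nK; [right|left].
Qed.

Lemma ccMl a b : continuous a -> cc b -> cc (fun x => a x * b x).
Proof.
move=> ca [cb [K cK b0]]; split; first exact: continuous_mulC.
by exists K => // x /b0 ->; rewrite mulr0.
Qed.

Lemma ccMr a b : cc a -> continuous b -> cc (fun x => a x * b x).
Proof.
move=> [ca [K cK b0]] cb; split; first exact: continuous_mulC.
by exists K => // x /b0 ->; rewrite mul0r.
Qed.

Lemma ccZ k a : cc a -> cc (fun x => k * a x).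
Proof. by apply: ccMl => x; exact: cvg_cst. Qed.

Lemma cc_conj a : cc a -> cc (fun x => (a x)^*).
Proof.
move=> [ca [K cK b0]]; split; first exact: continuous_conj_comp.
by exists K => // x /b0 ->; rewrite conjC0.
Qed.

Lemma cc_comp a (h h' : X -> X) : continuous h -> continuous h' ->
  cancel h h' -> cc a -> cc (fun x => a (h x)).
Proof.
move=> ch ch' hK [ca [K cK a0]]; split.
  by move=> x; apply: continuous_comp; [exact: ch|exact: ca].
exists (h' @` K); first by apply: continuous_compact => //; exact: continuous_subspaceT.
by move=> x nK; apply: a0 => Khx; apply: nK; exists (h x).
Qed.

Lemma cc_bounded a : cc a -> exists2 M : R, 0 < M & forall x, cmod (a x) <= M.
Proof.
move=> [ca [K cK a0]].
have [M [_ hM]] : bounded_set ((fun x => cmod (a x) : R^o) @` K).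
  apply: compact_bounded; apply: continuous_compact => //.
  apply: continuous_subspaceT => x; apply: continuous_comp; first exact: ca.
  exact: continuous_cmod.
exists (Num.max 1 (M + 1)); first by rewrite lt_max ltr01.
move=> x; have [Kx|/a0 ->] := pselect (K x).
  rewrite -[leLHS]ger0_norm ?cmod_ge0 //; apply: hM; last by exists x.
  by rewrite lt_max; apply/orP; right; rewrite ltrDl.
by rewrite cmod0 le_max ler01.
Qed.

End CompactlySupported.

Lemma urysohn_cc (R : realType) (X : topologicalType) (K : set X) :
  locally_compact [set: X] -> hausdorff_space X -> compact K ->
  exists e : X -> R, [/\ cc (fun x => ofR (e x)), continuous e,
    forall x, 0 <= e x <= 1 & forall x, K x -> e x = 1].
Proof.
move=> lX hX cK; have [e [ce e01 e1 [K' cK' e0]]] := urysohn_compact (R := R) lX hX cK.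
exists e; split => //; split; first exact: continuous_ofR_comp.
by exists K' => // x /e0 ->.
Qed.

Lemma tietze_cc (R : realType) (X : topologicalType) (D K : set X) (f : X -> Cplx R) :
  locally_compact [set: X] -> hausdorff_space X ->
  closed D -> {within D, continuous f} -> compact K ->
  (forall x, D x -> ~ K x -> f x = 0) ->
  exists2 a, cc a & forall x, D x -> a x = f x.
Proof.
move=> lX hX cD cf cK f0.
have [||g [cg gE [K1 cK1 g0]]] := @tietze_compact R X lX hX D K
    (fun x => cRe (f x)) cD _ cK _.
- move=> x; apply: (continuous_comp (f := f : subspace D -> _)); first exact: cf.
  exact: continuous_cRe.
- by move=> x Dx Kx; rewrite f0.
have [||h [ch hE [K2 cK2 h0]]] := @tietze_compact R X lX hX D K
    (fun x => cIm (f x)) cD _ cK _.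
- move=> x; apply: (continuous_comp (f := f : subspace D -> _)); first exact: cf.
  exact: continuous_cIm.
- by move=> x Dx Kx; rewrite f0.
exists (fun x => ofR (g x) + iC * ofR (h x)).
  apply: ccD; last apply: ccZ.
    by split; [exact: continuous_ofR_comp|exists K1 => // x /g0 ->].
  by split; [exact: continuous_ofR_comp|exists K2 => // x /h0 ->].
by move=> x Dx; rewrite gE // hE // -cplxE.
Qed.

Section ConvolutionAlgebra.
Context {R : realType} {Gam : groupType} {X : topologicalType}.
Context (act : Gam -> X -> X) (Y : set X) (L : set Gam) (W : set X).
Notation C := (Cplx R).
Notation G := (box act L W).
Implicit Types (p : arr G) (f : arr G -> C) (g : Gam) (a : X -> C).

(** In crossed product notation this is [u_g a]: the coefficient is read at the source of the
    arrow. *)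
Definition elem g a : arr G -> C := fun p => if gam p == g then a (pt p) else 0.

(** This describes [C_c] by generators; its induction principle reduces statements linear in a
    function to one slice. *)
Inductive span : (arr G -> C) -> Prop :=
| span0 : span (fun=> 0)
| spanD g a f : L g -> cc a -> span f -> span (fun p => elem g a p + f p).

Lemma eq_elem g a b : (forall y, W y -> W (act g y) -> a y = b y) -> elem g a = elem g b.
Proof.
move=> ab; apply/funext => p; rewrite /elem; case: eqP => // gp.
by apply: ab; [exact: (ptP p)|rewrite -gp; exact: (actP p)].
Qed.

Lemma elem0 g : elem g (fun=> 0) = fun=> 0.
Proof. by apply/funext => p; rewrite /elem; case: ifP. Qed.

Lemma elemD g a b p : elem g (fun y => a y + b y) p = elem g a p + elem g b p.
Proof. by rewrite /elem; case: ifP => //; rewrite addr0. Qed.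

Lemma elemZ k g a p : elem g (fun y => k * a y) p = k * elem g a p.
Proof. by rewrite /elem; case: ifP => //; rewrite mulr0. Qed.

Lemma span_elem g a : L g -> cc a -> span (elem g a).
Proof.
move=> Lg ca; have := spanD Lg ca span0; congr span.
by apply/funext => p; rewrite addr0.
Qed.

Lemma span_add f1 f2 : span f1 -> span f2 -> span (fun p => f1 p + f2 p).
Proof.
move=> + s2; elim=> [|g a f Lg ca sf IH].
  by have := s2; congr span; apply/funext => p; rewrite add0r.
have := spanD Lg ca IH; congr span; apply/funext => p; exact: addrA.
Qed.

Lemma span_scale k f : span f -> span (fun p => k * f p).
Proof.
elim=> [|g a h Lg ca sf IH].
  by have := span0; congr span; apply/funext => p; rewrite mulr0.
have := spanD Lg (ccZ k ca) IH; congr span; apply/funext => p.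
by rewrite elemZ mulrDr.
Qed.

Context (ir : invariant_reduction act Y L W).
Let ac := ir_act ir.

Lemma cc_act g a : cc a -> cc (fun x => a (act g x)).
Proof.
apply: (@cc_comp _ _ _ _ (act g^-1%g)); [exact: act_continuous|exact: act_continuous|].
by move=> x; rewrite actK.
Qed.

Lemma continuous_indY g : continuous (fun x => ind Y (act g x) : C).
Proof.
move=> x; apply: (continuous_comp (f := act g)); first exact: act_continuous.
by apply: continuous_ind; [exact: ir_open ir|exact: ir_closed ir].
Qed.

Lemma elem_Cc g a : cc a -> Cc (elem g a).
Proof.
move=> [ca [K cK a0]]; split.
  move=> p U nU; have [gp|gp] := eqVneq (gam p) g; last first.
    apply/nbhs_arrP; exists setT; first exact: filterT.
    move=> q qp _ /=; rewrite /elem qp (negbTE gp).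
    by have := nbhs_singleton nU; rewrite /elem (negbTE gp).
  apply/nbhs_arrP; exists (a @^-1` U).
    by apply: ca; have := nU; rewrite /elem gp eqxx.
  by move=> q qp Uq /=; rewrite /elem qp gp eqxx.
pose K' := [set g : discrete_topology Gam] `*` K.
have cK' : compact (set_val @^-1` K' : set (arr G)).
  apply: compact_set_type; first exact: closed_boxset ir.
  by apply: compact_setX => //; exact: compact_set1.
have clK' : closed (set_val @^-1` K' : set (arr G)).
  apply: compact_closed => //; apply: hausdorff_set_type.
  by apply: hausdorff_discrete_prod; exact: ir_haus ir.
apply: subclosed_compact cK' _; first exact: closed_closure.
rewrite [X in _ `<=` X](closure_id _).1 //; apply: closure_subset => p /=.
rewrite /elem; case: (gam p =P g) => [gp ap|_]; last by rewrite eqxx.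
split => //; apply: contrapT => /a0; rewrite /pt in ap => h.
by rewrite h eqxx in ap.
Qed.

Lemma Cc_add f1 f2 : Cc f1 -> Cc f2 -> Cc (fun p => f1 p + f2 p).
Proof.
move=> [c1 k1] [c2 k2]; split; first exact: (continuous_addC c1 c2).
apply: (subclosed_compact _ (compactU k1 k2)); first exact: closed_closure.
rewrite -closureU; apply: closure_subset => p /=.
have [-> |h1 _] := eqVneq (f1 p) 0; last by left.
by rewrite add0r; right.
Qed.

Lemma Cc0 : Cc (fun _ : arr G => 0 : C).
Proof. by rewrite -(elem0 1%g); apply: elem_Cc; exact: cc0. Qed.

Lemma span_Cc f : span f -> Cc f.
Proof. by elim=> [|g a h _ ca _]; [exact: Cc0|apply: Cc_add; exact: elem_Cc]. Qed.

(** The sources of the arrows over [g] form a closed subset [D] of [X], from which Tietze extends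
    the restriction of [f]. *)
Lemma Cc_fiber f g : Cc f -> L g ->
  exists2 a, cc a & forall p, gam p = g -> a (pt p) = f p.
Proof.
move=> [cf kf] Lg; pose D := W `&` act g @^-1` W.
pose F y : C := if pselect (D y) is left h then f (mkarr Lg h.1 h.2) else 0.
have FE p : gam p = g -> F (pt p) = f p.
  move=> gp; rewrite /F; case: pselect => [h|[]].
    by congr f; apply: arr_inj.
  by split; [exact: (ptP p)|rewrite /= -gp; exact: (actP p)].
have cg : closed [set p : arr G | gam p = g].
  rewrite -openC openE => p /= gp; apply/nbhs_arrP.
  by exists setT; [exact: filterT|move=> q /= ->].
have cK : compact ((@pt _ _ act L W) @` (fsupp f `&` [set p | gam p = g])).
  apply: continuous_compact; last exact: compact_closedI.
  apply: continuous_subspaceT => p U nU.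
  by apply/nbhs_arrP; exists U.
have [] := tietze_cc (ir_lc ir) (ir_haus ir) (D := D) (f := F) _ _ cK.
- apply: closedI; first exact: ir_closedW ir.
  by apply: preimage_closed => [x _|]; [exact: act_continuous|exact: ir_closedW ir].
- apply/subspace_continuousP => x [Wx Wgx] U.
  have := FE (mkarr Lg Wx Wgx) erefl; rewrite /from_subspace /= => -> nU.
  have /nbhs_arrP [V nV VU] := cf _ _ nU.
  rewrite /= /nbhs /= /within /=; apply: filterS nV => y Vy [Wy Wgy].
  have := FE (mkarr Lg Wy Wgy) erefl; rewrite /from_subspace /= => ->.
  exact: VU.
- move=> x [Wx Wgx] nK; have := FE (mkarr Lg Wx Wgx) erefl.
  rewrite pt_mkarr => ->; apply: contrapT => /eqP h; apply: nK.
  by exists (mkarr Lg Wx Wgx) => //; split => //; exact: subset_closure.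
move=> a ca aF; exists a => // p gp; rewrite -FE // aF //.
by split; [exact: (ptP p)|rewrite /= -gp; exact: (actP p)].
Qed.

Lemma Cc_finite_gam f : Cc f ->
  exists s : seq Gam, forall p, f p != 0 -> gam p \in s.
Proof.
move=> [cf /compact_near_coveringP kf].
(* Along finite lists ordered by inclusion, the covering form of compactness yields one list that
   works on the whole support; near a point only the open slice through it matters. *)
pose F := filter_from setT (fun s0 : seq Gam => [set s : seq Gam | {subset s0 <= s}]).
have FF : Filter F.
  apply: filter_from_filter; first by exists [::].
  move=> s1 s2 _ _; exists (s1 ++ s2) => // s ss.
  by split=> x xs; apply: ss; rewrite mem_cat xs ?orbT.
have [|s0 _ /(_ s0)] := kf _ F (fun s p => gam p \in s) FF.
  move=> p _; exists ([set q | gam q = gam p], [set s : seq Gam | gam p \in s]).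
    split; first by apply/nbhs_arrP; exists setT => //; exact: filterT.
    by exists [:: gam p] => // s; apply; rewrite inE.
  by move=> [q s] [/= -> ].
move=> /(_ (fun _ h => h)) h; exists s0 => p fp.
by apply: h; exact: subset_closure.
Qed.

Lemma CcP f : Cc f <-> span f.
Proof.
split=> [cf|]; last exact: span_Cc.
have [s fs] := Cc_finite_gam cf.
suff : span (fun p => if gam p \in s then f p else 0).
  congr span; apply/funext => p; case: ifP => // /negbT ps; apply/esym/eqP.
  by apply: contraNT ps; exact: fs.
(* Slices are added one at a time; an index that is repeated or lies outside [L] contributes
   nothing. *)
elim: {fs} s => [|g s IH]; first exact: span0.
have [Lg|nLg] := pselect (L g); last first.
  move: IH; congr span; apply/funext => p; rewrite in_cons.
  by case: eqP => // gp; case: nLg; rewrite -gp; exact: gamP.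
have [a ca aE] := Cc_fiber cf Lg.
have [gs|gs] := boolP (g \in s).
  by move: IH; congr span; apply/funext => p; rewrite in_cons; case: eqP => // ->; rewrite gs.
have := spanD Lg ca IH; congr span; apply/funext => p; rewrite in_cons /elem.
by case: eqP => [gp|_]; rewrite ?add0r // gp (negbTE gs) addr0 aE.
Qed.

End ConvolutionAlgebra.

(** * Convolution and involution computed on slices *)

Section ConvolutionIdentities.
Context {R : realType} {Gam : groupType} {X : topologicalType}.
Context {act : Gam -> X -> X} {Y : set X} {L : set Gam} {W : set X}.
Context (ir : invariant_reduction act Y L W).
Notation C := (Cplx R).
Notation G := (box act L W).
Notation el := (@elem R Gam X act L W).
(* [convex.v] also defines a [conv]. *)
Notation conv := Defs.conv.
Implicit Types (p : arr G) (f : arr G -> C) (g : Gam) (a : X -> C).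
Let ac := ir_act ir.

Lemma fiber_inj (h k : arr G) : rng h = rng k -> gam h = gam k -> h = k.
Proof.
move=> /(congr1 set_val); rewrite !rng_val => hk ghk; apply: arr_inj => //.
by rewrite -(actK ac (gam h) (pt h)) hk ghk actK.
Qed.

Lemma finite_fiber f (x : obj G) : span f ->
  finite_set [set h : arr G | rng h = x /\ f h != 0].
Proof.
elim=> [|g a k Lg ca _ IH].
  by rewrite (_ : [set _ | _] = set0) // -subset0 => h [_]; rewrite eqxx.
apply: (@sub_finite_set _ _ ([set h : arr G | rng h = x /\ gam h = g] `|`
    [set h : arr G | rng h = x /\ k h != 0])).
  move=> h [hx]; rewrite /elem; case: (gam h =P g) => [gh _|_]; first by left.
  by rewrite add0r; right.
rewrite finite_setU; split => //.
have [[h [hx hg]]|none] := pselect (exists h : arr G, rng h = x /\ gam h = g).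
  apply: (@sub_finite_set _ _ [set h]); last exact: finite_set1.
  by move=> k' [kx kg]; apply: fiber_inj; rewrite ?kx ?kg.
by rewrite (_ : [set _ | _] = set0) // -subset0 => h hh; apply: none; exists h.
Qed.

(** The freedom in [S] allows several convolutions to be written over one common finite set, as
    additivity requires. *)
Lemma convE f1 f2 p (S : set (arr G)) : finite_set S ->
  (forall h, S h -> rng h = rng p) ->
  (forall h, rng h = rng p -> f1 h != 0 -> S h) ->
  conv f1 f2 p = \sum_(h \in S) f1 h * f2 (gmul (ginv h) p).
Proof.
move=> finS S1 S2; rewrite /conv; apply/esym; apply: fsbig_widen => //.
move=> h [/= hp nS]; have [->|/(S2 _ hp)//] := eqVneq (f1 h) 0.
by rewrite mul0r.
Qed.

Lemma conv_addl f1 f2 f : span f1 -> span f2 ->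
  conv (fun p => f1 p + f2 p) f = fun p => conv f1 f p + conv f2 f p.
Proof.
move=> s1 s2; apply/funext => p.
pose S := [set h : arr G | rng h = rng p /\ f1 h != 0] `|`
  [set h | rng h = rng p /\ f2 h != 0].
have finS : finite_set S by rewrite finite_setU; split; exact: finite_fiber.
have S1 h : S h -> rng h = rng p by case=> -[].
rewrite !(convE _ finS) // => [|h hp f0|h hp f0|h hp f0].
- by rewrite -fsbig_split //; apply: eq_fsbigr => h _; rewrite mulrDl.
- by right.
- by left.
- have [f10|] := eqVneq (f1 h) 0; last by left.
  by right; rewrite f10 add0r in f0.
Qed.

Lemma conv_addr f f1 f2 : span f ->
  conv f (fun p => f1 p + f2 p) = fun p => conv f f1 p + conv f f2 p.
Proof.
move=> sf; apply/funext => p.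
rewrite !(convE _ (finite_fiber (rng p) sf)) => [|h []|h|h []|h|h []|h] //.
by rewrite -fsbig_split //; [apply: eq_fsbigr => h _; rewrite mulrDr|exact: finite_fiber].
Qed.

Lemma conv_scalel k f1 f2 : conv (fun p => k * f1 p) f2 = fun p => k * conv f1 f2 p.
Proof.
apply/funext => p; rewrite /conv mulr_fsumr.
by apply: eq_fsbigr => h _; rewrite mulrA.
Qed.

Lemma conv_scaler k f1 f2 : conv f1 (fun p => k * f2 p) = fun p => k * conv f1 f2 p.
Proof.
apply/funext => p; rewrite /conv mulr_fsumr.
by apply: eq_fsbigr => h _; rewrite mulrCA.
Qed.

Lemma conv0l f : conv (fun=> 0) f = fun=> 0 :> C.
Proof.
apply/funext => p; rewrite (convE _ (finite_set0 (arr G))) ?fsbig_set0 //.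
by move=> h _; rewrite eqxx.
Qed.

Lemma conv0r f : conv f (fun=> 0) = fun=> 0 :> C.
Proof.
have := conv_scaler 0 f (fun=> 0).
rewrite (_ : (fun=> 0 * 0) = (fun=> 0 : C)); last by rewrite mul0r.
by move=> ->; apply/funext => p; rewrite mul0r.
Qed.

(** An arrow over [g1 * g2] with source [y] factors only through [act g2 y], which has to lie in
    [W]. For [y] in [W], invariance makes this equivalent to lying in [Y]; the indicator of [Y] is
    continuous on [X], which that of [W] need not be. *)
Lemma conv_el g1 g2 a b : L g1 -> L g2 ->
  conv (el g1 a) (el g2 b) =
  el (g1 * g2)%g
    (fun y => a (act g2 y) * ind Y (act g2 y) * b y).
Proof.
move=> L1 L2; apply/funext => p.
(* The only source that a left factor over [g1] can have. *)
pose z := act g1^-1%g (act (gam p) (pt p)).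
have [Wz|nWz] := pselect (W z); last first.
  rewrite (convE _ (finite_set0 (arr G))) //; last first.
    move=> h hp; rewrite /elem; case: (gam h =P g1) => [gh _|_]; last by rewrite eqxx.
    apply: nWz; move/(congr1 set_val): hp; rewrite !rng_val /z => <-.
    by rewrite gh actK //; exact: ptP.
  rewrite fsbig_set0 /elem; case: (gam p =P _) => // gp; rewrite ind0 ?mulr0 ?mul0r //.
  move=> Yz; apply: nWz; rewrite /z gp actM // actK //.
  by apply: (ir_inv ir) => //; exact: ptP.
have Wgz : W (act g1 z) by rewrite /z actVK //; exact: (actP p).
pose h0 : arr G := mkarr L1 Wz Wgz.
have h0p : rng h0 = rng p by apply: objP; rewrite !rng_val /= /z actVK.
rewrite (convE _ (finite_set1 h0)) => [|h -> //|h hp]; last first.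
  rewrite /elem; case: (gam h =P g1) => [gh _|_]; last by rewrite eqxx.
  by apply: fiber_inj; rewrite ?h0p.
have [e1 e2] := ginvE ir h0.
have ih : src (ginv h0) = rng p by apply: objP; rewrite src_val e2 -rng_val h0p.
have [e3 e4] := gmulE ir ih.
rewrite fsbig_set1 /elem e3 e4 e1 /= gam_mkarr eqxx pt_mkarr.
have -> : ((g1^-1 * gam p)%g == g2) = (gam p == (g1 * g2)%g).
  by apply/eqP/eqP => [<-|->]; rewrite mulgA ?mulgV ?mulVg mul1g.
case: eqP => [gp|_]; last by rewrite mulr0.
have zE : z = act g2 (pt p) by rewrite /z gp actM // actK.
by rewrite zE ind1 ?mulr1 // -zE; exact: ir_sub ir _ Wz.
Qed.

Lemma invol_el g a : invol (el g a) =
  el (g^-1)%g (fun y => (a (act g^-1%g y))^*).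
Proof.
apply/funext => p; rewrite /invol /elem; have [-> ->] := ginvE ir p.
have -> : ((gam p)^-1%g == g) = (gam p == g^-1%g).
  by apply/eqP/eqP => [<-|->]; rewrite invgK.
by case: eqP => [->//|_]; rewrite conjC0.
Qed.

Lemma involD f1 f2 :
  invol (fun p => f1 p + f2 p) = fun p => invol f1 p + invol f2 p.
Proof. by apply/funext => p; rewrite /invol rmorphD. Qed.

Lemma involZ k f : invol (fun p => k * f p) = fun p => k^* * invol f p.
Proof. by apply/funext => p; rewrite /invol rmorphM. Qed.

Lemma ginvK : involutive (@ginv G).
Proof.
move=> p; have [e1 e2] := ginvE ir p; have [e3 e4] := ginvE ir (ginv p).
by apply: arr_inj; rewrite ?e3 ?e4 e1 ?invgK ?e2 ?actK.
Qed.

Lemma involK f : invol (invol f) = f.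
Proof. by apply/funext => p; rewrite /invol ginvK conjCK. Qed.

Lemma invol0 : invol (fun=> 0) = fun _ : arr G => 0 :> C.
Proof. by apply/funext => p; rewrite /invol conjC0. Qed.

Lemma cc_invol g a : cc a -> cc (fun y => (a (act g y))^*).
Proof. by move=> ca; apply: cc_conj; exact: (cc_act ir). Qed.

Lemma cc_conv g a b : cc a -> cc b ->
  cc (fun y => a (act g y) * ind Y (act g y) * b y).
Proof.
move=> ca cb; apply: ccMr; last by case: cb.
by apply: ccMr; [exact: (cc_act ir)|exact: (continuous_indY ir)].
Qed.

Lemma span_invol f : span f -> span (invol f).
Proof.
elim=> [|g a h Lg ca _ IH]; first by rewrite invol0; exact: span0.
rewrite involD invol_el; apply: spanD => //; last exact: cc_invol.
exact: (ir_V ir).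
Qed.

Lemma span_conv_el g a f : L g -> cc a -> span f -> span (conv (el g a) f).
Proof.
move=> Lg ca; elim=> [|g2 b h Lg2 cb _ IH].
  by rewrite conv0r; exact: span0.
rewrite conv_addr; last exact: span_elem.
rewrite conv_el //; apply: spanD => //; last exact: cc_conv.
exact: (ir_M ir).
Qed.

Lemma span_conv f1 f2 : span f1 -> span f2 -> span (conv f1 f2).
Proof.
move=> + s2; elim=> [|g a h Lg ca sh IH]; first by rewrite conv0l; exact: span0.
rewrite conv_addl //; last exact: span_elem.
by apply: span_add => //; exact: span_conv_el.
Qed.

(** Both sides are trilinear; three inductions leave an identity between products of
    coefficients. *)
Lemma conv_assoc f1 f2 f3 : span f1 -> span f2 -> span f3 ->
  conv (conv f1 f2) f3 = conv f1 (conv f2 f3).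
Proof.
move=> s1 s2 s3; elim: s1 => [|g1 a1 h1 L1 c1 s1 IH1]; first by rewrite !conv0l.
have e1 := span_elem act W L1 c1.
rewrite (conv_addl _ e1 s1) conv_addl; [|exact: span_conv|exact: span_conv].
rewrite [RHS]conv_addl // IH1; suff -> : conv (conv (el g1 a1) f2) f3 =
  conv (el g1 a1) (conv f2 f3) by [].
elim: s2 => [|g2 a2 h2 L2 c2 s2 IH2]; first by rewrite conv0r // conv0l conv0r.
have e2 := span_elem act W L2 c2.
rewrite conv_addr // conv_addl; [|exact: span_conv|exact: span_conv].
rewrite [in RHS](conv_addl _ e2 s2) [RHS]conv_addr //.
rewrite IH2; suff -> : conv (conv (el g1 a1) (el g2 a2)) f3 =
  conv (el g1 a1) (conv (el g2 a2) f3) by [].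
elim: s3 => [|g3 a3 h3 L3 c3 s3 IH3].
  by rewrite !conv0r.
have e3 := span_elem act W L3 c3.
rewrite conv_addr; last exact: span_conv.
rewrite [in RHS](conv_addr _ _ e2) [RHS]conv_addr // IH3.
suff -> : conv (conv (el g1 a1) (el g2 a2)) (el g3 a3) =
  conv (el g1 a1) (conv (el g2 a2) (el g3 a3)) by [].
have L12 := ir_M ir L1 L2; have L23 := ir_M ir L2 L3.
rewrite !conv_el // mulgA; apply: eq_elem => y _ _.
by rewrite actM //; ring.
Qed.

Lemma invol_conv f1 f2 : span f1 -> span f2 ->
  invol (conv f1 f2) = conv (invol f2) (invol f1).
Proof.
move=> s1 s2; elim: s1 => [|g1 a1 h1 L1 c1 s1 IH1].
  by rewrite conv0l !invol0 conv0r.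
have e1 := span_elem act W L1 c1.
rewrite conv_addl // involD IH1 involD conv_addr; last exact: span_invol.
suff -> : invol (conv (el g1 a1) f2) = conv (invol f2) (invol (el g1 a1)) by [].
elim: s2 => [|g2 a2 h2 L2 c2 s2 IH2].
  by rewrite conv0r // !invol0 conv0l.
have e2 := span_elem act W L2 c2.
rewrite conv_addr // involD IH2 involD conv_addl; [|exact: span_invol|exact: span_invol].
suff -> : invol (conv (el g1 a1) (el g2 a2)) =
  conv (invol (el g2 a2)) (invol (el g1 a1)) by [].
rewrite conv_el // !invol_el conv_el; [|exact: ir_V ir _ L2|exact: ir_V ir _ L1].
rewrite invgM; apply: eq_elem => y _ _.
rewrite !rmorphM /= conj_ind !actM // !actVK //; ring.
Qed.

(** Any coefficient equal to [1] on a large enough compact set acts as an exact unit on a given [f],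
    which replaces limits along an approximate unit. *)
Lemma local_unit f : span f -> exists2 K, compact K &
  forall e : X -> C, cc e -> (forall x, K x -> e x = 1) ->
    conv (el 1%g e) f = f /\ conv f (el 1%g e) = f.
Proof.
elim=> [|g a h Lg ca sh [K cK IH]].
  by exists set0; [exact: compact0|move=> e ce _; rewrite conv0l conv0r].
have [_ [K1 cK1 a0]] := ca.
(* A right unit is read at sources, hence [K1]; a left unit at ranges, hence the image of [K1] under
   [g]. *)
exists (K `|` (K1 `|` act g @` K1)).
  apply: compactU => //; apply: compactU => //; apply: continuous_compact cK1.
  by apply: continuous_subspaceT; exact: act_continuous.
move=> e ce e1; have [h1 h2] := IH e ce (fun x Kx => e1 x (or_introl Kx)).
have L1 := ir_1 ir; have s1 := span_elem act W L1 ce; have sg := span_elem act W Lg ca.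
rewrite conv_addr // conv_addl // h1 h2 !conv_el // mulg1 mul1g.
have Wind y : W y -> ind Y y = 1 :> C by move=> /(ir_sub ir)/ind1.
split; apply/funext => p; congr (_ + _); congr (_ p); apply: eq_elem => y Wy Wgy.
  rewrite Wind // mulr1; have [Ky|/a0 ->] := pselect (K1 y); last by rewrite mulr0.
  by rewrite e1 ?mul1r //; right; right; exists y.
rewrite act1 // Wind // mulr1; have [Ky|/a0 ->] := pselect (K1 y).
  by rewrite e1 ?mulr1 //; right; left.
by rewrite mul0r.
Qed.

End ConvolutionIdentities.

(** * States of the convolution algebra *)

Section Functionals.
Context {R : realType} {Gam : groupType} {X : topologicalType}.
Context {act : Gam -> X -> X} {Y : set X} {L : set Gam} {W : set X}.
Context (ir : invariant_reduction act Y L W).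
Notation C := (Cplx R).
Notation G := (box act L W).
Notation el := (@elem R Gam X act L W).
Notation conv := Defs.conv.
Implicit Types (p : arr G) (f : arr G -> C) (g : Gam) (a : X -> C).
Let ac := ir_act ir.

Definition cutoff (e : X -> R) : Prop :=
  [/\ cc (fun x => ofR (e x)), continuous e & forall x, 0 <= e x <= 1].

Definition el_sq (e : X -> R) : arr G -> C := el 1%g (fun x => ofR (e x ^+ 2)).

(* The restrictions to [C_c(G)] of the states of [C^*(G)]. *)
Record algebraic_state (phi : (arr G -> C) -> C) : Prop := {
  as_lin : forall k f1 f2, span f1 -> span f2 ->
    phi (fun p => k * f1 p + f2 p) = k * phi f1 + phi f2;
  as_pos : forall f, span f -> 0 <= phi (conv (invol f) f);
  as_le1 : forall e, cutoff e -> cRe (phi (el_sq e)) <= 1;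
  as_approx : forall eps : R, 0 < eps -> exists2 K, compact K &
    forall e, cutoff e -> (forall x, K x -> e x = 1) ->
      1 - eps < cRe (phi (el_sq e)) }.

Lemma conv_el1 g a b : L g ->
  conv (el 1%g a) (el g b) = el g (fun y => a (act g y) * b y).
Proof.
move=> Lg; rewrite (conv_el ir) // ?mul1g; last exact: ir_1 ir.
by apply: eq_elem => y _ Wgy; rewrite ind1 ?mulr1 //; exact: ir_sub ir _ Wgy.
Qed.

Lemma conv_el11 a b : conv (el 1%g a) (el 1%g b) = el 1%g (fun y => a y * b y).
Proof.
rewrite conv_el1; last exact: ir_1 ir.
by apply: eq_elem => y _ _; rewrite act1.
Qed.

Lemma conv_el1r g a b : L g ->
  conv (el g a) (el 1%g b) = el g (fun y => a y * b y).
Proof.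
move=> Lg; rewrite (conv_el ir) // ?mulg1; last exact: ir_1 ir.
by apply: eq_elem => y Wy _; rewrite act1 // ind1 ?mulr1 //; exact: ir_sub ir _ Wy.
Qed.

Lemma invol_el1 a : invol (el 1%g a) = el 1%g (fun y => (a y)^*).
Proof.
by rewrite (invol_el ir) invg1; apply: eq_elem => y _ _; rewrite act1.
Qed.

Lemma conv_invol_el g a : L g -> conv (invol (el g a)) (el g a) =
  el 1%g (fun y => (a y)^* * a y * ind Y (act g y)).
Proof.
move=> Lg; rewrite (invol_el ir) (conv_el ir) //; last exact: (ir_V ir).
by rewrite mulVg; apply: eq_elem => y _ _; rewrite actK // mulrAC.
Qed.

Lemma conv_cutoff (e : X -> R) :
  conv (invol (el 1%g (fun x => ofR (e x)))) (el 1%g (fun x => ofR (e x))) = el_sq e.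
Proof.
rewrite invol_el1 conv_el11; apply: eq_elem => y _ _.
by rewrite conj_ofR -ofRM.
Qed.

Lemma span_cutoff e : cutoff e -> span (el 1%g (fun x => ofR (e x))).
Proof. by move=> [ce _ _]; apply: span_elem => //; exact: ir_1 ir. Qed.

Lemma exists_cutoff K : compact K ->
  exists2 e, cutoff e & forall x, K x -> e x = 1.
Proof.
move=> cK; have [e [h1 h2 h3 h4]] := urysohn_cc R (ir_lc ir) (ir_haus ir) cK.
by exists e.
Qed.

Lemma cutoff_unit f : span f -> exists2 K, compact K &
  forall e, cutoff e -> (forall x, K x -> e x = 1) ->
    conv (el 1%g (fun x => ofR (e x))) f = f /\
    conv f (el 1%g (fun x => ofR (e x))) = f.
Proof.
move=> /(local_unit ir) [K cK h]; exists K => // e [ce _ _] e1; apply: h => //.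
by move=> x /e1 ->.
Qed.

(** * The GNS seminorm of a positive functional *)

Section Positive.
Variable phi : (arr G -> C) -> C.
Hypothesis phi_lin : forall k f1 f2, span f1 -> span f2 ->
  phi (fun p => k * f1 p + f2 p) = k * phi f1 + phi f2.
Hypothesis phi_pos : forall f, span f -> 0 <= phi (conv (invol f) f).

(** The GNS form, conjugate linear in its first argument and possibly degenerate. No quotient is
    formed, so [nrm] is only a seminorm. *)
Definition ip f h : C := phi (conv (invol f) h).
Definition nrm f : R := Num.sqrt (cRe (ip f f)).

Lemma phi0 : phi (fun=> 0) = 0.
Proof.
have := phi_lin (-1) (span0 _ _ _ ) (span0 _ _ _).
rewrite (_ : (fun p => _) = (fun=> 0)); last by apply/funext => p; rewrite mulr0 addr0.
by rewrite mulN1r addNr.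
Qed.

Lemma phiD f1 f2 : span f1 -> span f2 -> phi (fun p => f1 p + f2 p) = phi f1 + phi f2.
Proof.
move=> s1 s2; have := phi_lin 1 s1 s2; rewrite mul1r => <-.
by congr phi; apply/funext => p; rewrite mul1r.
Qed.

Lemma phiZ k f : span f -> phi (fun p => k * f p) = k * phi f.
Proof.
move=> sf; have := phi_lin k sf (span0 _ _ _); rewrite phi0 addr0 => <-.
by congr phi; apply/funext => p; rewrite addr0.
Qed.

Lemma ipDl f1 f2 h : span f1 -> span f2 -> span h ->
  ip (fun p => f1 p + f2 p) h = ip f1 h + ip f2 h.
Proof.
move=> s1 s2 sh; rewrite /ip involD (conv_addl ir) ?phiD //.
all: by do ?[apply: (span_conv ir) => //]; apply: (span_invol ir).
Qed.

Lemma ipDr f h1 h2 : span f -> span h1 -> span h2 ->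
  ip f (fun p => h1 p + h2 p) = ip f h1 + ip f h2.
Proof.
move=> sf s1 s2; rewrite /ip (conv_addr ir) ?phiD //.
all: by do ?[apply: (span_conv ir) => //]; apply: (span_invol ir).
Qed.

Lemma ipZl k f h : span f -> span h -> ip (fun p => k * f p) h = k^* * ip f h.
Proof.
move=> sf sh; rewrite /ip involZ conv_scalel phiZ //.
by apply: (span_conv ir) => //; exact: (span_invol ir).
Qed.

Lemma ipZr k f h : span f -> span h -> ip f (fun p => k * h p) = k * ip f h.
Proof.
move=> sf sh; rewrite /ip conv_scaler phiZ //.
by apply: (span_conv ir) => //; exact: (span_invol ir).
Qed.

Lemma ip_ge0 f : span f -> 0 <= ip f f. Proof. exact: phi_pos. Qed.

Lemma ip_quadratic f h : span f -> span h -> forall l,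
  0 <= ip f f + l * ip f h + l^* * ip h f + l^* * l * ip h h.
Proof.
move=> sf sh l; have slh := span_scale l sh.
have := ip_ge0 (span_add sf slh).
rewrite ipDl //; last exact: span_add.
rewrite !ipDr // ipZl // ipZr // ipZl // ipZr //; congr (_ <= _); ring.
Qed.

Lemma ip_conj f h : span f -> span h -> ip h f = (ip f h)^*.
Proof.
by move=> sf sh; apply: hermitian_of_ge0 (ip_ge0 sf) (ip_ge0 sh) (ip_quadratic sf sh).
Qed.

Lemma nrm_ge0 f : 0 <= nrm f. Proof. exact: sqrtr_ge0. Qed.

Lemma nrm_sqr f : span f -> nrm f ^+ 2 = cRe (ip f f).
Proof. by move=> /ip_ge0 /cge0P [? _]; rewrite sqr_sqrtr. Qed.

Lemma ip_le f h : span f -> span h -> cmod (ip f h) <= nrm f * nrm h.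
Proof.
move=> sf sh; rewrite -(@ler_pXn2r _ 2) ?nnegrE ?cmod_ge0 ?mulr_ge0 ?nrm_ge0 //.
rewrite exprMn !nrm_sqr //.
exact: cauchy_schwarz_of_ge0 (ip_ge0 sf) (ip_ge0 sh) (ip_quadratic sf sh).
Qed.

Lemma nrmZ k f : span f -> nrm (fun p => k * f p) = cmod k * nrm f.
Proof.
move=> sf; rewrite /nrm ipZl ?ipZr //; last exact: span_scale.
have /cge0P[r0 i0] := ip_ge0 sf.
rewrite mulrA mulC_conj !cRIE i0 mulr0 subr0 sqrtrM ?sqr_ge0 //.
by rewrite sqrtr_sqr ger0_norm ?cmod_ge0.
Qed.

Lemma nrmD f h : span f -> span h -> nrm (fun p => f p + h p) <= nrm f + nrm h.
Proof.
move=> sf sh; have sfh := span_add sf sh.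
rewrite -(@ler_pXn2r _ 2) ?nnegrE ?addr_ge0 ?nrm_ge0 //.
rewrite nrm_sqr // ipDl // !ipDr // !cRIE (ip_conj sf sh) cRe_conj.
have := le_trans (ler_norm _) (le_trans (cRe_le_norm _) (ip_le sf sh)).
by rewrite sqrrD -!nrm_sqr // => ?; nra.
Qed.

Lemma nrm0 : nrm (fun=> 0) = 0.
Proof. by rewrite /nrm /ip conv0r phi0 sqrtr0. Qed.

Lemma ip_conv f f' h h' : span f -> span f' -> span h -> span h' ->
  ip (conv f h) (conv f' h') = ip h (conv (conv (invol f) f') h').
Proof.
move=> sf sf' sh sh'; have sF := span_invol ir sf; have sH := span_invol ir sh.
rewrite /ip (invol_conv ir) // (conv_assoc ir sH sF) ?(conv_assoc ir) //.
exact: (span_conv ir).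
Qed.

(** Boundedness holds because [M^2 - a^* a] is again a square: if [A], [B], [D] have coefficients
    [a E], [k] and [E], then [A^* A + B^* B = M^2 D^* D], and the term of [B] may be dropped after
    applying the form. *)
Lemma nrm_conv_el g a : L g -> cc a -> exists2 M, 0 <= M &
  forall h, span h -> nrm (conv (el g a) h) <= M * nrm h.
Proof.
move=> Lg ca; have [M M0 aM] := cc_bounded ca; exists M; first exact: ltW.
move=> h sh; have [K cK hK] := cutoff_unit sh.
have [e ce e1] := exists_cutoff cK; have [eh _] := hK e ce e1.
have se := span_cutoff ce; have sga := span_elem act W Lg ca.
pose E (x : X) : C := ofR (e x).
have ccE : cc E by case: ce.
pose q x : C := (a x)^* * a x * ind Y (act g x).
have qE x : q x = ofR (cRe (q x)).
  apply: cge0E; rewrite /q mulC_conj /ind.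
  by case: (_ \in _); rewrite ?mulr1 ?mulr0 // ler_ofR sqr_ge0.
have qM x : cRe (q x) <= M ^+ 2.
  rewrite /q mulC_conj /ind; case: (_ \in _); rewrite ?mulr1 ?mulr0 /= ?sqr_ge0 //.
  by rewrite lerXn2r ?nnegrE ?cmod_ge0 ?(ltW M0).
have cq : continuous q.
  have [ca' _] := ca; have cci : continuous (fun x => ind Y (act g x) : C) by exact: (continuous_indY ir).
  have c1 := @continuous_mulC R X (fun x => (a x)^*) a (continuous_conj_comp ca') ca'.
  exact: (@continuous_mulC R X _ _ c1 cci).
(* The square root alone equals [M] wherever [a] vanishes, so it is cut down by [E], which is a unit
   for [h]. *)
pose k x : C := ofR (Num.sqrt (M ^+ 2 - cRe (q x))) * E x.
have cM : continuous (fun x => M ^+ 2 - cRe (q x)).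
  move=> x; apply: (@cvgB _ R^o); first exact: cvg_cst.
  by apply: (continuous_comp (f := q)); [exact: cq|exact: continuous_cRe].
have csq : continuous (fun x => Num.sqrt (M ^+ 2 - cRe (q x))).
  move=> x; apply: (@continuous_comp _ R R (fun x => M ^+ 2 - cRe (q x)) Num.sqrt).
    exact: cM.
  exact: sqrt_continuous.
have ck : cc k := ccMl (continuous_ofR_comp csq) ccE.
have sk := span_elem act W (ir_1 ir) ck.
have caE : cc (fun y => a y * E y) := ccMr ca (proj1 ccE).
have sgE := span_elem act W Lg caE.
have -> : conv (el g a) h = conv (el g (fun y => a y * E y)) h.
  by rewrite -{1}eh -(conv_assoc ir) // conv_el1r.
rewrite -(@ler_pXn2r _ 2) ?nnegrE ?mulr_ge0 ?nrm_ge0 ?(ltW M0) //.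
have s1 := span_conv ir sgE sh; have s2 := span_conv ir sk sh.
pose A := el g (fun y => a y * E y); pose B := el 1%g k; pose D := el 1%g E.
have FE : (fun p => conv (invol A) A p + conv (invol B) B p) =
    fun p => ofR (M ^+ 2) * conv (invol D) D p.
  have L1 := ir_1 ir; apply/funext => p; rewrite !conv_invol_el //.
  rewrite -elemZ -elemD; congr (_ p); apply: eq_elem => y Wy Wgy.
  have i1 : ind Y y = 1 :> C by rewrite ind1 //; exact: ir_sub ir _ Wy.
  rewrite act1 // i1 /k rmorphM /= !conj_ofR rmorphM /= conj_ofR.
  set r := Num.sqrt _.
  have rr : ofR r * ofR r = ofR (M ^+ 2) - q y.
    by rewrite -ofRM -expr2 sqr_sqrtr ?subr_ge0 // ofRB -qE.
  transitivity ((q y + ofR r * ofR r) * (E y * E y)); last by rewrite rr; ring.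
  by rewrite /q /E conj_ofR; ring.
have key : ip (conv A h) (conv A h) + ip (conv B h) (conv B h) = ofR (M ^+ 2) * ip h h.
  have sA : span (conv (invol A) A) := span_conv ir (span_invol ir sgE) sgE.
  have sB : span (conv (invol B) B) := span_conv ir (span_invol ir sk) sk.
  have sD : span (conv (invol D) D) := span_conv ir (span_invol ir se) se.
  rewrite (ip_conv sgE sgE sh sh) (ip_conv sk sk sh sh).
  rewrite -(ipDr sh (span_conv ir sA sh) (span_conv ir sB sh)).
  rewrite -(conv_addl ir h sA sB) FE conv_scalel (ipZr _ sh (span_conv ir sD sh)).
  by rewrite -(ip_conv se se sh sh) eh.
rewrite exprMn !nrm_sqr //.
have /cge0P[k0 _] := ip_ge0 s2; have := congr1 (@cRe R) key.
by rewrite !cRIE mul0r subr0 => <-; rewrite lerDl.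
Qed.

Lemma nrm_conv_bounded f : span f -> exists2 M, 0 <= M &
  forall h, span h -> nrm (conv f h) <= M * nrm h.
Proof.
elim=> [|g a k Lg ca sk [M M0 IH]].
  by exists 0 => // h sh; rewrite conv0l nrm0 mul0r.
have [M' M'0 h'] := nrm_conv_el Lg ca; have sg := span_elem act W Lg ca.
exists (M' + M); first exact: addr_ge0.
move=> h sh; rewrite (conv_addl ir) // (le_trans (nrmD _ _)) //.
- exact: (span_conv ir).
- exact: (span_conv ir).
- by rewrite mulrDl; apply: lerD; [exact: h'|exact: IH].
Qed.

(* The norm of the image of [f] in the GNS representation of [phi]. *)
Definition gns f : R := sup [set nrm (conv f h) | h in [set h | span h /\ nrm h <= 1]].

Lemma gns_has_sup f : span f ->
  has_sup [set nrm (conv f h) | h in [set h | span h /\ nrm h <= 1]].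
Proof.
move=> sf; split.
  exists (nrm (conv f (fun=> 0))); exists (fun=> 0) => //.
  by split; [exact: span0|rewrite nrm0 ler01].
have [M M0 hM] := nrm_conv_bounded sf; exists M => _ [h [sh h1] <-].
by rewrite (le_trans (hM _ sh)) // ler_piMr.
Qed.

Lemma gns_ge0 f : span f -> 0 <= gns f.
Proof.
move=> sf; have [_ hb] := gns_has_sup sf.
apply: le_trans (ub_le_sup hb _); last first.
  by exists (fun=> 0) => //; split; [exact: span0|rewrite nrm0 ler01].
exact: nrm_ge0.
Qed.

Lemma gns_le f (M : R) : span f -> 0 <= M ->
  (forall h, span h -> nrm (conv f h) <= M * nrm h) -> gns f <= M.
Proof.
move=> sf M0 hM; apply: ge_sup; first by have [] := gns_has_sup sf.
by move=> _ [h [sh h1] <-]; rewrite (le_trans (hM _ sh)) // ler_piMr.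
Qed.

(** A vector of seminorm zero cannot be normalized; for it, boundedness of left multiplication gives
    seminorm zero on the left as well. *)
Lemma le_gns f h : span f -> span h -> nrm (conv f h) <= gns f * nrm h.
Proof.
move=> sf sh; have [h0|hn0] := eqVneq (nrm h) 0.
  have [M M0 /(_ h sh)] := nrm_conv_bounded sf.
  by rewrite h0 !mulr0.
have hp : 0 < nrm h by rewrite lt_neqAle eq_sym hn0 nrm_ge0.
pose k := ofR (nrm h)^-1; have kE : cmod k = (nrm h)^-1.
  by rewrite cmod_ofR ger0_norm // invr_ge0 nrm_ge0.
have [_ hb] := gns_has_sup sf.
have : nrm (conv f (fun p => k * h p)) <= gns f.
  apply: ub_le_sup => //; exists (fun p => k * h p) => //.
  by split; [exact: span_scale|rewrite nrmZ // kE mulVf].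
rewrite conv_scaler nrmZ; last exact: (span_conv ir).
by rewrite kE ler_pdivrMl // mulrC.
Qed.

Lemma gnsZ_le k f : span f -> gns (fun p => k * f p) <= cmod k * gns f.
Proof.
move=> sf; apply: gns_le; first exact: span_scale.
  by rewrite mulr_ge0 ?cmod_ge0 ?gns_ge0.
move=> h sh; rewrite conv_scalel nrmZ; last exact: (span_conv ir).
by rewrite -mulrA ler_wpM2l ?cmod_ge0 // le_gns.
Qed.

Lemma gnsZ k f : span f -> gns (fun p => k * f p) = cmod k * gns f.
Proof.
move=> sf; apply/eqP; rewrite eq_le gnsZ_le //=.
have [->|k0] := eqVneq k 0.
  by rewrite cmod0 mul0r gns_ge0 //; exact: span_scale.
have := gnsZ_le k^-1 (span_scale k sf).
rewrite (_ : (fun p => _) = f); last by apply/funext => p; rewrite mulrA mulVf // mul1r.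
have kV : cmod k * cmod k^-1 = 1 by rewrite -cmodM mulfV // cmod1.
move=> /(ler_wpM2l (cmod_ge0 k)); by rewrite mulrA kV mul1r.
Qed.

Lemma gnsM f1 f2 : span f1 -> span f2 -> gns (conv f1 f2) <= gns f1 * gns f2.
Proof.
move=> s1 s2; apply: gns_le; first exact: (span_conv ir).
  by rewrite mulr_ge0 ?gns_ge0.
move=> h sh; rewrite (conv_assoc ir) // (le_trans (le_gns _ _)) //.
  exact: (span_conv ir).
by rewrite -mulrA ler_wpM2l ?gns_ge0 // le_gns.
Qed.

(** The square of [nrm (conv f h)] is the form of [h] with [f^* f h], to which Cauchy-Schwarz
    applies. *)
Lemma gns_sqr_le f : span f -> gns f ^+ 2 <= gns (conv (invol f) f).
Proof.
move=> sf; have sff := span_conv ir (span_invol ir sf) sf.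
rewrite -[leRHS]sqr_sqrtr ?gns_ge0 // lerXn2r ?nnegrE ?gns_ge0 ?sqrtr_ge0 //.
apply: gns_le; rewrite ?sqrtr_ge0 // => h sh.
rewrite -(@ler_pXn2r _ 2) ?nnegrE ?mulr_ge0 ?nrm_ge0 ?sqrtr_ge0 //.
rewrite exprMn [X in _ <= X * _]sqr_sqrtr ?gns_ge0 //.
rewrite [leLHS]nrm_sqr; last exact: (span_conv ir).
rewrite ip_conv //; apply: le_trans (ler_norm _) _.
apply: le_trans (cRe_le_norm _) _; apply: le_trans (ip_le _ _) _ => //.
  exact: (span_conv ir).
by rewrite expr2 mulrA mulrC ler_wpM2r ?nrm_ge0 // le_gns.
Qed.

Lemma gns_invol_le f : span f -> gns f <= gns (invol f).
Proof.
move=> sf; have si := span_invol ir sf.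
have := le_trans (gns_sqr_le sf) (gnsM si sf); rewrite expr2.
have [->|f0] := eqVneq (gns f) 0; first by rewrite gns_ge0.
by rewrite ler_pM2r // lt_neqAle eq_sym f0 gns_ge0.
Qed.

Lemma gns_cstar_seminorm : cstar_seminorm gns.
Proof.
split; first by move=> f /(CcP ir) sf; exact: gns_ge0.
split.
  move=> f1 f2 /(CcP ir) s1 /(CcP ir) s2; apply: gns_le; first exact: span_add.
    by rewrite addr_ge0 ?gns_ge0.
  move=> h sh; rewrite (conv_addl ir) // (le_trans (nrmD _ _)) //.
  - exact: (span_conv ir).
  - exact: (span_conv ir).
  - by rewrite mulrDl; apply: lerD; exact: le_gns.
split; first by move=> k f /(CcP ir) sf; exact: gnsZ.
split; first by move=> f1 f2 /(CcP ir) s1 /(CcP ir) s2; exact: gnsM.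
move=> f /(CcP ir) sf; apply/eqP; rewrite eq_le gns_sqr_le // andbT.
apply: le_trans (gnsM (span_invol ir sf) sf) _; rewrite expr2 ler_wpM2r ?gns_ge0 //.
by have := gns_invol_le (span_invol ir sf); rewrite (involK ir).
Qed.

(** For a cutoff [e] that is a unit for [f], the value [phi f] is the form of [e] with [f e], and
    [e] has seminorm at most [1]. *)
Lemma phi_le_gns f :
  (forall e, cutoff e -> cRe (phi (el_sq e)) <= 1) ->
  span f -> cmod (phi f) <= gns f.
Proof.
move=> phi1 sf; have [K cK hK] := cutoff_unit sf.
have [e ce e1] := exists_cutoff cK; have [ef fe] := hK e ce e1.
have se := span_cutoff ce; have ne : nrm (el 1%g (fun x => ofR (e x))) <= 1.
  rewrite -sqrtr1 ler_wsqrtr //; apply: le_trans (phi1 e ce).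
  by rewrite /ip conv_cutoff.
have ee : invol (el 1%g (fun x => ofR (e x))) = el 1%g (fun x => ofR (e x)).
  by rewrite invol_el1; apply: eq_elem => y _ _; rewrite conj_ofR.
have -> : phi f = ip (el 1%g (fun x => ofR (e x))) (conv f (el 1%g (fun x => ofR (e x)))).
  by rewrite /ip ee fe ef.
apply: le_trans (ip_le _ _) _ => //; first exact: (span_conv ir).
have := le_gns sf se; have := gns_ge0 sf; have := nrm_ge0 (el 1%g (fun x => ofR (e x))).
have := nrm_ge0 (conv f (el 1%g (fun x => ofR (e x)))); nra.
Qed.

End Positive.
End Functionals.

(** * C*-algebras *)

Section CstarAlgebras.
Context {R : realType} {A : cstarAlgebra R}.
Notation C := (Cplx R).
Implicit Types (a b w z : A) (k : C).

Definition nA a : R := cRe `|a|.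

Lemma normA_ofR a : `|a| = ofR (nA a).
Proof. by rewrite /nA -cge0E. Qed.
Lemma nA_ge0 a : 0 <= nA a. Proof. by have /cge0P[] := normr_ge0 a. Qed.
Lemma nAD a b : nA (a + b) <= nA a + nA b.
Proof. by rewrite -ler_ofR ofRD -!normA_ofR ler_normD. Qed.
Lemma nAZ k a : nA (k *: a) = cmod k * nA a.
Proof. by apply: ofR_inj; rewrite ofRM -!normA_ofR -normC_ofR normrZ. Qed.
Lemma nAN a : nA (- a) = nA a. Proof. by rewrite /nA normrN. Qed.
Lemma nA0 : nA 0 = 0. Proof. by rewrite /nA normr0. Qed.
Lemma nAB a b : nA (a - b) = nA (b - a).
Proof. by rewrite -nAN opprB. Qed.
Lemma nAM a b : nA (cmul a b) <= nA a * nA b.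
Proof. by rewrite -ler_ofR ofRM -!normA_ofR cnormM. Qed.
Lemma nA_star_mul a : nA (cmul (cstar a) a) = nA a ^+ 2.
Proof. by apply: ofR_inj; rewrite expr2 ofRM -!normA_ofR cnorm_star expr2. Qed.
Lemma nA_eq0 a : nA a = 0 -> a = 0.
Proof. by move=> h; apply/eqP; rewrite -normr_eq0 normA_ofR h. Qed.
Lemma nA_small a : (forall e : R, 0 < e -> nA a <= e) -> a = 0.
Proof.
move=> h; apply: nA_eq0; apply/eqP; rewrite eq_le nA_ge0 andbT.
by apply/ler_addgt0Pl => e e0; rewrite addr0 h.
Qed.

Lemma cmulDl a b w : cmul (a + b) w = cmul a w + cmul b w.
Proof. by have := cmul_linl 1 a b w; rewrite !scale1r. Qed.
Lemma cmulDr a b w : cmul w (a + b) = cmul w a + cmul w b.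
Proof. by have := cmul_linr 1 a b w; rewrite !scale1r. Qed.
Lemma cmul0l w : cmul (0 : A) w = 0.
Proof.
by have h := cmulDl 0 0 w; rewrite addr0 in h; apply: (@addIr _ (cmul 0 w)); rewrite add0r -h.
Qed.
Lemma cmul0r w : cmul w (0 : A) = 0.
Proof.
by have h := cmulDr 0 0 w; rewrite addr0 in h; apply: (@addIr _ (cmul w 0)); rewrite add0r -h.
Qed.
Lemma cmulZl k a w : cmul (k *: a) w = k *: cmul a w.
Proof. by have := cmul_linl k a 0 w; rewrite cmul0l !addr0. Qed.
Lemma cmulZr k a w : cmul w (k *: a) = k *: cmul w a.
Proof. by have := cmul_linr k a 0 w; rewrite cmul0r !addr0. Qed.
Lemma cmulNl a w : cmul (- a) w = - cmul a w.
Proof. by rewrite -scaleN1r cmulZl scaleN1r. Qed.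
Lemma cmulNr a w : cmul w (- a) = - cmul w a.
Proof. by rewrite -scaleN1r cmulZr scaleN1r. Qed.
Lemma cstarD a b : cstar (a + b) = cstar a + cstar b.
Proof. by have := cstar_lin 1 a b; rewrite rmorph1 !scale1r. Qed.
Lemma cstar0 : cstar (0 : A) = 0.
Proof.
by have h := cstarD 0 0; rewrite addr0 in h; apply: (@addIr _ (cstar 0)); rewrite add0r -h.
Qed.
Lemma cstarZ k a : cstar (k *: a) = k^* *: cstar a.
Proof. by have := cstar_lin k a 0; rewrite cstar0 !addr0. Qed.
Lemma cstarN a : cstar (- a) = - cstar a.
Proof. by rewrite -scaleN1r cstarZ rmorphN rmorph1 scaleN1r. Qed.

(** The C*-identity and submultiplicativity give one inequality; applied to the adjoint it gives the
    other. *)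
Lemma nA_star a : nA (cstar a) = nA a.
Proof.
suff h b : nA b <= nA (cstar b) by apply/eqP; rewrite eq_le h -{2}[a]cstarK h.
have [->|b0] := eqVneq (nA b) 0; first exact: nA_ge0.
have := nAM (cstar b) b; rewrite nA_star_mul expr2 ler_pM2r //.
by rewrite lt_neqAle eq_sym b0 nA_ge0.
Qed.

(* [z |-> c z + v z] is left multiplication by the unitary [c + v] of the
   unitization, hence isometric. *)
Lemma unitary_isometry (c : C) (v z : A) : cmod c = 1 ->
  c^* *: v + c *: cstar v + cmul (cstar v) v = 0 ->
  nA (c *: z + cmul v z) = nA z.
Proof.
move=> c1 hv; apply/eqP.
rewrite -(@eqrXn2 _ 2) ?nA_ge0 // -!nA_star_mul; apply/eqP; congr nA.
rewrite cstarD cstarZ cstarM !(cmulDl, cmulDr, cmulZl, cmulZr) scalerDr scalerA mulC_conj.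
rewrite c1 expr1n scale1r -addrA -[RHS]addr0; congr (_ + _).
transitivity (cmul (cstar z) (cmul (c^* *: v + c *: cstar v + cmul (cstar v) v) z)).
  rewrite !(cmulDl, cmulDr, cmulZl, cmulZr) -!cmulA addrA; congr (_ + _ + _).
by rewrite hv cmul0l cmul0r.
Qed.

(* [w = sqrt (1 - a^2) - 1], so that [a + i (1 + w)] and its adjoint are
   unitaries with mean [a]. *)
Lemma nA_le1 a w : cstar a = a -> cstar w = w -> cmul a w = cmul w a ->
  w + w + cmul w w + cmul a a = 0 -> nA a <= 1.
Proof.
move=> sa sw aw h.
have ci : cmod (- iC : C) = 1 by rewrite cmodN cmod_iC.
have ii : (- iC) * iC = 1 :> C by rewrite mulNr iC_sqr opprK.
have u1 (z : A) : nA (iC *: z + cmul (a + iC *: w) z) = nA z.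
  apply: unitary_isometry; first exact: cmod_iC.
  rewrite cstarD cstarZ sa sw conj_iC -h !(cmulDl, cmulDr, cmulZl, cmulZr) !scalerDr.
  rewrite !scalerA ii aw mulrN -mulNr ii !scale1r !scaleNr.
  rewrite [X in X + _]addrACA addNr add0r -!addrA; congr (_ + (_ + _)).
  rewrite [RHS]addrC !addrA; congr (_ + _).
  by rewrite -[LHS]addrA subrr addr0.
have u2 (z : A) : nA (- iC *: z + cmul (a - iC *: w) z) = nA z.
  apply: unitary_isometry; first exact: ci.
  rewrite cstarD cstarN cstarZ sa sw conj_iC rmorphN /= conj_iC opprK -h.
  rewrite !(cmulDl, cmulDr, cmulZl, cmulZr, cmulNl, cmulNr) !scalerDr !scalerN.
  rewrite !scaleNr !opprK !scalerA iC_sqr aw !scaleN1r !opprK.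
  rewrite scalerN scalerA iC_sqr scaleN1r opprK.
  rewrite [X in X + _]addrACA subrr add0r -!addrA; congr (_ + (_ + _)).
  rewrite [RHS]addrC !addrA; congr (_ + _).
  by rewrite subrK.
(* Applying the two unitaries to [a] and adding gives [2 a^2], each summand having the norm of [a].
   The C*-identity then turns the left side into the square of [nA a]. *)
have : nA (cmul a a) <= nA a.
  have : nA (2%:R *: cmul a a) <= nA a + nA a.
    rewrite -{1}(u1 a) -(u2 a); apply: le_trans (nAD _ _); rewrite le_eqVlt.
    apply/orP; left; apply/eqP; congr nA.
    rewrite !(cmulDl, cmulNl) scaleNr addrACA subrr add0r addrACA subrr addr0.
    by rewrite scaler_nat.
  rewrite nAZ (_ : 2%:R = ofR (2%:R : R)); last by rewrite /ofR rmorph_nat.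
  rewrite cmod_ofR ger0_norm //; lra.
rewrite -{1}sa nA_star_mul expr2.
have [->|a0] := eqVneq (nA a) 0; first by rewrite ler01.
by rewrite -{3}[nA a]mul1r ler_pM2r // lt_neqAle eq_sym a0 nA_ge0.
Qed.

End CstarAlgebras.

Section Completeness.
Context {R : realType}.
Notation C := (Cplx R).

Lemma half_gt0 (e : R) : 0 < e -> 0 < e / 2.
Proof. by move=> e0; rewrite divr_gt0. Qed.

Lemma nA_complete (A : cstarAlgebra R) (u : nat -> A) :
  (forall e : R, 0 < e -> exists N, forall m n, (N <= m)%N -> (N <= n)%N ->
    nA (u m - u n) <= e) ->
  exists l, forall e : R, 0 < e -> exists N, forall n, (N <= n)%N -> nA (u n - l) <= e.
Proof.
move=> hu; have cu : cauchy (u @ \oo).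
  apply: cauchy_exP => e e0; have eE := cge0E (ltW e0).
  have r0 : 0 < cRe e by rewrite -ltr_ofR -eE.
  have [N hN] := hu (cRe e / 2) (half_gt0 r0).
  exists (u N); exists N => // n /= Nn; rewrite -ball_normE /= eE normA_ofR ltr_ofR.
  by rewrite (le_lt_trans (hN _ _ (leqnn N) Nn)) // ltr_pdivrMr // ltr_pMr // ltr1n.
have /cvg_ex [l ul] : cvg (u @ \oo) by exact: cauchy_cvg.
exists l => e e0; have e0' : 0 < ofR e by rewrite -(ltr_ofR 0) in e0 *.
have /cvgrPdist_le /(_ _ e0') [N _ hN] := ul.
by exists N => n Nn; have := hN n Nn; rewrite /= normA_ofR ler_ofR nAB.
Qed.

Lemma cmod_complete (u : nat -> C) :
  (forall e : R, 0 < e -> exists N, forall m n, (N <= m)%N -> (N <= n)%N ->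
    cmod (u m - u n) <= e) ->
  exists l, forall e : R, 0 < e -> exists N, forall n, (N <= n)%N -> cmod (u n - l) <= e.
Proof.
move=> hu.
have h (r : C -> R) : (forall z w, `|r z - r w| <= cmod (z - w)) ->
    exists l, forall e : R, 0 < e -> exists N, forall n, (N <= n)%N -> `|r (u n) - l| <= e.
  move=> hr; have cu : cauchy ((r \o u) @ \oo).
    apply: cauchy_exP => e e0; have [N hN] := hu (e / 2) (half_gt0 e0).
    exists (r (u N)); exists N => // n /= Nn; rewrite -ball_normE /=.
    rewrite (le_lt_trans (le_trans (hr _ _) (hN _ _ (leqnn N) Nn))) //.
    by rewrite ltr_pdivrMr // ltr_pMr // ltr1n.
  have /cvg_ex [l ul] : cvg ((r \o u) @ \oo) by exact: cauchy_cvg.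
  exists l => e e0; have /cvgrPdist_le /(_ _ e0) [N _ hN] := ul.
  by exists N => n Nn; have := hN n Nn; rewrite /= distrC.
have [x hx] := h (@cRe R) (fun z w => ltac:(rewrite -cReN -cReD; exact: cRe_le_norm)).
have [y hy] := h (@cIm R) (fun z w => ltac:(rewrite -cImN -cImD; exact: cIm_le_norm)).
exists (x +i* y)%C => e e0; have e2 : 0 < e / 2 by rewrite divr_gt0.
have [N1 h1] := hx _ e2; have [N2 h2] := hy _ e2.
exists (maxn N1 N2) => n; rewrite geq_max => /andP[n1 n2].
apply: le_trans (cmod_le _) _; rewrite !cRIE (splitr e).
by apply: lerD; [exact: h1|exact: h2].
Qed.

End Completeness.

(** * Square roots by iteration and contractivity of star-homomorphisms *)

Section Homomorphisms.
Context {R : realType} {A : cstarAlgebra R}.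
Implicit Types (a b w : A).

(* Picard iteration for [w = - (a^2 + w^2) / 2]. *)
Lemma exists_sqrt_one_minus_sqr a : cstar a = a -> nA a < 1 ->
  exists w, [/\ cstar w = w, cmul a w = cmul w a &
    w + w + cmul w w + cmul a a = 0].
Proof.
move=> sa a1; set s := nA a in a1; have s0 : 0 <= s by exact: nA_ge0.
pose half : Cplx R := ofR (2^-1).
have ch : cmod half = 2^-1 by rewrite cmod_ofR ger0_norm.
have hh x : half *: x + half *: x = x :> A.
  by rewrite -scalerDl -ofRD -[X in X + X]mul1r -splitr ofR1 scale1r.
pose T w : A := - (half *: (cmul a a + cmul w w)).
pose u := fix u n : A := if n is n.+1 then T (u n) else 0.
have Tle w : nA w <= s -> nA (T w) <= s.
  move=> ws; rewrite nAN nAZ ch.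
  have : nA (cmul a a + cmul w w) <= s * s + s * s.
    apply: le_trans (nAD _ _) _; apply: lerD; apply: le_trans (nAM _ _) _ => //.
    by apply: ler_pM => //; exact: nA_ge0.
  move=> h; nra.
(* The difference of squares is split as [w' (w' - w) + (w' - w) w], which is valid without
   commutation; the factor one half leaves the Lipschitz constant [s]. *)
have Tlip w w' : nA w <= s -> nA w' <= s -> nA (T w - T w') <= s * nA (w - w').
  move=> ws ws'.
  have -> : T w - T w' = half *: (cmul w' (w' - w) + cmul (w' - w) w).
    rewrite /T opprK addrC -scalerBr opprD addrACA subrr add0r; congr (_ *: _).
    by rewrite cmulDr cmulDl cmulNr cmulNl addrA subrK.
  rewrite nAZ ch; have h0 := nA_ge0 (w - w').
  have : nA (cmul w' (w' - w) + cmul (w' - w) w) <= s * nA (w - w') + nA (w - w') * s.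
    apply: le_trans (nAD _ _) _; rewrite (nAB w w').
    by apply: lerD; apply: le_trans (nAM _ _) _; apply: ler_pM; rewrite ?nA_ge0.
  move=> h; nra.
have us n : nA (u n) <= s by elim: n => [|n IH] /=; [rewrite nA0|exact: Tle].
(* For [n = 0] the distance to [u 0 = 0] is at most [s], crudely at most [2]; every further step
   contracts by [s]. *)
have ustep n k : nA (u (n + k)%N - u n) <= s ^+ n * 2.
  elim: n => [|n IH].
    by rewrite add0n subr0 expr0 mul1r (le_trans (us k)) // ltW // (lt_trans a1) // ltr1n.
  rewrite addSn /= (le_trans (Tlip _ _ (us _) (us _))) // exprS -mulrA.
  by rewrite ler_wpM2l.
have ssmall (e : R) : 0 < e -> exists N, s ^+ N * 2 <= e.
  move=> e0; have := @cvg_expr R s; rewrite ger0_norm // => /(_ a1).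
  move=> /cvgrPdist_le /(_ (e / 2) (half_gt0 e0)) [N _ /(_ N (leqnn N))] /=.
  rewrite sub0r normrN ger0_norm ?exprn_ge0 // => h; exists N.
  by rewrite -ler_pdivlMr.
have [|w hw] := nA_complete (u := u).
  move=> e e0; have [N hN] := ssmall (e / 2) (half_gt0 e0); exists N.
  have h n : (N <= n)%N -> nA (u n - u N) <= e / 2.
    by move=> Nn; rewrite -(subnKC Nn) (le_trans (ustep _ _)).
  move=> m n /h hm /h hn; rewrite -(subrKA (u N)) (splitr e).
  by apply: le_trans (nAD _ _) _; apply: lerD => //; rewrite nAB.
have hws : nA w <= s.
  apply/ler_addgt0Pr => e /hw [N /(_ N (leqnn N)) h].
  rewrite -[w](subrK (u N)) addrC; apply: le_trans (nAD _ _) _.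
  by apply: lerD; [exact: us|rewrite nAB].
have uw : w = T w.
  apply/eqP; rewrite -subr_eq0; apply/eqP; apply: nA_small => e e0.
  have [N hN] := hw _ (half_gt0 e0).
  rewrite -(subrKA (u N.+1)) (splitr e); apply: le_trans (nAD _ _) _; apply: lerD.
    by rewrite nAB; apply: hN.
  apply: le_trans (Tlip _ _ (us _) hws) _.
  by apply: le_trans (hN N (leqnn N)); rewrite ler_piMl ?nA_ge0 // ltW.
have su n : cstar (u n) = u n.
  elim: n => [|n IH] /=; first exact: cstar0.
  by rewrite /T cstarN cstarZ cstarD !cstarM sa IH conj_ofR.
have cu n : cmul a (u n) = cmul (u n) a.
  elim: n => [|n IH] /=; first by rewrite cmul0l cmul0r.
  rewrite /T cmulNr cmulNl cmulZr cmulZl cmulDr cmulDl; congr (- (_ *: (_ + _))).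
    exact: cmulA.
  by rewrite cmulA IH -cmulA IH cmulA.
(* Self-adjointness and commutation with [a] hold for every iterate and pass to the limit; the
   equation is twice the fixed point identity. *)
exists w; split.
- apply/eqP; rewrite -subr_eq0; apply/eqP; apply: nA_small => e e0.
  have [N hN] := hw _ (half_gt0 e0); have {}hN := hN N (leqnn N).
  rewrite -(subrKA (u N)) (splitr e); apply: le_trans (nAD _ _) _; apply: lerD => //.
  by rewrite -{1}(su N) -cstarN -cstarD nA_star nAB.
- apply/eqP; rewrite -subr_eq0; apply/eqP; apply: nA_small => e e0.
  have [N hN] := hw _ (half_gt0 e0); have {}hN := hN N (leqnn N).
  rewrite -(subrKA (cmul a (u N))) {2}cu -cmulNr -cmulNl -cmulDr -cmulDl (splitr e).
  apply: le_trans (nAD _ _) _; apply: lerD; apply: le_trans (nAM _ _) _.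
    rewrite (nAB w); apply: le_trans hN; rewrite ler_piMl ?nA_ge0 //; exact: ltW.
  by apply: le_trans hN; rewrite ler_piMr ?nA_ge0 //; exact: ltW.
- have -> : w + w = - (cmul a a + cmul w w) by rewrite {1 2}uw /T -opprD hh.
  by rewrite -addrA (addrC (cmul w w)) addNr.
Qed.

Section StarHomomorphism.
Context {B : cstarAlgebra R} (sigma : A -> B).
Hypothesis sigma_lin : forall (k : Cplx R) a b,
  sigma (k *: a + b) = k *: sigma a + sigma b.
Hypothesis sigmaM : {morph sigma : a b / cmul a b}.
Hypothesis sigma_star : {morph sigma : a / cstar a}.

Lemma star_homD a b : sigma (a + b) = sigma a + sigma b.
Proof. by have := sigma_lin 1 a b; rewrite !scale1r. Qed.

Lemma star_hom0 : sigma 0 = 0.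
Proof.
by have h := star_homD 0 0; rewrite addr0 in h; apply: (@addIr _ (sigma 0)); rewrite add0r -h.
Qed.

Lemma star_homZ k a : sigma (k *: a) = k *: sigma a.
Proof. by have := sigma_lin k a 0; rewrite star_hom0 !addr0. Qed.

(** For a self-adjoint element of norm below [1], the image of its square root witness is a witness
    for its image, and [nA_le1] applies. Scaling and the C*-identity give the general case. *)
Lemma star_hom_contractive a : nA (sigma a) <= nA a.
Proof.
have h1 b : cstar b = b -> nA b < 1 -> nA (sigma b) <= 1.
  move=> sb /(exists_sqrt_one_minus_sqr sb) [w [sw bw e]].
  apply: (@nA_le1 _ _ _ (sigma w)); rewrite -?sigma_star ?sb ?sw -?sigmaM ?bw //.
  by rewrite -!star_homD e star_hom0.
have h2 b : cstar b = b -> nA (sigma b) <= nA b.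
  move=> sb; apply/ler_addgt0Pr => e e0.
  have M0 : 0 < nA b + e by rewrite ltr_wpDl ?nA_ge0.
  have cM : cmod (ofR (nA b + e)^-1) = (nA b + e)^-1.
    by rewrite cmod_ofR ger0_norm // invr_ge0 ltW.
  have := h1 (ofR (nA b + e)^-1 *: b); rewrite cstarZ conj_ofR sb star_homZ !nAZ cM.
  rewrite ltr_pdivrMl // mulr1 ler_pdivrMl // mulr1; apply => //.
  by rewrite ltrDl.
rewrite -(@ler_pXn2r _ 2) ?nnegrE ?nA_ge0 // -!nA_star_mul.
by rewrite -sigma_star -sigmaM h2 // cstarM cstarK.
Qed.

End StarHomomorphism.
End Homomorphisms.

(** * States of groupoid C*-algebras *)

Section LinearFunctionals.
Context {R : realType} {A : cstarAlgebra R}.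
Notation C := (Cplx R).
Implicit Types (phi : A -> C).

Lemma lfD phi a b : linear_functional phi -> phi (a + b) = phi a + phi b.
Proof. by move=> /(_ 1 a b); rewrite scale1r mul1r. Qed.
Lemma lf0 phi : linear_functional phi -> phi 0 = 0.
Proof.
by move=> h; have := lfD 0 0 h; rewrite addr0 => e; apply: (@addIr _ (phi 0)); rewrite add0r -e.
Qed.
Lemma lfZ phi k a : linear_functional phi -> phi (k *: a) = k * phi a.
Proof. by move=> h; have := h k a 0; rewrite (lf0 h) !addr0. Qed.
Lemma lfN phi a : linear_functional phi -> phi (- a) = - phi a.
Proof. by move=> h; rewrite -scaleN1r lfZ // mulN1r. Qed.

Lemma state_le phi a : state_space phi -> cmod (phi a) <= nA a.
Proof.
move=> [lin pos norm1].
have hs : has_sup [set cRe `|phi a| | a in [set a : A | `|a| <= 1]].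
  apply: contrapT => /sup_out h; have := norm1; rewrite /fun_norm h => /esym/eqP.
  by rewrite oner_eq0.
have [a0|a0] := eqVneq (nA a) 0; first by rewrite (nA_eq0 a0) (lf0 lin) nA0 cmod0.
have ap : 0 < nA a by rewrite lt_neqAle eq_sym a0 nA_ge0.
have kE : cmod (ofR (nA a)^-1) = (nA a)^-1.
  by rewrite cmod_ofR ger0_norm // invr_ge0 ltW.
have : cRe `|phi (ofR (nA a)^-1 *: a)| <= 1.
  rewrite -[leRHS]norm1; apply: ub_le_sup; first by case: hs.
  exists (ofR (nA a)^-1 *: a) => //=.
  by rewrite normA_ofR -ofR1 ler_ofR nAZ kE mulVf.
by rewrite -/(cmod _) lfZ // cmodM kE ler_pdivrMl // mulr1.
Qed.

Lemma bounded_continuous phi (M : R) : linear_functional phi ->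
  (forall a, cmod (phi a) <= M * nA a) -> continuous phi.
Proof.
move=> lin hM a U /nbhsC_P [e e0 hU].
have M1 : 0 < `|M| + 1 by rewrite ltr_wpDl.
have d0 : 0 < ofR (e / (`|M| + 1)) by rewrite -[0]/(ofR 0) ltr_ofR divr_gt0.
apply: (filterS _ (nbhsx_ballx a _ d0)) => b.
rewrite -ball_normE /= normA_ofR ltr_ofR => h; apply: hU.
rewrite -lfN // -lfD //; apply: le_lt_trans (hM _) _.
apply: (@le_lt_trans _ _ ((`|M| + 1) * nA (a - b))); last by rewrite mulrC -ltr_pdivlMr.
rewrite ler_wpM2r ?nA_ge0 //; apply: le_trans (ler_norm M) _; lra.
Qed.

End LinearFunctionals.

Section StatesOfGroupoidAlgebra.
Context {R : realType} {Gam : groupType} {X : topologicalType}.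
Context {act : Gam -> X -> X} {Y : set X} {L : set Gam} {W : set X}.
Context (ir : invariant_reduction act Y L W).
Notation C := (Cplx R).
Notation G := (box act L W).
Notation el := (@elem R Gam X act L W).
Notation conv := Defs.conv.
Notation elsq := (@el_sq R Gam X act L W).
Context {A : cstarAlgebra R} {iota : (arr G -> C) -> A}.
Hypothesis hA : is_groupoid_Cstar iota.
Implicit Types (f : arr G -> C) (a : A) (phi : A -> C).

Lemma iota_lin k f1 f2 : span f1 -> span f2 ->
  iota (fun g => k * f1 g + f2 g) = k *: iota f1 + iota f2.
Proof. by move=> s1 s2; case: hA => h _; apply: h; exact/(CcP ir). Qed.

Lemma iotaM f1 f2 : span f1 -> span f2 -> iota (conv f1 f2) = cmul (iota f1) (iota f2).
Proof. by move=> s1 s2; case: hA => _ [h _]; apply: h; exact/(CcP ir). Qed.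

Lemma iota_invol f : span f -> iota (invol f) = cstar (iota f).
Proof. by move=> s1; case: hA => _ [_ [h _]]; apply: h; exact/(CcP ir). Qed.

Lemma iota_approx a (e : R) : 0 < e -> exists2 f, span f & nA (iota f - a) <= e.
Proof.
move=> e0; case: hA => _ [_ [_ [h _]]].
have d0 : 0 < ofR e by rewrite -[0]/(ofR 0) ltr_ofR.
have [||b [bO [f cf fE]]] := h (ball a (ofR e))°.
- by exists a; exact: nbhsx_ballx.
- exact: open_interior.
have := interior_subset bO; rewrite -ball_normE -fE /= normA_ofR ltr_ofR => fa.
by exists f; [exact/(CcP ir)|rewrite nAB ltW].
Qed.

Lemma iota_max p f : cstar_seminorm p -> span f -> p f <= nA (iota f).
Proof.
move=> hp sf; case: hA => _ [_ [_ [_ /(_ p hp f)]]].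
by rewrite normA_ofR ler_ofR; apply; exact/(CcP ir).
Qed.

Lemma iota0 : iota (fun=> 0) = 0.
Proof.
have := iota_lin (-1) (span0 _ _ _) (span0 _ _ _).
rewrite (_ : (fun p => _) = (fun=> 0)); last by apply/funext => p; rewrite mulr0 addr0.
by rewrite scaleN1r addNr.
Qed.

Lemma iotaZ k f : span f -> iota (fun p => k * f p) = k *: iota f.
Proof.
move=> sf; have := iota_lin k sf (span0 _ _ _); rewrite iota0 addr0 => <-.
by congr iota; apply/funext => p; rewrite addr0.
Qed.

Lemma iotaD f1 f2 : span f1 -> span f2 ->
  iota (fun p => f1 p + f2 p) = iota f1 + iota f2.
Proof.
move=> s1 s2; have := iota_lin 1 s1 s2; rewrite scale1r => <-.
by congr iota; apply/funext => p; rewrite mul1r.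
Qed.

Lemma lf_eq phi1 phi2 :
  linear_functional phi1 -> (forall a, cmod (phi1 a) <= nA a) ->
  linear_functional phi2 -> (forall a, cmod (phi2 a) <= nA a) ->
  (forall f, span f -> phi1 (iota f) = phi2 (iota f)) -> phi1 = phi2.
Proof.
move=> l1 b1 l2 b2 h; apply/funext => a; apply/eqP; rewrite -subr_eq0; apply/eqP.
apply: cmod_eq0; apply/eqP; rewrite eq_le cmod_ge0 andbT.
apply/ler_addgt0Pl => e e0; rewrite addr0.
have [f sf hf] := iota_approx a (half_gt0 e0).
rewrite -(subrKA (phi1 (iota f))) {2}h // (splitr e) -!lfN // -!lfD //.
apply: le_trans (cmodD _ _) _; apply: lerD; first by rewrite (le_trans (b1 _)) // nAB.
exact: le_trans (b2 _) _.
Qed.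

(** The function [sqrt (1 - e^2) - 1] vanishes wherever [e] does, so it provides inside [C_c] the
    element [w] that [nA_le1] asks for. *)
Lemma nA_iota_cutoff e : cutoff e -> nA (iota (el 1%g (fun x => ofR (e x)))) <= 1.
Proof.
move=> [ce cont e01]; pose s x := Num.sqrt (1 - e x ^+ 2) - 1.
have cs : continuous s.
  move=> x; apply: (@cvgB _ R^o); last exact: cvg_cst.
  apply: (@continuous_comp _ R R (fun x => 1 - e x ^+ 2) Num.sqrt); last exact: sqrt_continuous.
  apply: (@cvgB _ R^o); first exact: cvg_cst.
  by apply: cvgM; exact: cont.
have ccs : cc (fun x => ofR (s x)).
  split; first exact: continuous_ofR_comp.
  have [_ [K cK h]] := ce; exists K => // x /h /ofR_inj e0.
  by rewrite /s e0 expr0n subr0 sqrtr1 subrr.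
have L1 := ir_1 ir.
have s1 := span_elem act W L1 ce; have s2 := span_elem act W L1 ccs.
apply: (@nA_le1 _ _ _ (iota (el 1%g (fun x => ofR (s x))))).
- rewrite -iota_invol // (invol_el1 ir); congr iota.
  by apply: eq_elem => y _ _; rewrite conj_ofR.
- rewrite -iota_invol // (invol_el1 ir); congr iota.
  by apply: eq_elem => y _ _; rewrite conj_ofR.
- rewrite -!iotaM // !(conv_el11 ir); congr iota.
  by apply: eq_elem => y _ _; rewrite mulrC.
have m1 := span_conv ir s1 s1; have m2 := span_conv ir s2 s2.
rewrite -!iotaM // -!iotaD //; try by do ?apply: span_add.
rewrite !(conv_el11 ir) -iota0; congr iota; apply/funext => p.
rewrite -!elemD /elem; case: ifP => // _; set y := pt p.
rewrite -!ofRM -!ofRD -ofR0; congr ofR; rewrite /s; set q := Num.sqrt _.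
have qq : q * q = 1 - e y ^+ 2.
  rewrite -expr2 sqr_sqrtr // subr_ge0; have := e01 y => /andP[? ?].
  by rewrite expr_le1.
by have -> : q - 1 + (q - 1) + (q - 1) * (q - 1) + e y * e y =
  q * q - (1 - e y ^+ 2); [ring|rewrite qq subrr].
Qed.

Lemma nA_iota_el_sq e : cutoff e -> nA (iota (elsq e)) <= 1.
Proof.
move=> he; have se := span_cutoff ir he; have h := nA_iota_cutoff he.
rewrite -(conv_cutoff ir) iotaM //; last exact: (span_invol ir).
apply: le_trans (nAM _ _) _; rewrite iota_invol // nA_star.
have := nA_ge0 (iota (el 1%g (fun x => ofR (e x)))); nra.
Qed.

(** Only [as_approx] takes work. Choose [f] of norm nearly [1] with value nearly [1] in modulus.
    Once [e] is a unit for [f], the value at [f] is the form of [e] with [f], and Cauchy-Schwarz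
    bounds the value at [e^2] from below. *)
Lemma state_algebraic phi : state_space phi ->
  algebraic_state (act := act) (L := L) (W := W) (fun f => phi (iota f)).
Proof.
move=> sphi; have [lin pos norm1] := sphi.
have plin k f1 f2 : span f1 -> span f2 ->
    phi (iota (fun p => k * f1 p + f2 p)) = k * phi (iota f1) + phi (iota f2).
  by move=> s1 s2; rewrite iota_lin // lin.
have ppos f : span f -> 0 <= phi (iota (conv (invol f) f)).
  by move=> sf; rewrite iotaM ?iota_invol //; exact: (span_invol ir).
split=> //.
  move=> e he; apply: le_trans (ler_norm _) _; apply: le_trans (cRe_le_norm _) _.
  by apply: le_trans (state_le _ sphi) _; exact: nA_iota_el_sq.
(* The constant works because [(1 - 2 d)^2] exceeds [(1 - 8 d) (1 + d)^2]; the minimum with [1]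
   keeps [1 - 8 d] nonnegative. *)
move=> eps eps0; pose d := Num.min eps 1 / 8.
have d0 : 0 < d by rewrite divr_gt0 // lt_min eps0 ltr01.
have d8 : 8 * d <= eps by rewrite mulrC divfK // ge_min lexx.
have d1 : 8 * d <= 1 by rewrite mulrC divfK // ge_min lexx orbT.
have [a a1 ha] : exists2 a, nA a <= 1 & 1 - d < cmod (phi a).
  have hs : has_sup [set cRe `|phi a| | a in [set a : A | `|a| <= 1]].
    apply: contrapT => /sup_out h; have := norm1; rewrite /fun_norm h => /esym/eqP.
    by rewrite oner_eq0.
  have [_ [a /= a1 <-]] := sup_adherent d0 hs; rewrite -/(fun_norm phi) norm1 => h.
  by exists a => //; rewrite normA_ofR -ofR1 ler_ofR in a1.
have [f sf fa] := iota_approx a d0.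
have nf : nA (iota f) <= 1 + d.
  rewrite -[iota f](subrK a); apply: le_trans (nAD _ _) _; lra.
have pf : 1 - 2 * d < cmod (phi (iota f)).
  have := cmod_dist (phi a) (phi (iota f)).
  have : cmod (phi a - phi (iota f)) <= d.
    by rewrite -lfN // -lfD // (le_trans (state_le _ sphi)) // nAB.
  move=> h1 h2; have := le_trans (ler_norm _) (le_trans h2 h1); lra.
have [K cK hK] := cutoff_unit ir sf; exists K => // e he e1.
have [ef _] := hK e he e1; have se := span_cutoff ir he.
have := ip_le (phi := fun f => phi (iota f)) ir plin ppos se sf; rewrite /ip.
rewrite (invol_el1 ir) (_ : el 1%g _ = el 1%g (fun x => ofR (e x))); last first.
  by apply: eq_elem => y _ _; rewrite conj_ofR.
rewrite ef => h.
have n1 := nrm_sqr (phi := fun f => phi (iota f)) ppos se.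
have n2 := nrm_sqr (phi := fun f => phi (iota f)) ppos sf.
rewrite /ip (conv_cutoff ir) in n1.
have {n2} n2 : nrm (fun f => phi (iota f)) f ^+ 2 <= nA (iota f) ^+ 2.
  rewrite n2 /ip; apply: le_trans (ler_norm _) _; apply: le_trans (cRe_le_norm _) _.
  apply: le_trans (state_le _ sphi) _.
  by rewrite iotaM ?iota_invol ?nA_star_mul //; exact: (span_invol ir).
rewrite -n1; move: h n2; set v := cmod _ in pf *; set x := nrm _ _; set y := nrm _ _.
have x0 : 0 <= x by exact: nrm_ge0.
have y0 : 0 <= y by exact: nrm_ge0.
have i0 := nA_ge0 (iota f); move=> h n2.
have yi : y <= 1 + d.
  by apply: le_trans nf; rewrite -(@ler_pXn2r _ 2) ?nnegrE.
have hv : 1 - 2 * d < x * (1 + d) by nra.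
apply: (@le_lt_trans _ _ (1 - 8 * d)); first by rewrite lerD2l lerN2.
rewrite ltNge; apply/negP => hx.
have : (1 - 2 * d) ^+ 2 < (x * (1 + d)) ^+ 2 by rewrite ltr_pXn2r ?nnegrE //; nra.
by rewrite exprMn; nra.
Qed.

(** The norm of the algebra dominates [gns], so [psi] is contractive on [C_c] and extends by
    density. *)
Lemma algebraic_state_extend (psi : (arr G -> C) -> C) :
  algebraic_state (act := act) (L := L) (W := W) psi ->
  exists2 phi, state_space phi & forall f, span f -> phi (iota f) = psi f.
Proof.
move=> [lin pos le1 approx].
have bnd f : span f -> cmod (psi f) <= nA (iota f).
  move=> sf; apply: le_trans (phi_le_gns ir lin pos le1 sf) _.
  by apply: iota_max => //; exact: (gns_cstar_seminorm ir lin pos).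
have bndB f1 f2 : span f1 -> span f2 ->
    cmod (psi f1 - psi f2) <= nA (iota f1 - iota f2).
  move=> s1 s2; have := bnd _ (span_add (span_scale (-1) s2) s1).
  by rewrite lin // iota_lin // mulN1r scaleN1r !(addrC (- _)).
(* The value at [a] is characterized by an inequality against every [f] and not by a chosen
   sequence; linearity and positivity are derived from this inequality. *)
have ex a : exists z, forall f, span f -> cmod (psi f - z) <= nA (iota f - a).
  have hn n : exists f, span f /\ nA (iota f - a) <= n.+1%:R^-1.
    by have [|f] := iota_approx a (_ : 0 < n.+1%:R^-1); [by []|exists f].
  have [u hu] := choice hn.
  have inv_small (e : R) : 0 < e -> exists N, forall n, (N <= n)%N -> n.+1%:R^-1 <= e.
    move=> e0; exists (Num.truncn e^-1) => n Nn.
    rewrite -[e]invrK lef_pV2 ?posrE ?invr_gt0 //.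
    apply: ltW; apply: lt_le_trans (truncnS_gt _) _; first by rewrite ler_nat ltnS.
  have [|z hz] := cmod_complete (u := fun n => psi (u n)).
    move=> e e0; have [N hN] := inv_small _ (half_gt0 e0); exists N => m n Nm Nn.
    apply: le_trans (bndB _ _ (hu m).1 (hu n).1) _.
    rewrite -(subrKA a) (splitr e); apply: le_trans (nAD _ _) _; apply: lerD.
      exact: le_trans (hu m).2 (hN _ Nm).
    by rewrite nAB; exact: le_trans (hu n).2 (hN _ Nn).
  exists z => f sf; apply/ler_addgt0Pr => e e0.
  have [N1 h1] := hz _ (half_gt0 e0); have [N2 h2] := inv_small _ (half_gt0 e0).
  set n := maxn N1 N2; rewrite -(subrKA (psi (u n))).
  apply: le_trans (cmodD _ _) _; rewrite (splitr e) addrA; apply: lerD; last first.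
    by apply: h1; exact: leq_maxl.
  apply: le_trans (bndB _ _ sf (hu n).1) _; rewrite -(subrKA a).
  apply: le_trans (nAD _ _) _; apply: lerD => //; rewrite nAB.
  by apply: le_trans (hu n).2 (h2 _ _); exact: leq_maxr.
have [phi hphi] := choice ex.
have phiE f : span f -> phi (iota f) = psi f.
  move=> sf; apply/esym/eqP; rewrite -subr_eq0; apply/eqP; apply: cmod_eq0; apply/eqP.
  by rewrite eq_le cmod_ge0 andbT (le_trans (hphi _ _ sf)) // subrr nA0.
have bphi a : cmod (phi a) <= nA a.
  have := hphi a _ (span0 _ _ _); rewrite (phi0 lin) iota0 !sub0r.
  by rewrite cmodN nAN.
have philin : linear_functional phi.
  move=> k a b; apply/eqP; rewrite -subr_eq0; apply/eqP; apply: cmod_eq0; apply/eqP.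
  rewrite eq_le cmod_ge0 andbT; apply/ler_addgt0Pl => e e0; rewrite addr0.
  have D0 : 0 < 2 * (cmod k + 1) by rewrite mulr_gt0 // ltr_wpDl ?cmod_ge0.
  (* Two errors, each at most [(cmod k + 1) * d], have to add up to [e]. *)
  pose d := e / (2 * (cmod k + 1)); have d0 : 0 < d by rewrite divr_gt0.
  have [f sf fa] := iota_approx a d0; have [h sh hb] := iota_approx b d0.
  have skf := span_scale k sf.
  have h1 : cmod (psi (fun p => k * f p + h p) - phi (k *: a + b)) <= cmod k * d + d.
    apply: le_trans (hphi _ _ (span_add skf sh)) _.
    rewrite iota_lin // opprD addrACA -scalerBr; apply: le_trans (nAD _ _) _.
    by rewrite nAZ; apply: lerD => //; rewrite ler_wpM2l ?cmod_ge0.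
  have h2 : cmod (k * (psi f - phi a) + (psi h - phi b)) <= cmod k * d + d.
    apply: le_trans (cmodD _ _) _; rewrite cmodM; apply: lerD.
      by rewrite ler_wpM2l ?cmod_ge0 // (le_trans (hphi _ _ sf)).
    by rewrite (le_trans (hphi _ _ sh)).
  have -> : phi (k *: a + b) - (k * phi a + phi b) =
      - (psi (fun p => k * f p + h p) - phi (k *: a + b)) +
      (k * (psi f - phi a) + (psi h - phi b)) by rewrite lin //; ring.
  apply: le_trans (cmodD _ _) _; rewrite cmodN; apply: le_trans (lerD h1 h2) _.
  have -> : e = 2 * (cmod k + 1) * d by rewrite /d mulrC divfK // gt_eqF.
  by rewrite le_eqVlt; apply/orP; left; apply/eqP; ring.
have phipos a : 0 <= phi (cmul (cstar a) a).
  suff h (e : R) : 0 < e -> - e <= cRe (phi (cmul (cstar a) a)) /\ `|cIm (phi (cmul (cstar a) a))| <= e.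
    apply/cge0P; split.
      by apply/ler_addgt0Pr => e e0; have [h1 _] := h e e0; rewrite -lerBlDr sub0r.
    apply/eqP; rewrite -normr_eq0 eq_le normr_ge0 andbT.
    by apply/ler_addgt0Pl => e e0; have [_ h1] := h e e0; rewrite addr0.
  (* [M] bounds the norm of [a] plus that of any [iota f] within distance [1] of [a]. *)
  move=> e0; pose M := 2 * nA a + 1.
  have M0 : 0 < M by rewrite ltr_wpDl // mulr_ge0 // nA_ge0.
  pose d := Num.min 1 (e / M); have d0 : 0 < d by rewrite lt_min ltr01 divr_gt0.
  have dM : d * M <= e by rewrite -ler_pdivlMr // ge_min lexx orbT.
  have d1 : d <= 1 by rewrite ge_min lexx.
  have [f sf fa] := iota_approx a d0.
  have sff := span_conv ir (span_invol ir sf) sf.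
  have fM : nA (iota f) <= nA a + d.
    by rewrite -[iota f](subrK a) addrC; apply: le_trans (nAD _ _) _; apply: lerD.
  have hd : cmod (psi (conv (invol f) f) - phi (cmul (cstar a) a)) <= e.
    apply: le_trans (hphi _ _ sff) _; apply: le_trans dM.
    rewrite iotaM // ?iota_invol //; last exact: (span_invol ir).
    have -> : cmul (cstar (iota f)) (iota f) - cmul (cstar a) a =
        cmul (cstar (iota f)) (iota f - a) + cmul (cstar (iota f - a)) a.
      by rewrite cmulDr cmulNr cstarD cstarN cmulDl cmulNl subrKA.
    have h1 := nAM (cstar (iota f)) (iota f - a).
    have h2 := nAM (cstar (iota f - a)) a; rewrite !nA_star in h1 h2.
    apply: le_trans (nAD _ _) _; apply: le_trans (lerD h1 h2) _.
    have := nA_ge0 a; have := nA_ge0 (iota f); have := nA_ge0 (iota f - a).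
    by rewrite /M; nra.
  have /cge0P[p0 i0] := pos f sf.
  have hr := le_trans (cRe_le_norm _) hd; have hi := le_trans (cIm_le_norm _) hd.
  rewrite !cRIE i0 sub0r normrN in hr hi; rewrite ler_norml in hr.
  by split=> //; have /andP[? ?] := hr; lra.
have ub : ubound [set cRe `|phi a| | a in [set a : A | `|a| <= 1]] 1.
  move=> _ [a /= a1 <-]; apply: le_trans (bphi a) _.
  by rewrite normA_ofR -ofR1 ler_ofR in a1.
exists phi => //; split => //; apply/eqP; rewrite eq_le; apply/andP; split.
  apply: ge_sup => //; exists (cRe `|phi 0|); exists 0 => //=.
  by rewrite normr0 ler01.
(* The norm is at least [1], because squares of cutoffs lie in the unit ball and their values come
   within [e] of [1]. *)
apply/ler_addgt0Pr => e e0; have [K cK hK] := approx e e0.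
have [c cc1 c1] := exists_cutoff (R := R) ir cK; have := hK c cc1 c1.
have sc : span (elsq c).
  have s0 := span_cutoff ir cc1.
  by rewrite -(conv_cutoff ir); exact: (span_conv ir (span_invol ir s0) s0).
rewrite -phiE // ltrBlDr => h; apply: le_trans (ltW h) _; rewrite lerD2r.
apply: le_trans (ler_norm _) _; apply: le_trans (cRe_le_norm _) _.
apply: ub_le_sup; first by exists 1.
exists (iota (elsq c)) => //=.
by rewrite normA_ofR -ofR1 ler_ofR; exact: nA_iota_el_sq.
Qed.

End StatesOfGroupoidAlgebra.

(** * Restriction to the boundary groupoid *)

Section FiniteSums.
Context {R : realType} {Gam : groupType} {X : topologicalType}.
Context {act : Gam -> X -> X} {Y : set X} {L : set Gam} {W : set X}.
Context (ir : invariant_reduction act Y L W).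
Notation C := (Cplx R).
Notation G := (box act L W).
Notation el := (@elem R Gam X act L W).
Notation conv := Defs.conv.
Implicit Types (f : arr G -> C).

Lemma sum_nil (T I : Type) (F : I -> T -> C) :
  (fun p => \sum_(i <- [::]) F i p) = fun=> 0.
Proof. by apply/funext => p; rewrite big_nil. Qed.

Lemma sum_cons (T I : Type) (r : seq I) i (F : I -> T -> C) :
  (fun p => \sum_(j <- i :: r) F j p) = fun p => F i p + \sum_(j <- r) F j p.
Proof. by apply/funext => p; rewrite big_cons. Qed.

Lemma span_sum (I : Type) (r : seq I) (F : I -> arr G -> C) :
  (forall i, span (F i)) -> span (fun p => \sum_(i <- r) F i p).
Proof.
move=> hF; elim: r => [|i r IH]; first by rewrite sum_nil; exact: span0.
by rewrite sum_cons; exact: span_add (hF i) IH.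
Qed.

Lemma conv_suml (I : Type) (r : seq I) (F : I -> arr G -> C) f :
  (forall i, span (F i)) ->
  conv (fun p => \sum_(i <- r) F i p) f = fun p => \sum_(i <- r) conv (F i) f p.
Proof.
move=> hF; elim: r => [|i r IH]; first by rewrite !sum_nil conv0l.
rewrite !sum_cons (conv_addl ir f (hF i) (span_sum r hF)) IH //.
Qed.

Lemma conv_sumr (I : Type) (r : seq I) (F : I -> arr G -> C) f : span f ->
  conv f (fun p => \sum_(i <- r) F i p) = fun p => \sum_(i <- r) conv f (F i) p.
Proof.
move=> sf; elim: r => [|i r IH]; first by rewrite !sum_nil conv0r.
by rewrite !sum_cons (conv_addr ir _ _ sf) IH.
Qed.

Lemma invol_sum (I : Type) (r : seq I) (F : I -> arr G -> C) :
  invol (fun p => \sum_(i <- r) F i p) = fun p => \sum_(i <- r) invol (F i) p.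
Proof. by apply/funext => p; rewrite /invol rmorph_sum. Qed.

Lemma conv_invol_sum (I : Type) (r : seq I) (F : I -> arr G -> C) :
  (forall i, span (F i)) ->
  conv (invol (fun p => \sum_(i <- r) F i p)) (fun p => \sum_(i <- r) F i p) =
  fun p => \sum_(i <- r) \sum_(j <- r) conv (invol (F i)) (F j) p.
Proof.
move=> hF; have hiF i : span (invol (F i)) by exact: (span_invol ir).
rewrite invol_sum conv_suml //; apply/funext => p; apply: eq_bigr => i _.
by rewrite conv_sumr.
Qed.

(** Positivity of the restriction treats all pairs of slices at once and needs an indexed family;
    the [g i] may repeat. *)
Lemma span_rep f : span f -> exists (n : nat) (g : 'I_n -> Gam) (a : 'I_n -> X -> C),
  [/\ forall i, L (g i), forall i, cc (a i) & f = fun p => \sum_i el (g i) (a i) p].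
Proof.
elim=> [|g a k Lg ca _ [n [g' [a' [h1 h2 ->]]]]].
  exists 0%N, (fun _ => 1%g), (fun _ _ => 0); split; [by case|by case|].
  by apply/funext => p; rewrite big_ord0.
exists n.+1, (fun i => if unlift ord0 i is Some j then g' j else g),
  (fun i => if unlift ord0 i is Some j then a' j else a); split.
- by move=> i; case: unliftP => [j _|_].
- by move=> i; case: unliftP => [j _|_].
apply/funext => p; rewrite big_ord_recl unlift_none; congr (_ + _).
by apply: eq_bigr => i _; rewrite liftK.
Qed.

End FiniteSums.

Section Boundary.
Context {R : realType} {Gam : groupType} {X : topologicalType}.
Context {act : Gam -> X -> X} {Y : set X} {N : Gam -> R}.
Hypothesis X_lc : locally_compact [set: X].
Hypothesis X_haus : hausdorff_space X.
Hypothesis ac : continuous_action act.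
Hypothesis Y_clopen : open Y /\ closed Y.
Hypothesis N_pos : forall g, 0 < N g.
Hypothesis N_mul : forall g h, N (g * h)%g = N g * N h.
Notation C := (Cplx R).
Notation Y0 := (Yzero act N Y).
Notation K := (kerN N).

Lemma N1 : N 1%g = 1.
Proof.
have := N_mul 1%g 1%g; rewrite mulg1 => h; apply: (mulfI (lt0r_neq0 (N_pos 1%g))).
by rewrite mulr1.
Qed.

Lemma NV g : N g^-1%g = (N g)^-1.
Proof.
apply: (mulfI (lt0r_neq0 (N_pos g))).
by rewrite -N_mul mulgV N1 mulfV // lt0r_neq0.
Qed.

(** Passing to inverses turns the removed translates into a condition on [act g y], the shape in
    which [Y] enters [conv_el]. *)
Lemma YzeroP y : Y0 y <-> Y y /\ forall g, N g < 1 -> ~ Y (act g y).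
Proof.
split=> [[Yy h]|[Yy h]]; split => //.
  move=> g gl Ygy; apply: h; exists g^-1%g.
    by rewrite /= NV invf_gt1.
  by exists (act g y) => //; rewrite actK.
move=> [g /= g1 [z Yz zy]]; apply: (h g^-1%g); first by rewrite NV invf_lt1.
by rewrite -zy actK.
Qed.

Lemma Yzero_inv k y : K k -> Y0 y -> Y (act k y) -> Y0 (act k y).
Proof.
move=> kk /YzeroP [Yy h] Yky; apply/YzeroP; split => // g g1 Yg.
by apply: (h (g * k)%g); rewrite ?actM // N_mul kk mulr1.
Qed.

(** [Y0] is closed as an intersection of [Y] with preimages of its closed complement. It is
    invariant because right multiplication by the kernel does not change [N]. *)
Lemma ir_Yzero : invariant_reduction act Y K Y0.
Proof.
have [oY cY] := Y_clopen; split => //.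
- rewrite (_ : Y0 = Y `&` \bigcap_(g in [set g | N g < 1]) (act g @^-1` (~` Y))).
    apply: closedI => //; apply: closed_bigI => g _; apply: preimage_closed.
      by move=> x _; exact: act_continuous.
    by rewrite closedC.
  apply/seteqP; split=> y; first by move=> /YzeroP [Yy h]; split.
  by move=> [Yy h]; apply/YzeroP.
- by move=> y [].
- exact: N1.
- by move=> g h gk hk; rewrite /kerN /= N_mul gk hk mulr1.
- by move=> g gk; rewrite /kerN /= NV gk invr1.
- by move=> g w; exact: Yzero_inv.
Qed.

Lemma ir_clopen (L : set Gam) : L 1%g -> (forall g h, L g -> L h -> L (g * h)%g) ->
  (forall g, L g -> L g^-1%g) -> invariant_reduction act Y L Y.
Proof. by have [oY cY] := Y_clopen; split. Qed.

Lemma ir_full : invariant_reduction act Y setT Y.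
Proof. exact: ir_clopen. Qed.

Lemma ir_kerN : invariant_reduction act Y K Y.
Proof. by have h := ir_Yzero; apply: ir_clopen; case: h. Qed.

Notation G := (box act setT Y).
Notation H := (box act K Y0).
Notation elG := (@elem R Gam X act setT Y).
Notation elH := (@elem R Gam X act K Y0).
Notation conv := Defs.conv.
Notation rst := (@restrict_ker R Gam X act N Y).
Notation irG := ir_full.
Notation irH := ir_Yzero.
Implicit Types (f : arr G -> C) (h : arr H -> C) (g : Gam) (a : X -> C).

Lemma elH0 g a : ~ K g -> elH g a = fun=> 0.
Proof.
move=> ng; apply/funext => p; rewrite /elem; case: eqP => // gp.
by case: ng; rewrite -gp; exact: gamP.
Qed.

Lemma rst_elem g a : rst (elG g a) = elH g a.
Proof. by []. Qed.

Lemma rst_span f : span f -> span (rst f).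
Proof.
elim=> [|g a k _ ca _ IH]; first exact: span0.
have [gK|gK] := pselect (K g); first exact: (spanD gK ca IH).
move: IH; congr span; apply/funext => p; rewrite /restrict_ker -/(rst (elG g a) p).
by rewrite rst_elem elH0 // add0r.
Qed.

(** Pairs functions on the two groupoids that have the same coefficients over [ker N]. It is a
    relation because a function on [H] has many such expressions. *)
Inductive lifts : (arr G -> C) -> (arr H -> C) -> Prop :=
| lifts0 : lifts (fun=> 0) (fun=> 0)
| liftsD g a f h : K g -> cc a -> lifts f h ->
    lifts (fun p => elG g a p + f p) (fun p => elH g a p + h p).

Lemma lifts_spanl f h : lifts f h -> span f.
Proof. by elim=> [|g a k l _ ca _ IH]; [exact: span0|exact: spanD]. Qed.
Lemma lifts_spanr f h : lifts f h -> span h.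
Proof. by elim=> [|g a k l gK ca _ IH]; [exact: span0|exact: spanD]. Qed.
Lemma lifts_rst f h : lifts f h -> rst f = h.
Proof.
elim=> [//|g a k l _ _ _ IH]; rewrite -IH; apply/funext => p.
by rewrite /restrict_ker -/(rst (elG g a) p) rst_elem.
Qed.
Lemma span_lifts h : span h -> exists f, lifts f h.
Proof.
elim=> [|g a k gK ca _ [f lf]]; first by exists (fun=> 0); exact: lifts0.
by exists (fun p => elG g a p + f p); exact: liftsD.
Qed.

(** Restriction need not be multiplicative on [C_c]. It is so on slices over [ker N], where
    [conv_el] produces the same coefficient, with the indicator of [Y], in both groupoids. *)
Lemma rst_conv f h f' h' : lifts f h -> lifts f' h' ->
  rst (conv (invol f) f') = conv (invol h) h'.
Proof.
move=> l1 l2; elim: l1 => [|g a k l gK ca lkl IH].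
  by rewrite !invol0 !conv0l.
have k1 := span_invol irG (lifts_spanl lkl); have k2 := span_invol irH (lifts_spanr lkl).
have e1 := span_invol irG (span_elem (L := setT) act Y I ca).
have e2 := span_invol irH (span_elem act Y0 gK ca).
rewrite !involD (conv_addl irG) // (conv_addl irH) // -IH.
suff -> : conv (invol (elH g a)) h' = rst (conv (invol (elG g a)) f') by [].
elim: l2 => {IH} [|g' a' k' l' gK' ca' lkl' IH].
  by rewrite !conv0r.
rewrite (conv_addr irG) // (conv_addr irH) // IH.
rewrite (invol_el irG) (invol_el irH) (conv_el irG) // (conv_el irH) //.
exact: (ir_V irH).
Qed.

(** * From states of the boundary groupoid to ground functionals *)

Section Push.
Variable psi : (arr H -> C) -> C.
Hypothesis hpsi : algebraic_state psi.
Let lin := as_lin hpsi.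
Let pos := as_pos hpsi.

Section Squares.
Variables (n : nat) (g : 'I_n -> Gam) (a : 'I_n -> X -> C).
Hypothesis ca : forall i, cc (a i).

(** For [D] constantly [Y] this is the [(i, j)] term of the restriction of [f^* * f]. A set
    depending on [N (g j)] is allowed because the induction removes points for one value of [N] at a
    time. *)
Definition sq_term (D : R -> set X) i j : arr H -> C := elH ((g i)^-1 * g j)%g
  (fun y => (a i (act (g i)^-1%g (act (g j) y)))^* * ind (D (N (g j))) (act (g j) y) * a j y).

Definition sq_sum D : arr H -> C := fun p => \sum_i \sum_j sq_term D i j p.

Lemma cc_sq_term (D : set X) i j : open D -> closed D ->
  cc (fun y => (a i (act (g i)^-1%g (act (g j) y)))^* * ind D (act (g j) y) * a j y).
Proof.
move=> oD cD; have [ci _] := ca i; have [cj _] := ca j; have ki := ca i.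
have c1 : continuous (fun y => (a i (act (g i)^-1%g (act (g j) y)))^*).
  apply: continuous_conj_comp => y.
  apply: (@continuous_comp _ X C (fun y => act (g i)^-1%g (act (g j) y)) (a i)).
    by apply: continuous_comp; exact: act_continuous.
  exact: ci.
have c2 : continuous (fun y => ind D (act (g j) y) : C).
  move=> y; apply: (@continuous_comp _ X C (act (g j)) (ind D)).
    exact: act_continuous.
  exact: continuous_ind.
exact: ccMl (continuous_mulC c1 c2) (ca j).
Qed.

Lemma span_sq_term D i j : (forall t, open (D t) /\ closed (D t)) -> span (sq_term D i j).
Proof.
move=> hD; have [gK|gK] := pselect (K ((g i)^-1 * g j)%g).
  by apply: span_elem => //; have [? ?] := hD (N (g j)); exact: cc_sq_term.
by rewrite /sq_term elH0 //; exact: span0.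
Qed.

Lemma span_sq_sum D : (forall t, open (D t) /\ closed (D t)) -> span (sq_sum D).
Proof. by move=> hD; do 2 apply: span_sum => ?; exact: span_sq_term. Qed.

(* Peel off the ranges [g l Y] one at a time: the part of the sum living over
   [D (N (g l)) `&` g l Y] is a single square [w^* * w]. *)
Lemma sq_sum_ge0 (s : seq 'I_n) (D : R -> set X) :
  (forall t, open (D t) /\ closed (D t)) ->
  (forall j y, Y y -> D (N (g j)) (act (g j) y) ->
     exists2 l, l \in s & N (g l) = N (g j) /\ Y (act (g l)^-1%g (act (g j) y))) ->
  0 <= psi (sq_sum D).
Proof.
elim: s D => [|l s IH] D hD cov.
  (* With no index left, the covering hypothesis says that the sets meet none of the ranges, so
     every term is zero. *)
  rewrite (_ : sq_sum D = (fun=> 0)) ?(phi0 lin) //.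
  apply/funext => p; rewrite /sq_sum big1 // => i _; rewrite big1 // => j _.
  rewrite /sq_term /elem; case: ifP => // _; rewrite ind0 ?mulr0 ?mul0r // => Dp.
  by have [] := cov j (pt p) (ir_sub irH (ptP p)) Dp.
pose P := act (g l)^-1%g @^-1` Y.
have [oY cY] := Y_clopen.
have oP : open P by apply: open_comp oY => y _; exact: act_continuous.
have cP : closed P by apply: preimage_closed cY => y _; exact: act_continuous.
(* The square formed with [g l] involves only indices on which [N] takes the value [N (g l)], so [P]
   is removed for that value alone. *)
pose D' t := if t == N (g l) then D t `\` P else D t.
have hD' t : open (D' t) /\ closed (D' t).
  rewrite /D'; case: ifP => _ //; have [oD cD] := hD t; rewrite setDE.
  by split; [apply: openI => //; rewrite openC|apply: closedI => //; rewrite closedC].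
have [oDl cDl] := hD (N (g l)).
pose Q := D (N (g l)) `&` P.
have oQ : open Q by exact: openI.
have cQ : closed Q by exact: closedI.
pose b j y := ind Q (act (g j) y) * a j y.
have cb j : cc (b j).
  apply: ccMl (ca j) => y; apply: (@continuous_comp _ X C (act (g j)) (ind Q)).
    exact: act_continuous.
  exact: continuous_ind.
pose w j := elH ((g l)^-1 * g j)%g (b j).
have sw j : span (w j).
  have [gK|gK] := pselect (K ((g l)^-1 * g j)%g); first exact: span_elem.
  by rewrite /w elH0 //; exact: span0.
have -> : sq_sum D = fun p => sq_sum D' p +
    conv (invol (fun p => \sum_j w j p)) (fun p => \sum_j w j p) p.
  apply/funext => p; rewrite (conv_invol_sum irH) // /sq_sum -big_split /=.
  apply: eq_bigr => i _; rewrite -big_split /=; apply: eq_bigr => j _.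
  have KV x y : N x = N y -> K (x^-1 * y)%g.
    by move=> xy; rewrite /kerN /= N_mul NV xy mulVf // lt0r_neq0.
  have VK x y : K (x^-1 * y)%g -> N x = N y.
    rewrite /kerN /= N_mul NV => /(congr1 ( *%R (N x))).
    by rewrite mulrA mulfV ?mul1r ?mulr1 // lt0r_neq0.
  (* Over another value of [N] the slice of [w j] is empty and [D'] agrees with [D]. *)
  have [jl|jl] := eqVneq (N (g j)) (N (g l)); last first.
    rewrite {2}/w elH0; last by move=> /VK jl'; rewrite jl' eqxx in jl.
    by rewrite conv0r addr0 /sq_term /D' (negbTE jl).
  have [il|il] := eqVneq (N (g i)) (N (g l)); last first.
    have nK : ~ K ((g i)^-1 * g j)%g by move=> /VK; rewrite jl => il'; rewrite il' eqxx in il.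
    rewrite /sq_term !elH0 // /w elH0; last by move=> /VK il'; rewrite il' eqxx in il.
    by rewrite invol0 conv0l addr0.
  have Ki := KV _ _ (esym il); have Kj := KV _ _ (esym jl).
  rewrite /w (invol_el irH) (conv_el irH) //; last exact: (ir_V irH).
  have -> : (((g l)^-1 * g i)^-1 * ((g l)^-1 * g j))%g = ((g i)^-1 * g j)%g.
    by rewrite invgM invgK mulgA mulgK.
  rewrite /sq_term -elemD; congr (_ p); apply: eq_elem => y _ _.
  rewrite /b /D' jl eqxx; set x := act (g j) y.
  have e1 : act ((g l)^-1 * g j)%g y = act (g l)^-1%g x by rewrite actM.
  have e2 : act ((g l)^-1 * g i)^-1%g (act ((g l)^-1 * g j)%g y) = act (g i)^-1%g x.
    by rewrite invgM invgK !actM // actVK.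
  rewrite e2 e1 actVK // rmorphM /= conj_ind.
  (* The points outside [P] are left to the induction; those in [Q] are accounted for by the
     square. *)
  have -> : ind (D (N (g l))) x = ind (D (N (g l)) `\` P) x + ind Q x :> C.
    have [Dx|Dx] := pselect (D (N (g l)) x); last first.
      by rewrite !ind0 ?addr0 // => -[].
    have [Px|Px] := pselect (P x).
      by rewrite (ind0 (Y := _ `\` _)) ?add0r ?ind1 // => -[].
    by rewrite (ind0 (Y := Q)) ?addr0 ?ind1 // => -[].
  have QY : ind Q x * ind Y (act (g l)^-1%g x) = ind Q x :> C.
    have [Qx|Qx] := pselect (Q x); last by rewrite ind0 // mul0r.
    by rewrite !ind1 ?mulr1 //; case: Qx.
  have QQ := ind_idem (R := R) Q x.
  rewrite mulrDr mulrDl; congr (_ + _).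
  transitivity ((a i (act (g i)^-1%g x))^* * (ind Q x * ind Y (act (g l)^-1%g x) * ind Q x) * a j y).
    by rewrite QY QQ.
  ring.
have sW : span (fun p => \sum_j w j p) by exact: span_sum.
rewrite (phiD lin); [|exact: span_sq_sum|exact: (span_conv irH (span_invol irH sW) sW)].
apply: addr_ge0; last exact: pos.
(* A remaining point lies outside [P] or over another value of [N]. In either case its covering
   index is not [l], so the shorter list covers it. *)
apply: IH => // j y Yy; rewrite /D'; case: eqP => [jl [Dy nP]|jl Dy].
  have [l' + [h1 h2]] := cov j y Yy Dy; rewrite in_cons => /orP[/eqP ll'|ls].
    by case: nP; rewrite /P /= -ll'.
  by exists l'.
have [l' + [h1 h2]] := cov j y Yy Dy; rewrite in_cons => /orP[/eqP ll'|ls].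
  by case: jl; rewrite -h1 ll'.
by exists l'.
Qed.

End Squares.

(** Each index covers its own range, so the full list of indices satisfies the covering hypothesis
    for the constant family [Y]. *)
Lemma push_pos f : span f -> 0 <= psi (rst (conv (invol f) f)).
Proof.
move=> /span_rep [n [g [a [_ ca ->]]]].
have sE i : span (elG (g i) (a i)) by exact: span_elem.
rewrite (conv_invol_sum irG) //.
rewrite (_ : rst _ = sq_sum g a (fun=> Y)).
  apply: (sq_sum_ge0 ca (s := index_enum _)) => // j y Yy _.
  by exists j; [rewrite mem_index_enum|rewrite actK].
apply/funext => p; rewrite /restrict_ker /sq_sum; apply: eq_bigr => i _.
apply: eq_bigr => j _.
by rewrite (invol_el irG) (conv_el irG) // -/(rst (elG _ _) p) rst_elem.
Qed.

Lemma push_state : algebraic_state (fun f => psi (rst f)).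
Proof.
split.
- by move=> k f1 f2 s1 s2; rewrite -lin //; exact: rst_span.
- exact: push_pos.
- by move=> e; exact: (as_le1 hpsi).
- by move=> e; exact: (as_approx hpsi).
Qed.

(** The square carries the factor [ind Y (act g y)], which vanishes for [y] in [Y0]. *)
Lemma push_ground g a : cc a -> N g < 1 ->
  psi (rst (conv (invol (elG g a)) (elG g a))) = 0.
Proof.
move=> ca g1; rewrite (conv_invol_el irG) // rst_elem.
rewrite (_ : elH _ _ = (fun=> 0)) ?(phi0 lin) //.
rewrite -(elem0 act K Y0 1%g); apply: eq_elem => y /YzeroP [_ h] _.
by rewrite ind0 ?mulr0 //; exact: h.
Qed.

End Push.

(** * Ground functionals factor through the boundary groupoid *)

Section Pull.
Variable phi : (arr G -> C) -> C.
Hypothesis hphi : algebraic_state phi.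
Hypothesis ground : forall g a, cc a -> N g < 1 ->
  phi (conv (invol (elG g a)) (elG g a)) = 0.
Let lin := as_lin hphi.
Let pos := as_pos hphi.

Lemma ground_ip g a f : cc a -> N g < 1 -> span f -> ip phi f (elG g a) = 0.
Proof.
move=> ca g1 sf; apply: cmod_eq0; apply/eqP; rewrite eq_le cmod_ge0 andbT.
have sg : span (elG g a) by exact: span_elem.
apply: le_trans (ip_le irG lin pos sf sg) _.
by rewrite {2}/nrm /ip ground // sqrtr0 mulr0.
Qed.

(** The part of [q] on which [act g y] lies in [Y] is a product of the adjoint of [el g e] with
    [el g q], killed by [ground_ip]; the other part is covered by the shorter list. *)
Lemma el1_vanish (s : seq Gam) (q : X -> C) : (forall g, g \in s -> N g < 1) ->
  cc q -> (forall y, Y y -> q y != 0 -> exists2 g, g \in s & Y (act g y)) ->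
  phi (elG 1%g q) = 0.
Proof.
elim: s q => [|g s IH] q sN cq cov.
  rewrite (_ : elG 1%g q = (fun=> 0)) ?(phi0 lin) //.
  rewrite -(elem0 act setT Y 1%g); apply: eq_elem => y Yy _.
  by apply: contrapT => /eqP /(cov y Yy) [].
pose q1 y := ind Y (act g y) * q y; pose q2 y := (1 - ind Y (act g y)) * q y.
have ci : continuous (fun x => ind Y (act g x) : C) by exact: (continuous_indY irG).
have cq1 : cc q1 := ccMl ci cq.
have ci2 : continuous (fun x => 1 - ind Y (act g x) : C).
  by move=> x; apply: cvgB; [exact: cvg_cst|exact: ci].
have cq2 : cc q2 := ccMl ci2 cq.
have s1 : span (elG 1%g q1) by exact: span_elem.
have s2 : span (elG 1%g q2) by exact: span_elem.
have -> : elG 1%g q = fun p => elG 1%g q1 p + elG 1%g q2 p.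
  apply/funext => p; rewrite -elemD; congr (_ p); apply: eq_elem => y _ _.
  by rewrite /q1 /q2 -mulrDl addrC subrK mul1r.
rewrite (phiD lin) // (IH q2) //; last 2 first.
- by move=> g' gs; apply: sN; rewrite in_cons gs orbT.
- move=> y Yy; have [Yg|Yg] := pselect (Y (act g y)).
    by rewrite /q2 ind1 // subrr mul0r eqxx.
  rewrite /q2 ind0 // subr0 mul1r => qy; have [g' + Yg'] := cov y Yy qy.
  by rewrite in_cons => /orP[/eqP gg|gs]; [case: Yg; rewrite -gg|exists g'].
have [_ [K1 cK1 q0]] := cq; have [e [ce _ _] e1] := exists_cutoff (R := R) irG cK1.
rewrite addr0 (_ : elG 1%g q1 = conv (invol (elG g (fun x => ofR (e x)))) (elG g q)).
  by apply: (ground_ip cq) => //; [apply: sN; rewrite in_cons eqxx|exact: span_elem].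
rewrite (invol_el irG) (conv_el irG) // mulVg; apply: eq_elem => y _ _.
rewrite actK // conj_ofR /q1; have [Ky|/q0 ->] := pselect (K1 y); last by rewrite !mulr0.
by rewrite e1 // mul1r.
Qed.

Lemma el1_ge0 (q : X -> R) : cc (fun x => ofR (q x)) -> (forall x, 0 <= q x) ->
  0 <= phi (elG 1%g (fun x => ofR (q x))).
Proof.
move=> cq q0; have [c1 [K1 cK1 z1]] := cq.
have cR : continuous q.
  rewrite (_ : q = @cRe R \o (fun x => ofR (q x))) // => x.
  by apply: continuous_comp; [exact: c1|exact: continuous_cRe].
have cs : cc (fun x => ofR (Num.sqrt (q x))).
  split; last by exists K1 => // x /z1 /ofR_inj ->; rewrite sqrtr0.
  apply: (@continuous_ofR_comp R X (fun x => Num.sqrt (q x))) => x.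
  by apply: (@continuous_comp _ R R q Num.sqrt); [exact: cR|exact: sqrt_continuous].
have := pos (span_elem act Y (I : [set: Gam] 1%g) cs).
rewrite (invol_el1 irG) (conv_el11 irG); congr (0 <= phi _); apply: eq_elem => y _ _.
by rewrite conj_ofR -ofRM -expr2 sqr_sqrtr.
Qed.

Lemma compact_cover_lt1 (K1 : set X) : compact K1 ->
  (forall y, K1 y -> exists2 g, N g < 1 & Y (act g y)) ->
  exists2 s : seq Gam, forall g, g \in s -> N g < 1 &
    forall y, K1 y -> exists2 g, g \in s & Y (act g y).
Proof.
move=> /compact_near_coveringP cK cov.
pose F := filter_from setT
  (fun s0 : seq Gam => [set s : seq Gam | {subset s0 <= s}]).
have FF : Filter F.
  apply: filter_from_filter; first by exists [::].
  move=> s1 s2 _ _; exists (s1 ++ s2) => // s ss.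
  by split=> x xs; apply: ss; rewrite mem_cat xs ?orbT.
have [|s0 _ /(_ s0)] := cK _ F
    (fun s y => exists g, [/\ g \in s, N g < 1 & Y (act g y)]) FF.
  move=> y /cov [g g1 Yg].
  exists (act g @^-1` Y, [set s : seq Gam | g \in s]).
    split; last by exists [:: g] => // s; apply; rewrite inE.
    apply: act_continuous => //; apply: open_nbhs_nbhs; split => //.
    by case: Y_clopen.
  by move=> [z s] [/= Yz gs]; exists g.
move=> /(_ (fun _ z => z)) h; exists [seq g <- s0 | N g < 1].
  by move=> g; rewrite mem_filter => /andP[].
by move=> y /h [g [gs g1 Yg]]; exists g => //; rewrite mem_filter g1.
Qed.

(** The truncation [qe] is nonzero only where [q] exceeds [eps]. Within [Y] this happens inside a
    compact set disjoint from [Y0], so finitely many [g] suffice for [el1_vanish]. The difference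
    [q - qe] is at most [eps] times the square of a cutoff, whose value is at most [1]. *)
Lemma el1_vanish_Yzero (q : X -> R) : cc (fun x => ofR (q x)) ->
  (forall x, 0 <= q x) -> (forall y, Y0 y -> q y = 0) ->
  phi (elG 1%g (fun x => ofR (q x))) = 0.
Proof.
move=> cq q0 qY; have /cge0P[r0 i0] := el1_ge0 cq q0.
apply: cplxP => //; rewrite cRe0; apply/eqP; rewrite eq_le r0 andbT.
apply/ler_addgt0Pl => eps eps0; rewrite addr0.
have [c1 [K1 cK1 z1]] := cq.
have {}z1 x : ~ K1 x -> q x = 0 by move=> /z1 /ofR_inj.
have cR : continuous q.
  rewrite (_ : q = @cRe R \o (fun x => ofR (q x))) // => x.
  by apply: continuous_comp; [exact: c1|exact: continuous_cRe].
have [oY cY] := Y_clopen.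
pose qe x := Num.max 0 (q x - eps).
have cqe : continuous qe.
  move=> x; apply: (@continuous_max R X (fun=> 0) (fun x => q x - eps)).
    exact: cvg_cst.
  by apply: (@cvgB _ R^o); [exact: cR|exact: cvg_cst].
have ccqe : cc (fun x => ofR (qe x)).
  split; first exact: (continuous_ofR_comp cqe).
  by exists K1 => // x /z1 h; rewrite /qe h max_l // sub0r oppr_le0 ltW.
have [||s sN scov] := @compact_cover_lt1 (K1 `&` (Y `&` [set x | eps <= q x])).
- apply: compact_closedI => //; apply: closedI => //.
  by apply: (@preimage_closed _ _ q [set r | eps <= r]) => [x _|]; [exact: cR|exact: closed_ge].
- move=> y [_ [Yy qy]]; apply: contrapT => none.
  have : q y = 0.
    by apply: qY; apply/YzeroP; split => // g g1 Yg; apply: none; exists g.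
  by move=> qy0; move: qy; rewrite /= qy0 leNgt eps0.
have vq : phi (elG 1%g (fun x => ofR (qe x))) = 0.
  apply: (@el1_vanish s) => // y Yy qy.
  have hq : eps < q y.
    rewrite ltNge; apply/negP => h; move: qy; rewrite /qe max_l ?eqxx //.
    by rewrite subr_le0.
  apply: scov; split; last by split => //=; exact: ltW.
  by apply: contrapT => /z1 h; move: hq; rewrite h ltNge ltW.
have [e [ce ceR e01] e1] := exists_cutoff (R := R) irG cK1.
(* The nonnegative slack [r] expresses the domination of [q - qe] as an identity, to which
   positivity of [phi] applies. *)
pose r x := eps * e x ^+ 2 - (q x - qe x).
have rE x : 0 <= r x.
  rewrite /r /qe; have [Kx|/z1 ->] := pselect (K1 x).
    rewrite e1 // expr1n mulr1; have := q0 x.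
    by case: (leP 0 (q x - eps)) => ? ?; lra.
  rewrite max_l; last by rewrite sub0r oppr_le0 ltW.
  by rewrite subrr subr0 mulr_ge0 ?sqr_ge0 // ltW.
have ccr : cc (fun x => ofR (r x)).
  have [_ [K2 cK2 z2]] := ce.
  split; last first.
    exists (K1 `|` K2); first exact: compactU.
    move=> x nK; rewrite /r /qe z1; last by move=> ?; apply: nK; left.
    have -> : e x = 0 by apply: ofR_inj; apply: z2 => ?; apply: nK; right.
    rewrite max_l; last by rewrite sub0r oppr_le0 ltW.
    by rewrite expr0n mulr0 subrr subr0.
  apply: (@continuous_ofR_comp R X r) => x; apply: (@cvgB _ R^o).
    apply: cvgM; first exact: cvg_cst.
    by apply: cvgM; exact: ceR.
  by apply: (@cvgB _ R^o); [exact: cR|exact: cqe].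
have le1 := as_le1 hphi (And3 ce ceR e01).
have /cge0P[r1 _] := el1_ge0 ccr rE.
have se : span (@el_sq R Gam X act setT Y e).
  have s0 := span_cutoff irG (And3 ce ceR e01).
  by rewrite -(conv_cutoff irG); exact: (span_conv irG (span_invol irG s0) s0).
have sq : span (elG 1%g (fun x => ofR (q x))) by exact: span_elem.
have sqe : span (elG 1%g (fun x => ofR (qe x))) by exact: span_elem.
have sr : span (elG 1%g (fun x => ofR (r x))) by exact: span_elem.
have : (fun p => elG 1%g (fun x => ofR (q x)) p + elG 1%g (fun x => ofR (r x)) p) =
    fun p => ofR eps * el_sq e p + elG 1%g (fun x => ofR (qe x)) p.
  apply/funext => p; rewrite /el_sq -elemZ -!elemD; congr (_ p).
  by apply: eq_elem => y _ _; rewrite -!ofRD -ofRM -ofRD; congr ofR; rewrite /r; ring.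
move=> /(congr1 phi); rewrite (phiD lin) // lin // vq addr0 => /(congr1 (@cRe R)).
rewrite !cRIE mul0r subr0 => h.
apply: (@le_trans _ _ (eps * cRe (phi (el_sq e)))).
  by rewrite -h lerDl.
by rewrite ler_piMr // ltW.
Qed.

Lemma phi_invol f : span f -> phi (invol f) = (phi f)^*.
Proof.
move=> sf; have si := span_invol irG sf.
have [K1 cK1 h1] := cutoff_unit irG sf; have [K2 cK2 h2] := cutoff_unit irG si.
have [e ce e1] := exists_cutoff (R := R) irG (compactU cK1 cK2).
have [ef _] := h1 e ce (fun x Kx => e1 x (or_introl Kx)).
have [_ fe] := h2 e ce (fun x Kx => e1 x (or_intror Kx)).
have se := span_cutoff irG ce; have := ip_conj irG lin pos se sf.
rewrite /ip fe (invol_el1 irG).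
rewrite (_ : elG 1%g (fun y => (ofR (e y))^*) = elG 1%g (fun x => ofR (e x))) ?ef //.
by apply: eq_elem => y _ _; rewrite conj_ofR.
Qed.

(** Cauchy-Schwarz against a cutoff that is a unit for [f]; consequently [phi f] vanishes with the
    square of [f]. *)
Lemma phi_le_nrm f : span f -> exists e, cmod (phi f) <= nrm phi e * nrm phi f.
Proof.
move=> sf; have [K1 cK1 h1] := cutoff_unit irG sf.
have [e ce e1] := exists_cutoff (R := R) irG cK1; have [ef _] := h1 e ce e1.
have se := span_cutoff irG ce; exists (elG 1%g (fun x => ofR (e x))).
have := ip_le irG lin pos se sf; rewrite {1}/ip (invol_el1 irG).
rewrite (_ : elG 1%g (fun y => (ofR (e y))^*) = elG 1%g (fun x => ofR (e x))) ?ef //.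
by apply: eq_elem => y _ _; rewrite conj_ofR.
Qed.

Lemma phi_elem_lt1 g a : cc a -> N g < 1 -> phi (elG g a) = 0.
Proof.
move=> ca g1; have sg : span (elG g a) by exact: span_elem.
have [e] := phi_le_nrm sg; rewrite {2}/nrm /ip ground // sqrtr0 mulr0 => h.
by apply: cmod_eq0; apply/eqP; rewrite eq_le h cmod_ge0.
Qed.

(** This makes the descent to the boundary groupoid well defined. It is proved slice by slice, since
    restriction preserves slices. *)
Lemma phi_rst0 f : span f -> rst f = (fun=> 0) -> phi f = 0.
Proof.
move=> /(CcP irG) cf rf0.
suff h (s : seq Gam) : span (fun p => if gam p \in s then f p else 0) /\
    phi (fun p => if gam p \in s then f p else 0) = 0.
  have [s fs] := Cc_finite_gam cf; have [_ <-] := h s.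
  congr phi; apply/funext => p; case: ifP => // /negbT ps; apply/eqP.
  by apply: contraNT ps; exact: fs.
elim: s => [|g s [IH1 IH2]].
  by split; [exact: span0|exact: (phi0 lin)].
have [gs|gs] := boolP (g \in s).
  rewrite (_ : (fun p => _) = (fun p => if gam p \in s then f p else 0)) //.
  by apply/funext => p; rewrite in_cons; case: eqP => // ->; rewrite gs.
have [a ca aE] := Cc_fiber irG cf (I : [set: Gam] g).
have sg : span (elG g a) by exact: span_elem.
have -> : (fun p => if gam p \in g :: s then f p else 0) =
    fun p => elG g a p + (if gam p \in s then f p else 0).
  apply/funext => p; rewrite in_cons /elem.
  by case: eqP => [gp|_]; rewrite ?add0r // gp (negbTE gs) addr0 aE.
split; first exact: span_add.
rewrite (phiD lin) // IH2 addr0.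
(* The case [N g > 1] reduces to [N g < 1] by taking adjoints. For [N g = 1] the square of the slice
   has a nonnegative coefficient that vanishes on [Y0]. *)
have [g1|g1|g1] := ltgtP (N g) 1; first exact: phi_elem_lt1.
  rewrite -[LHS]conjCK -phi_invol // (invol_el irG) phi_elem_lt1 ?conjC0 //.
    exact: (cc_invol irG).
  by rewrite NV invf_lt1.
have [e] := phi_le_nrm sg; rewrite {2}/nrm /ip (conv_invol_el irG) //.
pose q x : R := cRe ((a x)^* * a x * ind Y (act g x)).
have qE x : (a x)^* * a x * ind Y (act g x) = ofR (q x).
  apply: cge0E; rewrite mulC_conj /ind.
  by case: (_ \in _); rewrite ?mulr1 ?mulr0 // -[0]/(ofR 0) ler_ofR sqr_ge0.
have -> : elG 1%g (fun x => (a x)^* * a x * ind Y (act g x)) = elG 1%g (fun x => ofR (q x)).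
  by apply: eq_elem => y _ _; exact: qE.
rewrite el1_vanish_Yzero ?sqrtr0 ?mulr0.
- by move=> h; apply: cmod_eq0; apply/eqP; rewrite eq_le h cmod_ge0.
- have [c1 _] := ca; have cci : continuous (fun x => ind Y (act g x) : C).
    exact: (continuous_indY irG).
  have := ccMr (ccMl (continuous_conj_comp c1) ca) cci.
  by congr cc; apply/funext => x; exact: qE.
- by move=> x; have := qE x; rewrite mulC_conj /ind; case: (_ \in _);
    rewrite ?mulr1 ?mulr0 => /ofR_inj <-; rewrite ?sqr_ge0.
move=> y Yy; apply: ofR_inj; rewrite -qE; have [Yg|Yg] := pselect (Y (act g y)).
  have Yg0 := Yzero_inv g1 Yy Yg.
  pose p : arr H := mkarr (g1 : K g) Yy Yg0.
  have := congr1 (fun k => k p) rf0; rewrite /restrict_ker => fp.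
  have ay : a y = 0 by rewrite -[RHS]fp -(aE (box_incl p) erefl).
  by rewrite ay mulr0 mul0r.
by rewrite ind0 // mulr0.
Qed.

Lemma pull_state : exists2 psi : (arr H -> C) -> C,
  algebraic_state psi & forall f, span f -> psi (rst f) = phi f.
Proof.
(* Evaluate [phi] on an arbitrary lift; by [phi_rst0] the choice does not affect the value. *)
pose psi h := phi (xget (fun=> 0) [set f | lifts f h]).
have psiE f : span f -> psi (rst f) = phi f.
  move=> sf; have [f' lf] := span_lifts (rst_span sf).
  rewrite /psi; case: xgetP => [f2 _ l2|/(_ f') //].
  have s2 := lifts_spanl l2; apply/eqP; rewrite -subr_eq0 addrC -mulN1r; apply/eqP.
  rewrite -lin //; apply: phi_rst0; first exact: span_add (span_scale _ sf) s2.
  apply/funext => p; have := congr1 (fun k => k p) (lifts_rst l2).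
  by rewrite /restrict_ker => ->; rewrite mulN1r addNr.
exists psi => //; split.
- move=> k h1 h2 s1 s2; have [f1 l1] := span_lifts s1; have [f2 l2] := span_lifts s2.
  have [t1 t2] := (lifts_spanl l1, lifts_spanl l2).
  have := psiE _ (span_add (span_scale k t1) t2); rewrite lin //.
  rewrite -{1}(lifts_rst l1) -{1}(lifts_rst l2) -(psiE f1) // -(psiE f2) //.
  by rewrite (lifts_rst l1) (lifts_rst l2) => <-; rewrite -{1}(lifts_rst l1) -{1}(lifts_rst l2).
- move=> h sh; have [f lf] := span_lifts sh; have sf := lifts_spanl lf.
  rewrite -(rst_conv lf lf) psiE; first exact: pos.
  exact: (span_conv irG (span_invol irG sf) sf).
- move=> e ce; have := as_le1 hphi ce; rewrite -psiE //.
  have s0 := span_cutoff irG ce.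
  by rewrite -(conv_cutoff irG); exact: (span_conv irG (span_invol irG s0) s0).
move=> eps eps0; have [K1 cK1 hK] := as_approx hphi eps0; exists K1 => // e ce e1.
have := hK e ce e1; rewrite -psiE //; have s0 := span_cutoff irG ce.
by rewrite -(conv_cutoff irG); exact: (span_conv irG (span_invol irG s0) s0).
Qed.

(** Over an empty [Y0] every squared cutoff would have value [0], against [as_approx] with [eps] one
    half. *)
Lemma ground_Yzero_neq0 : Y0 !=set0.
Proof.
apply: contrapT => none; have half0 : 0 < 2^-1 :> R by [].
have [K1 cK1 hK] := as_approx hphi half0.
have [e ce e1] := exists_cutoff (R := R) irG cK1; have := hK e ce e1.
rewrite /el_sq el1_vanish_Yzero.
- by rewrite cRe0; lra.
- have [[_ [K2 cK2 z2]] c _] := ce; split.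
    apply: (@continuous_ofR_comp R X (fun x => e x ^+ 2)) => x.
    by apply: cvgM; exact: c.
  by exists K2 => // x /z2 /ofR_inj ->; rewrite expr0n.
- by move=> x; exact: sqr_ge0.
by move=> y Yy; case: none; exists y.
Qed.

End Pull.
End Boundary.

(** * Fourier inversion at a point *)

Section SmoothFunctions.
Context {R : realType}.
Implicit Types (w f : R -> R) (x y t : R).

Definition rsmooth w := forall n x, derivable (derive1n n w) x 1.

(** Smoothness without computing higher derivatives: it suffices to exhibit a class of
    differentiable functions closed under derivation. *)
Lemma rsmooth_of_class (P : (R -> R) -> Prop) :
  (forall f, P f -> forall x, derivable f x 1) -> (forall f, P f -> P (derive1 f)) ->
  forall f, P f -> rsmooth f.
Proof.
move=> hd hP f Pf n x; apply: (hd); elim: n => [//|n IH].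
by rewrite derive1nS; exact: hP.
Qed.

Lemma rsmooth_derive1 w : rsmooth w -> rsmooth (derive1 w).
Proof. by move=> sw n x; rewrite -derive1Sn; exact: sw. Qed.

Lemma rsmooth_is_derive w x : rsmooth w -> is_derive x 1 w ((derive1 w) x).
Proof. by move=> sw; rewrite derive1E; apply: derivableP; exact: (sw 0%N). Qed.

Lemma is_derive_continuous (f df : R -> R) :
  (forall x : R, is_derive x 1 f (df x)) -> continuous f.
Proof.
by move=> h x; apply: differentiable_continuous; apply/derivable1_diffP; case: (h x).
Qed.

Lemma rsmooth_continuous w : rsmooth w -> continuous w.
Proof. by move=> sw; apply: is_derive_continuous => x; exact: rsmooth_is_derive. Qed.

Lemma derive1_near0 w x : (\forall y \near x, w y = 0) ->
  is_derive x 1 w 0.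
Proof.
move=> h; have e : \forall y \near x, (cst 0 : R -> R) y = w y.
  by apply: filterS h => y ->.
apply: DeriveDef.
  apply: (@near_eq_derivable R R R (cst 0) w x 1 e); exact: derivable_cst.
by rewrite -(@near_eq_derive R R R (cst 0) w x 1 e) derive_cst.
Qed.

(** The gap between [M'] and [M] makes [w] and all its derivatives vanish at both ends of the
    interval, so integrations by parts have no boundary terms. *)
Definition test (M : R) w :=
  rsmooth w /\ exists2 M' : R, 0 < M' < M & forall x, M' < `|x| -> w x = 0.

Lemma test_derive1 M w : test M w -> test M (derive1 w).
Proof.
move=> [sw [M' M'M w0]]; split; first exact: rsmooth_derive1.
exists M' => // x xM; rewrite derive1E; apply: derive_val.
apply: derive1_near0; have : nbhs x [set y : R | M' < `|y|].
  apply: open_nbhs_nbhs; split => //.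
  apply: (@open_comp _ _ (fun y : R => `|y|) [set r | M' < r]).
    by move=> y _; exact: (@norm_continuous _ R^o).
  exact: open_gt.
by apply: filterS => y; exact: w0.
Qed.

Lemma test_continuous M w : test M w -> continuous w.
Proof. by move=> [/rsmooth_continuous]. Qed.

Lemma test_bound0 M w x : test M w -> M <= `|x| -> w x = 0.
Proof. by move=> [_ [M' /andP[_ h] w0]] Mx; apply: w0; exact: lt_le_trans Mx. Qed.

End SmoothFunctions.

(** * Oscillatory integrals over an interval and their decay in [t] *)

Section OscillatoryIntegrals.
Context {R : realType} (M s : R).
Hypothesis M0 : 0 < M.
Notation mu := (@lebesgue_measure R).
Implicit Types (w f g : R -> R) (x y t : R).

Lemma itv_integrable f a b : continuous f -> mu.-integrable `[a, b] (EFin \o f).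
Proof.
move=> cf; apply: continuous_compact_integrable; first exact: segment_compact.
exact: continuous_subspaceT.
Qed.

Lemma FTC2_is_derive (f df : R -> R) (a b : R) : a < b -> continuous df ->
  (forall x : R, is_derive x 1 f (df x)) ->
  \int[mu]_(x in `[a, b]) df x = f b - f a.
Proof.
move=> ab cdf hf; have cf := is_derive_continuous hf.
rewrite /Rintegral (@continuous_FTC2 _ df f) //.
- exact: continuous_subspaceT.
- split; first by move=> x _; case: (hf x).
    exact: cvg_at_right_filter (cf a).
  exact: cvg_at_left_filter (cf b).
- by move=> x _; rewrite derive1E; apply: derive_val.
Qed.

(* The real and (up to sign) imaginary parts of the Fourier transform of [w],
   multiplied by the character [expi (t * s)]. *)
Definition cosI w t := \int[mu]_(y in `[- M, M]) (w y * cos (t * (y - s))).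
Definition sinI w t := \int[mu]_(y in `[- M, M]) (w y * sin (t * (y - s))).

Lemma is_derive_phase (t y : R) : is_derive y 1 (fun y => t * (y - s)) t.
Proof.
have h : is_derive y 1 (fun y : R => y - s) 1.
  by rewrite -[X in is_derive _ _ _ X](subr0 1); apply: is_deriveB.
by rewrite -[X in is_derive _ _ _ X]mulr1; exact: (@is_deriveZ _ _ _ (fun y => y - s) t y 1 1 h).
Qed.

Lemma is_derive_cos_phase t y :
  is_derive y 1 (fun y => cos (t * (y - s))) (- sin (t * (y - s)) * t).
Proof. exact: (is_derive1_comp (is_derive_cos _) (is_derive_phase t y)). Qed.

Lemma is_derive_sin_phase t y :
  is_derive y 1 (fun y => sin (t * (y - s))) (cos (t * (y - s)) * t).
Proof. exact: (is_derive1_comp (is_derive_sin _) (is_derive_phase t y)). Qed.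

Lemma continuous_cos_phase t : continuous (fun y => cos (t * (y - s))).
Proof. by apply: is_derive_continuous => y; exact: is_derive_cos_phase. Qed.

Lemma continuous_sin_phase t : continuous (fun y => sin (t * (y - s))).
Proof. by apply: is_derive_continuous => y; exact: is_derive_sin_phase. Qed.

Lemma continuousMR f g : continuous f -> continuous g -> continuous (fun y => f y * g y).
Proof. by move=> cf cg y; apply: cvgM; [exact: cf|exact: cg]. Qed.

Lemma itv_gt : - M < M. Proof. by rewrite gtrN. Qed.

Lemma test_endpoints w : test M w -> w M = 0 /\ w (- M) = 0.
Proof.
by move=> tw; split; apply: (test_bound0 tw); rewrite ?normrN ger0_norm // ltW.
Qed.

Lemma cosI_by_parts w t : test M w -> t * cosI w t = - sinI (derive1 w) t.
Proof.
move=> tw; have [wM wNM] := test_endpoints tw; have [sw _] := tw.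
have cw := test_continuous tw; have cw' := test_continuous (test_derive1 tw).
have cs := @continuous_sin_phase t; have cc := @continuous_cos_phase t.
pose df y := t * (w y * cos (t * (y - s))) + derive1 w y * sin (t * (y - s)).
have d y : is_derive y 1 (fun y => w y * sin (t * (y - s))) (df y).
  rewrite (_ : df y = w y * (cos (t * (y - s)) * t) + sin (t * (y - s)) * derive1 w y).
    exact: is_deriveM (rsmooth_is_derive y sw) (is_derive_sin_phase t y).
  by rewrite /df; ring.
have c1 : continuous (fun y => w y * cos (t * (y - s))) := continuousMR cw cc.
have c2 : continuous (fun y => (derive1 w) y * sin (t * (y - s))) := continuousMR cw' cs.
have c3 : continuous (fun y => t * (w y * cos (t * (y - s)))).
  by apply: continuousMR => // y; exact: cvg_cst.
have cdf : continuous df by move=> y; apply: (@cvgD _ R^o); [exact: c3|exact: c2].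
have := FTC2_is_derive itv_gt cdf d; rewrite wM wNM !mul0r subr0 /df.
rewrite RintegralD //; [|exact: itv_integrable|exact: itv_integrable].
rewrite RintegralZl //; last exact: itv_integrable.
by rewrite -/(cosI w t) -/(sinI (derive1 w) t) => /eqP; rewrite addr_eq0 => /eqP.
Qed.

Lemma sinI_by_parts w t : test M w -> t * sinI w t = cosI (derive1 w) t.
Proof.
move=> tw; have [wM wNM] := test_endpoints tw; have [sw _] := tw.
have cw := test_continuous tw; have cw' := test_continuous (test_derive1 tw).
have cs := @continuous_sin_phase t; have cc := @continuous_cos_phase t.
pose df y := derive1 w y * cos (t * (y - s)) - t * (w y * sin (t * (y - s))).
have d y : is_derive y 1 (fun y => w y * cos (t * (y - s))) (df y).
  rewrite (_ : df y = w y * (- sin (t * (y - s)) * t) + cos (t * (y - s)) * derive1 w y).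
    exact: is_deriveM (rsmooth_is_derive y sw) (is_derive_cos_phase t y).
  by rewrite /df; ring.
have c1 : continuous (fun y => w y * sin (t * (y - s))) := continuousMR cw cs.
have c2 : continuous (fun y => derive1 w y * cos (t * (y - s))) := continuousMR cw' cc.
have c3 : continuous (fun y => t * (w y * sin (t * (y - s)))).
  by apply: continuousMR => // y; exact: cvg_cst.
have cdf : continuous df by move=> y; apply: (@cvgB _ R^o); [exact: c2|exact: c3].
have := FTC2_is_derive itv_gt cdf d; rewrite wM wNM !mul0r subr0 /df.
rewrite RintegralB //; [|exact: itv_integrable|exact: itv_integrable].
rewrite RintegralZl //; last exact: itv_integrable.
by rewrite -/(sinI w t) -/(cosI (derive1 w) t) => /eqP; rewrite subr_eq0 => /eqP.
Qed.

Definition absI w := \int[mu]_(y in `[- M, M]) `|w y|.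

Lemma continuous_norm_comp w : continuous w -> continuous (fun y => `|w y|).
Proof.
by move=> cw y; apply: (continuous_comp (f := w)); [exact: cw|exact: (@norm_continuous _ R^o)].
Qed.

Lemma kernelI_le w (k : R -> R) : continuous w -> continuous k ->
  (forall y, `|k y| <= 1) -> `|\int[mu]_(y in `[- M, M]) (w y * k y)| <= absI w.
Proof.
move=> cw ck k1; have cwk := continuousMR cw ck.
apply: le_trans.
  by apply: le_normr_Rintegral => //; exact: itv_integrable.
apply: le_Rintegral => //.
- by apply: itv_integrable; exact: (continuous_norm_comp cwk).
- by apply: itv_integrable; exact: (continuous_norm_comp cw).
by move=> y _; rewrite normrM ler_piMr.
Qed.

Lemma cosI_le w t : continuous w -> `|cosI w t| <= absI w.
Proof.
move=> cw; apply: kernelI_le => //; first exact: (@continuous_cos_phase t).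
by move=> y; rewrite ler_norml cos_geN1 cos_le1.
Qed.

Lemma sinI_le w t : continuous w -> `|sinI w t| <= absI w.
Proof.
move=> cw; apply: kernelI_le => //; first exact: (@continuous_sin_phase t).
by move=> y; rewrite ler_norml sin_geN1 sin_le1.
Qed.

(** The first term bounds the oscillatory integral, the second bounds [t ^+ 2] times it after two
    integrations by parts. *)
Definition decayC w := absI w + absI (derive1 (derive1 w)).

Lemma cosI_decay w t : test M w -> `|cosI w t| <= decayC w * (oneDsqr t)^-1.
Proof.
move=> tw; have tw' := test_derive1 tw; have tw2 := test_derive1 tw'.
have e : t ^+ 2 * cosI w t = - cosI (derive1 (derive1 w)) t.
  by rewrite expr2 -mulrA cosI_by_parts // mulrN sinI_by_parts.
rewrite ler_pdivlMr ?oneDsqr_gt0 // /oneDsqr mulrDr mulr1.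
have h1 := cosI_le t (test_continuous tw); have h2 := cosI_le t (test_continuous tw2).
apply: lerD => //; rewrite -[X in _ * X]ger0_norm ?sqr_ge0 // -normrM mulrC e.
by rewrite normrN.
Qed.

Lemma sinI_decay w t : test M w -> `|sinI w t| <= decayC w * (oneDsqr t)^-1.
Proof.
move=> tw; have tw' := test_derive1 tw; have tw2 := test_derive1 tw'.
have e : t ^+ 2 * sinI w t = - sinI (derive1 (derive1 w)) t.
  by rewrite expr2 -mulrA sinI_by_parts // cosI_by_parts.
rewrite ler_pdivlMr ?oneDsqr_gt0 // /oneDsqr mulrDr mulr1.
have h1 := sinI_le t (test_continuous tw); have h2 := sinI_le t (test_continuous tw2).
apply: lerD => //; rewrite -[X in _ * X]ger0_norm ?sqr_ge0 // -normrM mulrC e.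
by rewrite normrN.
Qed.

(** Domination is required only within distance [1] of [t], which suits a bound on [df] that grows
    with [x]. *)
Lemma is_derive_under_integral (B : set R) (f df : R -> R -> R) (G : R -> R) (t : R) :
  measurable B -> (forall x, mu.-integrable B (EFin \o f x)) ->
  (forall x y, B y -> is_derive x 1 (f ^~ y) (df x y)) ->
  mu.-integrable B (EFin \o G) -> (forall y, 0 <= G y) ->
  (forall x y, `|x - t| < 1 -> B y -> `|df x y| <= G y) ->
  is_derive t 1 (fun x => \int[mu]_(y in B) f x y) (\int[mu]_(y in B) df t y).
Proof.
move=> mB intf hd intG G0 hG.
have It : `]t - 1, t + 1[%classic t by rewrite /= in_itv /= ltrBlDr ltrDl ltr01.
have dE x y : B y -> partial1of2 f x y = df x y.
  by move=> /(hd x) h; rewrite partial1of2E; exact: derive_val.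
have i1 x : `]t - 1, t + 1[%classic x -> mu.-integrable B (EFin \o f x) by [].
have i2 x y : `]t - 1, t + 1[%classic x -> B y -> derivable (f ^~ y) x 1.
  by move=> _ /(hd x) h; exact: ex_derive.
have i3 x y : `]t - 1, t + 1[%classic x -> B y -> `|partial1of2 f x y| <= G y.
  move=> xt By; rewrite dE //; apply: hG => //.
  by move: xt; rewrite /= in_itv /= ltr_norml => /andP[? ?]; apply/andP; split; lra.
apply: DeriveDef; first exact (@derivable_under_integral R _ _ mu f B mB t _ _ It i1 i2 G G0 intG i3).
rewrite -derive1E (@differentiation_under_integral R _ _ mu f B mB t _ _ It i1 i2 G G0 intG i3).
by apply: eq_Rintegral => y; rewrite inE; exact: dE.
Qed.

Lemma is_derive_time (x y : R) : is_derive x 1 (fun x => x * (y - s)) (y - s).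
Proof.
rewrite (_ : (fun x => x * (y - s)) = (fun x => (y - s) * x)).
  by rewrite -[X in is_derive _ _ _ X]mulr1; exact: (@is_deriveZ _ _ _ id (y - s) x 1 1 _).
by apply/funext => z; rewrite mulrC.
Qed.

Lemma continuous_shift_mul w : continuous w -> continuous (fun y => (y - s) * w y).
Proof.
by move=> cw; apply: continuousMR => // y; apply: (@cvgB _ R^o); [exact: cvg_id|exact: cvg_cst].
Qed.

Lemma is_derive_cosI w t : continuous w ->
  is_derive t 1 (cosI w) (- sinI (fun y => (y - s) * w y) t).
Proof.
move=> cw; have cws := continuous_shift_mul cw; have cs x := @continuous_sin_phase x.
have cc x := @continuous_cos_phase x.
rewrite (_ : - _ = \int[mu]_(y in `[- M, M]) ((- 1) * ((y - s) * w y * sin (t * (y - s))))).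
  apply: (@is_derive_under_integral _ (fun x y => w y * cos (x * (y - s)))
    (fun x y => -1 * ((y - s) * w y * sin (x * (y - s)))) (fun y => `|(y - s) * w y|)) => //.
  - by move=> x; apply: itv_integrable; exact: (continuousMR cw (cc x)).
  - move=> x y _; rewrite (_ : -1 * _ = w y * (- sin (x * (y - s)) * (y - s))); last ring.
    apply: (@is_deriveZ _ _ _ (fun x => cos (x * (y - s)))).
    exact: (is_derive1_comp (is_derive_cos _) (is_derive_time x y)).
  - by apply: itv_integrable; exact: (continuous_norm_comp cws).
  - move=> x y _ _; rewrite mulN1r normrN normrM ler_piMr //.
    by rewrite ler_norml sin_geN1 sin_le1.
by rewrite RintegralZl ?mulN1r //; apply: itv_integrable; exact: (continuousMR cws (cs t)).
Qed.

Lemma is_derive_sinI w t : continuous w ->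
  is_derive t 1 (sinI w) (cosI (fun y => (y - s) * w y) t).
Proof.
move=> cw; have cws := continuous_shift_mul cw; have cs x := @continuous_sin_phase x.
apply: (@is_derive_under_integral _ (fun x y => w y * sin (x * (y - s)))
  (fun x y => (y - s) * w y * cos (x * (y - s))) (fun y => `|(y - s) * w y|)) => //.
- by move=> x; apply: itv_integrable; exact: (continuousMR cw (cs x)).
- move=> x y _; rewrite (_ : _ * cos _ = w y * (cos (x * (y - s)) * (y - s))); last ring.
  apply: (@is_deriveZ _ _ _ (fun x => sin (x * (y - s)))).
  exact: (is_derive1_comp (is_derive_sin _) (is_derive_time x y)).
- by apply: itv_integrable; exact: (continuous_norm_comp cws).
- move=> x y _ _; rewrite normrM ler_piMr //.
  by rewrite ler_norml cos_geN1 cos_le1.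
Qed.

Lemma continuous_cosI w : continuous w -> continuous (cosI w).
Proof. by move=> cw; apply: is_derive_continuous => t; exact: is_derive_cosI. Qed.
Lemma continuous_sinI w : continuous w -> continuous (sinI w).
Proof. by move=> cw; apply: is_derive_continuous => t; exact: is_derive_sinI. Qed.

End OscillatoryIntegrals.

Section IntegralsOverTheLine.
Context {R : realType}.
Notation mu := (@lebesgue_measure R).
Implicit Types (f F : R -> R) (x y t : R).

Lemma integrable_oneDsqrV : mu.-integrable setT (fun t => ((oneDsqr t)^-1)%:E).
Proof.
apply/integrableP; split.
  apply/measurable_EFinP; apply: continuous_measurable_fun.
  exact: continuous_oneDsqrV.
under eq_integral => t _ do rewrite /= ger0_norm ?invr_ge0 //.
rewrite (@ge0_symfun_integralT _ (fun t => (oneDsqr t)^-1)).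
- by rewrite -set_itvcy integral0y_oneDsqr -EFinM ltry.
- by move=> t; rewrite invr_ge0.
- exact: continuous_oneDsqrV.
- by move=> t /=; rewrite /oneDsqr sqrrN.
Qed.

Lemma integrable_decay f (K : R) : continuous f ->
  (forall t, `|f t| <= K * (oneDsqr t)^-1) -> mu.-integrable setT (EFin \o f).
Proof.
move=> cf fK; apply: (@le_integrable _ _ _ mu _ _ _ (fun t => (K * (oneDsqr t)^-1)%:E)) => //.
- by apply/measurable_EFinP; exact: continuous_measurable_fun.
- by move=> t _ /=; rewrite lee_fin (le_trans (fK t)) // ler_norm.
by under eq_fun do rewrite EFinM; apply: integrableZl => //; exact: integrable_oneDsqrV.
Qed.

(** Dominated convergence over growing intervals, on each of which the integral is a difference of
    values of [F]. The endpoint [n.+1] keeps every interval nondegenerate. *)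
Lemma cvg_antiderivative f F (K : R) : continuous f ->
  (forall t, `|f t| <= K * (oneDsqr t)^-1) -> (forall t, is_derive t 1 F (f t)) ->
  F n.+1%:R - F (- n.+1%:R) @[n --> \oo] --> \int[mu]_t f t.
Proof.
move=> cf fK hF; have intf := integrable_decay cf fK.
pose D (n : nat) : set R := `[(- n.+1%:R), n.+1%:R]%classic.
have mf : measurable_fun setT (EFin \o f).
  by apply/measurable_EFinP; exact: continuous_measurable_fun.
have mfn n : measurable_fun setT ((EFin \o f) \_ (D n)).
  by apply/(measurable_restrictT _ _).1; [exact: measurable_itv|exact: measurable_funS mf].
have [|||_ _ h] := @dominated_convergence _ _ _ mu setT measurableT
    (fun n => (EFin \o f) \_ (D n)) (EFin \o f) (fun t => `|f t|%:E) mfn mf.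
- apply: aeW => t _; apply: cvg_near_cst.
  exists (Num.truncn `|t|) => // n /= tn; rewrite patchE mem_set //.
  rewrite /D /= in_itv /= -ler_norml ltW //.
  by apply: lt_le_trans (truncnS_gt _) _; rewrite ler_nat ltnS.
- exact: integrable_norm.
- apply: aeW => t n _; rewrite patchE; case: ifP => _ //=.
  by rewrite normr0 lee_fin normr_ge0.
have -> : \int[mu]_t f t = fine (\int[mu]_t (f t)%:E)%E by [].
have e n : F n.+1%:R - F (- n.+1%:R) = fine (\int[mu]_t ((EFin \o f) \_ (D n)) t)%E.
  rewrite -integral_mkcond.
  have n0 : - n.+1%:R < n.+1%:R :> R by rewrite gtrN.
  by have <- := FTC2_is_derive n0 cf hF.
under eq_fun do rewrite e.
apply: fine_cvg; apply: cvg_trans h _; rewrite fineK //.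
exact: integrable_fin_num.
Qed.

Lemma cvg_oneDsqrV_n (K : R) : K * (oneDsqr n.+1%:R)^-1 @[n --> \oo] --> 0.
Proof.
rewrite -(mulr0 K); apply: cvgM; first exact: cvg_cst.
apply: (@squeeze_cvgr _ _ _ _ (fun=> 0) (fun n : nat => n.+1%:R^-1)).
- apply/nearW => n; rewrite invr_ge0 /=; apply/andP; split => //.
  rewrite lef_pV2 ?posrE ?oneDsqr_gt0 // /oneDsqr expr2.
  have : (0 : R) <= n%:R by []; rewrite -natr1; nra.
- exact: cvg_cst.
- exact: cvg_harmonic.
Qed.

Lemma integral_antiderivative_decay f F (K K' : R) : continuous f ->
  (forall t, `|f t| <= K * (oneDsqr t)^-1) -> (forall t, is_derive t 1 F (f t)) ->
  (forall t, `|F t| <= K' * (oneDsqr t)^-1) -> \int[mu]_t f t = 0.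
Proof.
move=> cf fK hF FK; have h1 := cvg_antiderivative cf fK hF.
suff h2 : F n.+1%:R - F (- n.+1%:R) @[n --> \oo] --> (0 : R).
  exact: (cvg_unique _ h1 h2).
have b n : `|F n.+1%:R - F (- n.+1%:R)| <= 2 * K' * (oneDsqr n.+1%:R)^-1.
  apply: le_trans (ler_normB _ _) _; have := FK n.+1%:R; have := FK (- n.+1%:R).
  by rewrite /oneDsqr sqrrN => ? ?; lra.
have c0 := cvg_oneDsqrV_n (2 * K').
apply: (@squeeze_cvgr _ _ _ _ (fun n => - (2 * K' * (oneDsqr n.+1%:R)^-1))
   (fun n => 2 * K' * (oneDsqr n.+1%:R)^-1)) => //.
- by apply/nearW => n; rewrite -ler_norml.
- by rewrite -[0]oppr0; apply: cvgN.
Qed.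

Section Vanishing.
Variables (M s : R).
Hypothesis M0 : 0 < M.
Variables w v : R -> R.
Hypothesis tw : test M w.
Hypothesis tv : test M v.
Hypothesis wv : w = fun y => (y - s) * v y.

(* [cosI M s w] is the derivative of [sinI M s v], which vanishes at infinity. *)
Lemma cosI_integral0 : \int[mu]_t cosI M s w t = 0.
Proof.
have cw := test_continuous tw; have cv := test_continuous tv.
apply: (@integral_antiderivative_decay _ (sinI M s v) (decayC M w) (decayC M v)).
- exact: continuous_cosI.
- by move=> t; exact: cosI_decay.
- by move=> t; rewrite wv; exact: is_derive_sinI.
- by move=> t; exact: sinI_decay.
Qed.

Lemma sinI_integral0 : \int[mu]_t sinI M s w t = 0.
Proof.
have cw := test_continuous tw; have cv := test_continuous tv.
apply: (@integral_antiderivative_decay _ (fun t => - cosI M s v t) (decayC M w) (decayC M v)).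
- exact: continuous_sinI.
- by move=> t; exact: sinI_decay.
- move=> t; rewrite wv -[X in is_derive _ _ _ X]opprK.
  exact: (is_deriveN (is_derive_cosI M s t cv)).
- by move=> t; rewrite normrN; exact: cosI_decay.
Qed.
End Vanishing.

Section Division.
Variables (M s : R) (w : R -> R).
Hypothesis tw : test M w.
Hypothesis ws : \forall y \near s, w y = 0.

(** Derivatives of [w] over powers of [y - s], with their combinations. All members vanish near [s],
    so the division causes no singularity and the class is closed under derivation. *)
Inductive quotient_class : (R -> R) -> Prop :=
| quot_base n k : quotient_class (fun y => derive1n n w y * (y - s) ^- k)
| quot_add f g : quotient_class f -> quotient_class g ->
    quotient_class (fun y => f y + g y)
| quot_scale (c : R) f : quotient_class f -> quotient_class (fun y => c * f y).

Lemma near_derive1n0 n : \forall y \near s, derive1n n w y = 0.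
Proof.
elim: n => [|n IH]; first exact: ws.
have := (near_join IH); apply: filterS => y hy; rewrite derive1nS derive1E.
by apply: derive_val; exact: derive1_near0.
Qed.

Lemma quotient_class_derive f : quotient_class f ->
  exists2 g, quotient_class g & forall x, is_derive x 1 f (g x).
Proof.
elim=> [n k|f1 f2 _ [g1 q1 d1] _ [g2 q2 d2]|c f1 _ [g1 q1 d1]].
- exists (fun y => derive1n n.+1 w y * (y - s) ^- k +
    (- k%:R) * (derive1n n w y * (y - s) ^- k.+1)).
    by apply: quot_add; [exact: quot_base|apply: quot_scale; exact: quot_base].
  move=> x; have [->|xs] := eqVneq x s.
    have h0 := nbhs_singleton (near_derive1n0 n).
    have h1 := nbhs_singleton (near_derive1n0 n.+1).
    rewrite h0 h1 !mul0r mulr0 addr0; apply: derive1_near0.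
    by apply: filterS (near_derive1n0 n) => y ->; rewrite mul0r.
  have xs0 : x - s != 0 by rewrite subr_eq0.
  have dw : is_derive x 1 (derive1n n w) (derive1n n.+1 w x).
    by rewrite derive1nS derive1E; apply: derivableP; case: tw => sw _; exact: sw.
  have ds : is_derive x 1 (fun y => y - s) (1 : R).
    by rewrite -[X in is_derive _ _ _ X](subr0 1); apply: is_deriveB.
  have dk : is_derive x 1 (fun y => (y - s) ^+ k) (k%:R * (x - s) ^+ k.-1).
    have h := @is_deriveX R R (fun y => y - s) k x 1 1 ds; rewrite exprfctE in h.
    by apply: (is_derive_eq h); rewrite /GRing.scale /= mulr1.
  have kn : (x - s) ^+ k != 0 by rewrite expf_neq0.
  have dV := @is_deriveV R (fun y => (y - s) ^+ k) x _ 1 kn dk.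
  apply: (is_derive_eq (is_deriveM dw dV)).
  rewrite /GRing.scale /=; case: k {dk dV kn} => [|k] /=; first by rewrite !mulr0n; ring.
  have a0 : (x - s) ^+ k != 0 by rewrite expf_neq0.
  rewrite !exprS; move: xs0 a0; move: (x - s) ((x - s) ^+ k) (derive1n n w x) (derive1 (derive1n n w) x) (k.+1%:R).
  by move=> b a c d e b0 a0; field; rewrite a0 b0.
- exists (fun y => g1 y + g2 y); first exact: quot_add.
  by move=> x; exact: (is_deriveD (d1 x) (d2 x)).
exists (fun y => c * g1 y); first exact: quot_scale.
by move=> x; exact: (is_deriveZ c (d1 x)).
Qed.

(** Divisibility by [y - s] is what presents the oscillatory integrals of [w] as derivatives in [t]
    of those of [v]. *)
Lemma exists_quotient : exists2 v, test M v & w = fun y => (y - s) * v y.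
Proof.
exists (fun y => w y * (y - s) ^- 1).
  split.
    apply: (@rsmooth_of_class _ quotient_class); last exact: (quot_base 0 1).
      by move=> f /quotient_class_derive [g _ d] x; case: (d x).
    move=> f /quotient_class_derive [g qg d].
    rewrite (_ : derive1 f = g) //; apply/funext => x.
    by rewrite derive1E; apply: derive_val.
  have [_ [M' hM w0]] := tw; exists M' => // x /w0 ->.
  by rewrite mul0r.
apply/funext => y; have [->|ys] := eqVneq y s.
  by rewrite (nbhs_singleton ws) mul0r mulr0.
by rewrite expr1 mulrCA mulfV ?mulr1 // subr_eq0.
Qed.
End Division.
End IntegralsOverTheLine.

(** * Smooth bump functions *)

Section Bump.
Context {R : realType}.
Implicit Types (x y z h : R) (f g : R -> R).

(** This settles the derivative of [flat] at the point where its two branches meet. *)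
Lemma is_derive_sqr_bound f (K : R) : (forall h, `|f h| <= K * h ^+ 2) ->
  is_derive (0 : R) 1 f 0.
Proof.
move=> fK; have f0 : f 0 = 0.
  by apply/eqP; rewrite -normr_eq0 eq_le normr_ge0 andbT (le_trans (fK 0)) // expr0n mulr0.
have c : (fun h => h^-1 *: ((f \o shift 0) (h *: 1) - f 0)) @ 0^' --> (0 : R).
  apply/cvgr0Pnorm_lt => e e0.
  have K1 : 0 < `|K| + 1 by rewrite ltr_wpDl.
  near=> h; have h0 : h != 0 by near: h; exact: nbhs_dnbhs_neq.
  rewrite /= addr0 f0 subr0 /GRing.scale /= mulr1 normrM normfV.
  rewrite ltr_pdivrMl ?normr_gt0 //; apply: le_lt_trans (fK h) _.
  have -> : h ^+ 2 = `|h| * `|h| by rewrite -expr2 real_normK // num_real.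
  rewrite mulrCA ltr_pM2l ?normr_gt0 //.
  have hh : `|h| < e / (`|K| + 1).
    near: h; apply: nbhs_dnbhs; apply/nbhs_ballP.
    exists (e / (`|K| + 1)); first by rewrite /= divr_gt0.
    by move=> y; rewrite -ball_normE /= sub0r normrN.
  have : (`|K| + 1) * `|h| < e by rewrite mulrC -ltr_pdivlMr.
  apply: le_lt_trans; apply: ler_wpM2r => //.
  by apply: le_trans (ler_norm K) _; rewrite lerDl.
apply: DeriveDef; first exact: (cvgP _ c).
by apply: (cvg_lim _ c); exact: Rhausdorff.
Unshelve. all: by end_near. Qed.

(* The factor [z ^- k] makes the class closed under derivation. *)
Definition flat (k : nat) z : R := if 0 < z then z ^- k * expR (- z^-1) else 0.

(** The inequality [expR x >= x] at the inverse of [m.+1%:R * z], inverted and raised to the power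
    [m.+1]. *)
Lemma expR_bound (m : nat) z : 0 < z -> expR (- z^-1) <= (m.+1%:R * z) ^+ m.+1.
Proof.
move=> z0; have mz : 0 < m.+1%:R * z by rewrite mulr_gt0.
have -> : - z^-1 = m.+1%:R * (- (m.+1%:R * z)^-1).
  by rewrite invfM mulrN mulrA mulfV ?mul1r // pnatr_eq0.
rewrite expRM_natl; apply: lerXn2r; rewrite ?nnegrE ?expR_ge0 ?(ltW mz) //.
rewrite expRN -[leRHS]invrK lef_pV2 ?posrE ?expR_gt0 ?invr_gt0 //.
by apply: le_trans (expR_ge1Dx _); rewrite lerDr.
Qed.

Lemma flat_bound k z : `|flat k z| <= k.+2%:R ^+ k.+2 * z ^+ 2.
Proof.
rewrite /flat; case: ifPn => [z0|_]; last first.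
  by rewrite normr0 mulr_ge0 ?sqr_ge0 // exprn_ge0.
have zk : 0 < z ^+ k by rewrite exprn_gt0.
rewrite ger0_norm; last by rewrite mulr_ge0 ?invr_ge0 ?expR_ge0 // ltW.
rewrite mulrC ler_pdivrMr //; apply: le_trans (expR_bound k.+1 z0) _.
by rewrite exprMn -[leRHS]mulrA -[X in _ <= _ * X]exprD add2n.
Qed.

Lemma is_derive_flat k z :
  is_derive z 1 (flat k) (flat k.+2 z - k%:R * flat k.+1 z).
Proof.
have [z0|z0|->] := ltgtP z 0.
- rewrite {2 3}/flat !ifN -?leNgt ?(ltW z0) // mulr0 subr0.
  apply: derive1_near0; have : nbhs z [set y | y < 0].
    by apply: open_nbhs_nbhs; split => //; exact: open_lt.
  by apply: filterS => y /= y0; rewrite /flat ifN // -leNgt ltW.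
- have near : \forall y \near z, y ^- k * expR (- y^-1) = flat k y.
    have : nbhs z [set y : R | 0 < y].
      by apply: open_nbhs_nbhs; split => //; exact: open_gt.
    by apply: filterS => y /= y0; rewrite /flat y0.
  have zn : z != 0 by rewrite gt_eqF.
  have kn : z ^+ k != 0 by rewrite expf_neq0.
  have dk : is_derive z 1 (fun y => y ^+ k) (k%:R * z ^+ k.-1).
    have h := @is_deriveX R R id k z 1 1 (is_derive_id _ _); rewrite exprfctE in h.
    by apply: (is_derive_eq h); rewrite /GRing.scale /= mulr1.
  have dV := @is_deriveV R (fun y => y ^+ k) z _ 1 kn dk.
  have dI := @is_deriveV R id z _ 1 zn (is_derive_id _ _).
  have dN : is_derive z 1 (fun y : R => - y^-1) (z ^- 2).
    by apply: (is_derive_eq (is_deriveN dI)); rewrite /GRing.scale /= mulr1 opprK.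
  have dE := @is_derive1_comp _ (@expR R) (fun y => - y^-1) z _ _ (is_derive_expR (- z^-1)) dN.
  have d := is_deriveM dV dE.
  have d1 : is_derive z 1 (fun y => y ^- k * expR (- y^-1)) (flat k.+2 z - k%:R * flat k.+1 z).
    apply: (is_derive_eq d); rewrite /flat z0 /GRing.scale /=.
    case: k {d dV dk kn near} => [|k] /=.
      by rewrite !expr0 !mulr0n; field.
    have a0 : z ^+ k != 0 by rewrite expf_neq0.
    rewrite !exprS; move: zn a0; move: (z ^+ k) (expR _) (k.+1%:R) => a c e b0 a0.
    by field; rewrite a0 b0.
  case: d1 => ex dv; apply: DeriveDef.
    exact: (@near_eq_derivable R R R _ (flat k) z 1 near ex).
  by rewrite -(@near_eq_derive R R R _ (flat k) z 1 near).
rewrite {2 3}/flat ltxx mulr0 subr0.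
exact: (is_derive_sqr_bound (flat_bound k)).
Qed.

Section At.
Variables (s r : R).

Inductive bump_class : (R -> R) -> Prop :=
| bump_cst c : bump_class (fun=> c)
| bump_id : bump_class id
| bump_flat k : bump_class (fun x => flat k (r ^+ 2 - (x - s) ^+ 2))
| bump_add f g : bump_class f -> bump_class g -> bump_class (fun x => f x + g x)
| bump_mul f g : bump_class f -> bump_class g -> bump_class (fun x => f x * g x).

Lemma bump_class_derive f : bump_class f ->
  exists2 g, bump_class g & forall x, is_derive x 1 f (g x).
Proof.
elim=> [c||k|f1 f2 _ [g1 q1 d1] _ [g2 q2 d2]|f1 f2 b1 [g1 q1 d1] b2 [g2 q2 d2]].
- by exists (fun=> 0); [exact: bump_cst|move=> x; exact: is_derive_cst].
- by exists (fun=> 1); [exact: bump_cst|move=> x; exact: is_derive_id].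
- exists (fun x => (flat k.+2 (r ^+ 2 - (x - s) ^+ 2) +
    (- k%:R) * flat k.+1 (r ^+ 2 - (x - s) ^+ 2)) * (-2 * (x + - s))).
    apply: bump_mul.
      by apply: bump_add; [|apply: bump_mul; [exact: bump_cst|]]; exact: bump_flat.
    by apply: bump_mul; [exact: bump_cst|apply: bump_add; [exact: bump_id|exact: bump_cst]].
  move=> x; have ds : is_derive x 1 (fun y => y - s) (1 : R).
    by rewrite -[X in is_derive _ _ _ X](subr0 1); apply: is_deriveB.
  have h := @is_deriveX R R (fun y => y - s) 2 x 1 1 ds; rewrite exprfctE in h.
  have dq : is_derive x 1 (fun y => r ^+ 2 - (y - s) ^+ 2) (-2 * (x + - s)).
    apply: (is_derive_eq (is_deriveB (is_derive_cst (r ^+ 2) x 1) h)).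
    by rewrite /GRing.scale /=; ring.
  apply: (is_derive_eq (is_derive1_comp (is_derive_flat k _) dq)).
  by rewrite (mulNr k%:R).
- by exists (fun x => g1 x + g2 x); [exact: bump_add|move=> x; exact: (is_deriveD (d1 x) (d2 x))].
exists (fun x => f1 x * g2 x + f2 x * g1 x).
  by apply: bump_add; exact: bump_mul.
by move=> x; exact: (is_deriveM (d1 x) (d2 x)).
Qed.

Definition bump (x : R) : R := flat 0 (r ^+ 2 - (x - s) ^+ 2).

Lemma rsmooth_bump : rsmooth bump.
Proof.
apply: (@rsmooth_of_class _ bump_class); last exact: (bump_flat 0).
  by move=> f /bump_class_derive [g _ d] x; case: (d x).
move=> f /bump_class_derive [g qg d].
rewrite (_ : derive1 f = g) //; apply/funext => x.
by rewrite derive1E; apply: derive_val.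
Qed.

Lemma bump_ge0 x : 0 <= bump x.
Proof. by rewrite /bump /flat; case: ifP => // _; rewrite mulr_ge0 ?expR_ge0 // invr_ge0. Qed.

Lemma bump0 x : 0 < r -> r <= `|x - s| -> bump x = 0.
Proof.
move=> r0 h; rewrite /bump /flat ifN // -leNgt subr_le0 -[X in _ <= X]real_normK ?num_real //.
by rewrite lerXn2r ?nnegrE ?(ltW r0).
Qed.

Lemma bump_ge x : 0 < r -> `|x - s| <= r / 2 -> expR (- (3 / 4 * r ^+ 2)^-1) <= bump x.
Proof.
move=> r0 h; have h2 : (x - s) ^+ 2 <= (r / 2) ^+ 2.
  by rewrite -[X in X <= _]real_normK ?num_real // lerXn2r ?nnegrE ?divr_ge0 ?(ltW r0).
have r2 : 0 < r ^+ 2 by rewrite exprn_gt0.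
(* The constant is [r ^+ 2] minus the square of [r / 2]. *)
have hq : 3 / 4 * r ^+ 2 <= r ^+ 2 - (x - s) ^+ 2.
  by move: h2; rewrite exprMn; lra.
have q0 : 0 < 3 / 4 * r ^+ 2 by rewrite mulr_gt0.
rewrite /bump /flat (lt_le_trans q0 hq) expr0 invr1 mul1r ler_expR lerN2.
by rewrite lef_pV2 ?posrE // (lt_le_trans q0 hq).
Qed.

Lemma test_bump M : 0 < r -> `|s| + r < M -> test M bump.
Proof.
move=> r0 h; split; first exact: rsmooth_bump.
exists (`|s| + r); first by rewrite h andbT ltr_wpDl.
move=> x hx; apply: bump0 => //; rewrite -(lerD2l `|s|) (le_trans (ltW hx)) //.
by rewrite -[X in `|X| <= _](subrKC s) ler_normD.
Qed.
End At.
End Bump.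

Section TrigonometricBounds.
Context {R : realType}.
Implicit Types x : R.

Lemma sin_norm_le x : `|sin x| <= `|x|.
Proof.
wlog x0 : x / 0 <= x => [H|].
  have [/H//|x0] := leP 0 x.
  by have := H (- x); rewrite sinN !normrN; apply; rewrite oppr_ge0 ltW.
move: x0; rewrite le_eqVlt => /predU1P[<-|x0]; first by rewrite sin0.
have d y : y \in `]0, x[ -> is_derive y 1 (@sin R) (cos y) by move=> _; exact: is_derive_sin.
have c : {within `[0, x], continuous (@sin R)}.
  by apply: continuous_subspaceT; exact: continuous_sin.
have [y _] := MVT x0 d c.
rewrite sin0 !subr0 => ->; rewrite normrM ler_piMl //.
by rewrite ler_norml cos_geN1 cos_le1.
Qed.

Lemma one_minus_cosE x : 1 - cos x = 2 * sin (x / 2) ^+ 2.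
Proof.
have -> : cos x = cos ((x / 2) *+ 2) by congr cos; rewrite -mulr_natr mulfVK.
by rewrite cos_mulr2n cos2sin2 mulr2n; ring.
Qed.

Lemma one_minus_cos_ge0 x : 0 <= 1 - cos x.
Proof. by rewrite subr_ge0 cos_le1. Qed.

Lemma one_minus_cos_le x : 1 - cos x <= x ^+ 2 / 2.
Proof.
rewrite one_minus_cosE.
have : sin (x / 2) ^+ 2 <= (x / 2) ^+ 2.
  rewrite -[leLHS]real_normK ?num_real // -[leRHS]real_normK ?num_real //.
  by rewrite lerXn2r ?nnegrE // sin_norm_le.
by rewrite exprMn; lra.
Qed.
End TrigonometricBounds.

(** * The integral of [cosI] is nonzero for a bump around [s] *)

Section NonVanishing.
Context {R : realType}.
Notation mu := (@lebesgue_measure R).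
Variables (M s : R) (w : R -> R).
Hypothesis M0 : 0 < M.
Hypothesis tw : test M w.
Implicit Types (x y t : R).

(** The point [s] is removed because the kernels below divide by [y - s]; integrals do not change,
    as it is a null set. *)
Notation B := (`[- M, M]%classic `\ s).

Let mB : measurable B.
Proof. by apply: measurableD; [exact: measurable_itv|exact: measurable_set1]. Qed.

Let measurableB (k : R -> R) : {in ~` [set s], continuous k} -> measurable_fun B k.
Proof.
move=> ck; have oO : open (~` [set s]).
  by apply: closed_openC; apply: accessible_closed_set1; apply: hausdorff_accessible; exact: Rhausdorff.
apply: (@measurable_funS _ _ _ _ (~` [set s])).
- exact: open_measurable.
- by move=> y [].
exact: open_continuous_measurable_fun.
Qed.

Let integrableB (k : R -> R) (K : R) : {in ~` [set s], continuous k} ->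
  (forall y, B y -> `|k y| <= K * `|w y|) -> mu.-integrable B (EFin \o k).
Proof.
move=> ck kK; have cw := test_continuous tw.
apply: (@le_integrable _ _ _ mu _ mB _ (fun y => (K * `|w y|)%:E)).
- by apply/measurable_EFinP; exact: measurableB.
- by move=> y By /=; rewrite lee_fin (le_trans (kK y By)) // ler_norm.
have cKw : continuous (fun y => K * `|w y|).
  by apply: continuousMR; [move=> y; exact: cvg_cst|exact: continuous_norm_comp].
apply: (@integrableS _ _ _ mu `[- M, M]%classic); first exact: measurable_itv.
- exact: mB.
- by move=> y [].
exact: itv_integrable.
Qed.

(* [V] and [W] are the first two primitives of [cosI M s w], so that vanishing
   of the integral would make [V] vanish at infinity, whereas [W] grows at least
   linearly. *)
Let kV t y := w y * (sin (t * (y - s)) / (y - s)).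
Let kW t y := w y * ((1 - cos (t * (y - s))) / (y - s) ^+ 2).
Let V t := \int[mu]_(y in B) kV t y.
Let W t := \int[mu]_(y in B) kW t y.

Let nz y : B y -> y - s != 0.
Proof. by move=> [_ /eqP]; rewrite subr_eq0. Qed.

Let continuousV y (k : R -> R) : y != s -> {for y, continuous k} ->
  {for y, continuous (fun z => w z * (k z / (z - s)))}.
Proof.
move=> ys ck; apply: cvgM; first exact: (test_continuous tw).
apply: cvgM; first exact: ck.
by apply: cvgV; [rewrite subr_eq0|apply: (@cvgB _ R^o); [exact: cvg_id|exact: cvg_cst]].
Qed.

Let kV_le t y : B y -> `|kV t y| <= `|t| * `|w y|.
Proof.
move=> By; rewrite normrM mulrC ler_wpM2r // normrM normfV.
by rewrite ler_pdivrMr ?normr_gt0 ?nz // -normrM sin_norm_le.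
Qed.

Let integrable_kV t : mu.-integrable B (EFin \o kV t).
Proof.
apply: (@integrableB _ `|t|).
  move=> y; rewrite inE => /eqP ys; apply: continuousV => //.
  exact: (@continuous_sin_phase _ s t).
by move=> y; exact: kV_le.
Qed.

Let integrable_kW t : mu.-integrable B (EFin \o kW t).
Proof.
apply: (@integrableB _ (t ^+ 2)).
  move=> y; rewrite inE => /eqP ys.
  have -> : kW t = fun z => w z * ((1 - cos (t * (z - s))) / (z - s) / (z - s)).
    by apply/funext => z; rewrite /kW expr2 invfM (mulrA (1 - _)).
  apply: continuousV => //; apply: cvgM.
    by apply: (@cvgB _ R^o); [exact: cvg_cst|exact: (@continuous_cos_phase _ s t)].
  by apply: cvgV; [rewrite subr_eq0|apply: (@cvgB _ R^o); [exact: cvg_id|exact: cvg_cst]].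
move=> y By; rewrite normrM mulrC ler_wpM2r //.
have y2 : 0 < (y - s) ^+ 2 by rewrite lt_neqAle sqr_ge0 andbT eq_sym expf_neq0 // nz.
rewrite ger0_norm ?divr_ge0 ?one_minus_cos_ge0 ?sqr_ge0 // ler_pdivrMr //.
apply: le_trans (one_minus_cos_le _) _; rewrite exprMn.
by have := mulr_ge0 (sqr_ge0 t) (ltW y2); lra.
Qed.

Let V_derive t : is_derive t 1 V (cosI M s w t).
Proof.
have cw := test_continuous tw.
have cwc : continuous (fun y => w y * cos (t * (y - s))).
  by apply: continuousMR => //; exact: continuous_cos_phase.
have -> : cosI M s w t = \int[mu]_(y in B) (w y * cos (t * (y - s))).
  rewrite /cosI /Rintegral integral_setD1 //; apply/measurable_EFinP.
  by apply: measurableB => y _; exact: cwc.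
apply: (@is_derive_under_integral R B kV (fun x y => w y * cos (x * (y - s))) (fun y => `|w y|)) => //.
- move=> x y /nz y0.
  rewrite (_ : kV ^~ y = fun x => (w y / (y - s)) * sin (x * (y - s))); last first.
    by apply/funext => z; rewrite /kV; ring.
  have d := is_derive1_comp (is_derive_sin _) (is_derive_time s x y).
  apply: (is_derive_eq (is_deriveZ (w y / (y - s)) d)); rewrite /GRing.scale /=.
  by move: (cos _) => c; field.
- by apply: (@integrableB _ 1) => [y _|y _]; [exact: (continuous_norm_comp cw)|rewrite normr_id mul1r].
- by move=> x y _ _; rewrite normrM ler_piMr // ler_norml cos_geN1 cos_le1.
Qed.

Let W_derive t : is_derive t 1 W (V t).
Proof.
have cw := test_continuous tw.
apply: (@is_derive_under_integral R B kW kV (fun y => (`|t| + 1) * `|w y|)) => //.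
- move=> x y /nz y0.
  rewrite (_ : kW ^~ y = fun x => (w y / (y - s) ^+ 2) * (1 - cos (x * (y - s)))); last first.
    by apply/funext => z; rewrite /kW; ring.
  have d := is_derive1_comp (is_derive_cos _) (is_derive_time s x y).
  have d2 := is_deriveB (is_derive_cst (1 : R) x 1) d.
  apply: (is_derive_eq (is_deriveZ (w y / (y - s) ^+ 2) d2)); rewrite /GRing.scale /= /kV.
  by move: (sin _) => c; field.
- apply: (@integrableB _ (`|t| + 1)) => [y _|y _].
    have c : continuous (fun y => (`|t| + 1) * `|w y|).
      by apply: continuousMR; [move=> z; exact: cvg_cst|exact: continuous_norm_comp].
    exact: c.
  by rewrite normrM normr_id ger0_norm // addr_ge0.
move=> x y xt By; apply: le_trans (kV_le x By) _; rewrite ler_wpM2r //.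
rewrite -[X in `|X| <= _](subrK t) addrC (le_trans (ler_normD _ _)) // lerD2l //.
exact: ltW.
Qed.

Let V_odd t : V (- t) = - V t.
Proof.
rewrite -[RHS]mulN1r /V -RintegralZl //; apply: eq_Rintegral => y _.
by rewrite /kV mulNr sinN; ring.
Qed.

Variables (d m : R).
Hypothesis d0 : 0 < d.
Hypothesis m0 : 0 < m.
Hypothesis sdM : - M <= s /\ s + d <= M.
Hypothesis w0 : forall y, 0 <= w y.
Hypothesis wm : forall y, `|y - s| <= d -> m <= w y.

(** For [y - s] between [pi / (2 t)] and [pi / t] the cosine is at most [0], so the kernel is at
    least [m (t / pi)^2]. This window has length [pi / (2 t)], and the condition on [t] keeps it
    within distance [d] of [s]. *)
Let W_lower t : pi / d <= t -> m / (2 * pi) * t <= W t.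
Proof.
have pi0 := pi_gt0 R.
move=> td; have t0 : 0 < t by apply: lt_le_trans td; rewrite divr_gt0.
have tp : pi / t <= d by rewrite ler_pdivrMr // mulrC -ler_pdivrMr.
have pt0 : 0 < pi / t by rewrite divr_gt0.
pose J := `[s + pi / t / 2, s + pi / t]%classic.
have JB : J `<=` B.
  move=> y; rewrite /J /= !in_itv /= => /andP[y1 y2]; split.
    by case: sdM => ? ?; apply/andP; split; lra.
  by move=> ys; move: y1; rewrite ys; lra.
have kW0 y : B y -> 0 <= kW t y.
  by move=> _; rewrite mulr_ge0 // divr_ge0 ?one_minus_cos_ge0 ?sqr_ge0.
have kWm y : J y -> m * (t / pi) ^+ 2 <= kW t y.
  rewrite /J /= in_itv /= => /andP[y1 y2].
  have ys : 0 < y - s by lra.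
  have ysp : y - s <= pi / t by lra.
  apply: ler_pM => //.
  - exact: ltW.
  - exact: sqr_ge0.
  - by apply: wm; rewrite ger0_norm ?(ltW ys) //; lra.
  rewrite ler_pdivlMr ?exprn_gt0 // -exprMn.
  apply: (@le_trans _ _ 1).
    have q : t / pi * (y - s) <= 1.
      by rewrite mulrAC ler_pdivrMr // mul1r mulrC -ler_pdivlMr.
    by rewrite expr_le1 // mulr_ge0 ?divr_ge0 ?(ltW ys) ?(ltW t0) ?(ltW pi0).
  rewrite lerDl oppr_ge0 -[X in cos X](subrK pi) cosDpi oppr_le0; apply: cos_ge0_pihalf.
  have u1 : pi / 2 / t <= y - s by rewrite mulrAC; lra.
  have u2 : y - s <= pi / t by lra.
  move: u1 u2; rewrite ler_pdivrMr // ler_pdivlMr // (mulrC t) => u1 u2.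
  by apply/andP; split; lra.
have mJ : measurable J by exact: measurable_itv.
have mkW : measurable_fun B (EFin \o kW t) by case/integrableP: (integrable_kW t).
rewrite -lee_fin /W /Rintegral fineK; last first.
  by apply: integrable_fin_num; [exact: mB|exact: integrable_kW].
apply: (@le_trans _ _ (\int[mu]_(y in J) (kW t y)%:E)%E); last first.
  by apply: ge0_subset_integral => // y By; rewrite lee_fin kW0.
apply: (@le_trans _ _ (\int[mu]_(y in J) (m * (t / pi) ^+ 2)%:E)%E); last first.
  apply: ge0_le_integral => //; try by move=> y _; rewrite lee_fin mulr_ge0 ?sqr_ge0 // ltW.
  exact: (measurable_funS mB JB mkW).
have muJ : mu J = (pi / t / 2)%:E.
  by rewrite /J lebesgue_measure_itv /= lte_fin ifT; [congr _%:E; field; rewrite gt_eqF|lra].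
have -> : (\int[mu]_(y in J) (m * (t / pi) ^+ 2)%:E)%E = (m * (t / pi) ^+ 2 * (pi / t / 2))%:E.
  by apply: etrans (integral_cst mu mJ _) _; rewrite [X in (_ * X)%E]muJ -EFinM.
rewrite lee_fin le_eqVlt; apply/orP; left; apply/eqP.
by have := gt_eqF t0; have := gt_eqF pi0; move: (pi : R) => p /negbT ? /negbT ?; field; apply/andP.
Qed.

Lemma cosI_integral_neq0 : \int[mu]_t cosI M s w t != 0.
Proof.
apply/eqP => I0; have pi0 := pi_gt0 R.
have cw := test_continuous tw.
have := cvg_antiderivative (@continuous_cosI _ M s w cw) (fun t => cosI_decay s M0 t tw) V_derive.
rewrite I0 => hV.
pose c := m / (2 * pi); have c0 : 0 < c by rewrite divr_gt0 // mulr_gt0.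
have hK := cvg_oneDsqrV_n (decayC M w).
have c4 : 0 < c / 4 by rewrite divr_gt0.
have [n1 _ h1] := (cvgrPdist_lt _ _).1 hV _ c4.
have [n2 _ h2] := (cvgrPdist_lt _ _).1 hK _ c4.
pose n0 := maxn (maxn n1 n2) (Num.truncn (pi / d)).
(* If [V] tends to [0], unit increments of [W] eventually drop to half the slope [c] of the lower
   bound. *)
have step n : (n0 <= n)%N -> W n.+2%:R - W n.+1%:R <= c / 2.
  move=> nn.
  have {h1}: `|V n.+1%:R| <= c / 4.
    (* Since [V] is odd, the difference of its values at opposite points is twice one of them. *)
    have n1n : (n1 <= n)%N by apply: leq_trans nn; rewrite !leq_max leqnn.
    have := h1 n n1n; rewrite /= V_odd sub0r opprK normrN => /ltW.
    rewrite -mulr2n normrMn mulr2n => h; have := normr_ge0 (V n.+1%:R); lra.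
  have {h2}: decayC M w * (oneDsqr n.+1%:R)^-1 <= c / 4.
    have n2n : (n2 <= n)%N by apply: leq_trans nn; rewrite !leq_max leqnn orbT.
    have := h2 n n2n; rewrite /= sub0r normrN => /ltW; apply: le_trans.
    exact: ler_norm.
  have nS : n.+1%:R < n.+2%:R :> R by rewrite ltr_nat.
  have cW : continuous W := is_derive_continuous W_derive.
  have cV : continuous V := is_derive_continuous V_derive.
  have [x xI ->] := MVT nS (fun t _ => W_derive t) (continuous_subspaceT cW).
  rewrite (_ : n.+2%:R - n.+1%:R = 1); last by rewrite -(natr1 n.+1) addrC addKr.
  rewrite mulr1; move: xI; rewrite in_itv /= => /andP[nx xn].
  have [y yI e] := MVT nx (fun t _ => V_derive t) (continuous_subspaceT cV).
  move: yI; rewrite in_itv /= => /andP[ny yx] hd hv.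
  (* On an interval of length at most [1], [V] moves by no more than the bound on its derivative
     [cosI]. *)
  have hy : `|V x - V n.+1%:R| <= c / 4.
    rewrite e normrM; apply: (@le_trans _ _ `|cosI M s w y|).
      rewrite ler_piMr // ger0_norm ?subr_ge0 ?ltW //.
      by move: xn; rewrite -(natr1 n.+1); lra.
    apply: le_trans (cosI_decay s M0 y tw) _; apply: le_trans hd.
    have nn0 : (0 : R) <= n.+1%:R by [].
    apply: ler_wpM2l; first by rewrite addr_ge0 // Rintegral_ge0.
    rewrite lef_pV2 ?posrE ?oneDsqr_gt0 // /oneDsqr lerD2l lerXn2r ?nnegrE //.
      exact: le_trans (ltW ny).
    exact: ltW.
  move: hy hv; rewrite !ler_norml => /andP[_ ?] /andP[_ ?]; lra.
have up k : W (n0 + k).+1%:R <= W n0.+1%:R + k%:R * (c / 2).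
  elim: k => [|k IH]; first by rewrite addn0 mul0r addr0.
  have := step (n0 + k)%N (leq_addr _ _); rewrite addnS -[X in _ + X * _]natr1; lra.
have low k : c * (n0 + k).+1%:R <= W (n0 + k).+1%:R.
  apply: W_lower; apply: le_trans (ltW (truncnS_gt _)) _.
  rewrite ler_nat ltnS; apply: leq_trans (leq_addr _ _).
  by rewrite !leq_max leqnn orbT.
(* So large that [k * (c / 2)] exceeds the starting value of [W]. *)
pose k := (Num.truncn (2 * `|W n0.+1%:R| / c)).+1.
have kb : 2 * `|W n0.+1%:R| / c < k%:R := truncnS_gt _.
move: kb; rewrite ltr_pdivrMr // => kb.
have := le_trans (low k) (up k); rewrite -addSn natrD.
have := ler_norm (W n0.+1%:R); have : 0 < c * n0.+1%:R by rewrite mulr_gt0.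
rewrite mulrDr; move: kb; move: (W n0.+1%:R) => z.
by have := normr_ge0 z; lra.
Qed.
End NonVanishing.

(** * Integrals of complex-valued functions *)

Section ComplexIntegral.
Context {R : realType}.
Notation C := (Cplx R).
Notation mu := (@lebesgue_measure R).
Implicit Types (f g : R -> C) (u v : R -> R).

Let integrableR u v (k l : R) : mu.-integrable setT (EFin \o u) ->
  mu.-integrable setT (EFin \o v) ->
  mu.-integrable setT (fun t => (k * u t + l * v t)%:E) /\
  \int[mu]_t (k * u t + l * v t) = k * \int[mu]_t u t + l * \int[mu]_t v t.
Proof.
move=> iu iv.
have iku : mu.-integrable setT (EFin \o (fun t => k * u t)) by exact: (integrableZl measurableT k iu).
have ilv : mu.-integrable setT (EFin \o (fun t => l * v t)) by exact: (integrableZl measurableT l iv).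
split; first exact: (integrableD measurableT iku ilv).
by rewrite RintegralD // !RintegralZl.
Qed.

Lemma cintegralD f g : cintegrable f -> cintegrable g ->
  cintegrable (fun t => f t + g t) /\
  cintegral (fun t => f t + g t) = cintegral f + cintegral g.
Proof.
move=> [f1 f2] [g1 g2].
have [i1 e1] := integrableR 1 1 f1 g1; have [i2 e2] := integrableR 1 1 f2 g2.
have q1 t : 1 * cRe (f t) + 1 * cRe (g t) = cRe (f t + g t) by rewrite !mul1r cReD.
have q2 t : 1 * cIm (f t) + 1 * cIm (g t) = cIm (f t + g t) by rewrite !mul1r cImD.
split.
  by split; [under eq_fun do rewrite -q1|under eq_fun do rewrite -q2].
apply: cplxP.
  by rewrite cReD /=; under eq_Rintegral do rewrite -q1; rewrite e1 !mul1r.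
by rewrite cImD /=; under eq_Rintegral do rewrite -q2; rewrite e2 !mul1r.
Qed.

Lemma cintegralZ (c : C) f : cintegrable f -> cintegrable (fun t => c * f t) /\
  cintegral (fun t => c * f t) = c * cintegral f.
Proof.
move=> [f1 f2].
have [i1 e1] := integrableR (cRe c) (- cIm c) f1 f2.
have [i2 e2] := integrableR (cRe c) (cIm c) f2 f1.
have q1 t : cRe c * cRe (f t) + - cIm c * cIm (f t) = cRe (c * f t) by rewrite cReM mulNr.
have q2 t : cRe c * cIm (f t) + cIm c * cRe (f t) = cIm (c * f t) by rewrite cImM.
split.
  by split; [under eq_fun do rewrite -q1|under eq_fun do rewrite -q2].
apply: cplxP.
  by rewrite cReM /=; under eq_Rintegral do rewrite -q1; rewrite e1 mulNr.
by rewrite cImM /=; under eq_Rintegral do rewrite -q2; rewrite e2.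
Qed.

(** Real and imaginary parts are estimated separately, whence the factor [2]. *)
Lemma cintegral_le f (c : R) : 0 <= c -> cintegrable f ->
  (forall t, cmod (f t) <= c * (oneDsqr t)^-1) ->
  cmod (cintegral f) <= c * (2 * \int[mu]_t (oneDsqr t)^-1).
Proof.
move=> c0 [f1 f2] fc; have iV := @integrable_oneDsqrV R.
have icV : mu.-integrable setT (EFin \o (fun t => c * (oneDsqr t)^-1)).
  exact: (integrableZl measurableT c iV).
have le u : mu.-integrable setT (EFin \o u) -> (forall t, `|u t| <= cmod (f t)) ->
    `|\int[mu]_t u t| <= c * \int[mu]_t (oneDsqr t)^-1.
  move=> iu ule; apply: le_trans (le_normr_Rintegral measurableT iu) _.
  rewrite -RintegralZl //; apply: le_Rintegral => //.
    exact: (integrable_norm iu).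
  by move=> t _; apply: le_trans (ule t) (fc t).
apply: le_trans (cmod_le _) _.
have l1 := le _ f1 (fun t => cRe_le_norm (f t)).
have l2 := le _ f2 (fun t => cIm_le_norm (f t)).
by apply: le_trans (lerD l1 l2) _; rewrite mulrCA mulr_natl mulr2n.
Qed.

Lemma integral_supported (M : R) u : continuous u -> (forall x, M <= `|x| -> u x = 0) ->
  mu.-integrable setT (EFin \o u) /\ \int[mu]_t u t = \int[mu]_(t in `[- M, M]) u t.
Proof.
move=> cu u0; have e : u = u \_ `[- M, M]%classic.
  apply/funext => x; rewrite patchE; case: ifPn => //.
  rewrite notin_setE /= in_itv /= => /negP; rewrite -ler_norml -ltNge => /ltW.
  exact: u0.
split.
  have -> : EFin \o u = (EFin \o u) \_ `[- M, M]%classic.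
    by apply/funext => x; rewrite [in LHS]e /= !patchE; case: ifP.
  by apply: (integrable_mkcond _ _).1; [exact: measurable_itv|exact: itv_integrable].
by rewrite [RHS]Rintegral_mkcond -e.
Qed.
End ComplexIntegral.

Section FourierTransform.
Context {R : realType}.
Notation C := (Cplx R).
Notation mu := (@lebesgue_measure R).

Lemma expiD (x y : R) : expi (x + y) = expi x * expi y.
Proof. by apply: cplxP; rewrite ?cReM ?cImM /= ?cosD ?sinD; ring. Qed.

Lemma expi0 : expi (0 : R) = 1.
Proof. by apply: cplxP; rewrite /= ?cos0 ?sin0. Qed.

Variable F : R -> C.
Hypothesis sF : smooth F.
Hypothesis cF : compact (fsupp F).
Let u1 x := cRe (F x).
Let u2 x := cIm (F x).

Let F0 x : ~ fsupp F x -> F x = 0.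
Proof.
by move=> h; apply/eqP/negPn/negP => Fx; apply: h; apply: subset_closure.
Qed.

Lemma smooth_test : exists2 M : R, 0 < M & test M u1 /\ test M u2.
Proof.
have [M0 [_ hM]] := compact_bounded cF.
pose M' := `|M0| + 1; have M'0 : 0 < M' by rewrite ltr_wpDl.
have MM' : M0 < M' by rewrite (le_lt_trans (ler_norm _)) // ltrDl.
have z x : M' < `|x| -> F x = 0.
  by move=> h; apply: F0 => /(hM M' MM') /=; rewrite leNgt h.
exists (M' + 1); first by rewrite addr_gt0.
have hM' : 0 < M' < M' + 1 by rewrite M'0 ltrDl ltr01.
split; (split; first by move=> n x; case: (sF n x)); exists M' => // x /z e.
  by rewrite /u1 e.
by rewrite /u2 e.
Qed.

Variable M : R.
Hypothesis M0 : 0 < M.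
Hypothesis t1 : test M u1.
Hypothesis t2 : test M u2.

(** The character is moved inside the integral, where it shifts the phase from [t * y] to
    [t * (y - s)]. *)
Lemma inv_fourier_phase (s t : R) : inv_fourier F t * expi (t * s) =
  ofR (2 * pi)^-1 * ((cosI M s u1 t + sinI M s u2 t) +i* (cosI M s u2 t - sinI M s u1 t))%C.
Proof.
have c1 := test_continuous t1; have c2 := test_continuous t2.
have cc x := @continuous_cos_phase R x; have cs x := @continuous_sin_phase R x.
have sup (u k : R -> R) : test M u -> continuous k ->
    mu.-integrable setT (EFin \o (fun y => u y * k y)) /\
    \int[mu]_y (u y * k y) = \int[mu]_(y in `[- M, M]) (u y * k y).
  move=> tu ck; apply: integral_supported; first exact: (continuousMR (test_continuous tu) ck).
  by move=> x hx; rewrite (test_bound0 tu hx) mul0r.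
have key s' : cintegrable (fun y => F y * expi (- (t * (y - s')))) /\
    cintegral (fun y => F y * expi (- (t * (y - s')))) =
    ((cosI M s' u1 t + sinI M s' u2 t) +i* (cosI M s' u2 t - sinI M s' u1 t))%C.
  have [i1 e1] := sup _ _ t1 (cc s' t); have [i2 e2] := sup _ _ t2 (cs s' t).
  have [i3 e3] := sup _ _ t2 (cc s' t); have [i4 e4] := sup _ _ t1 (cs s' t).
  have q1 y : cRe (F y * expi (- (t * (y - s')))) =
      u1 y * cos (t * (y - s')) + u2 y * sin (t * (y - s')).
    by rewrite cReM /= cosN sinN -/(u1 y) -/(u2 y); ring.
  have q2 y : cIm (F y * expi (- (t * (y - s')))) =
      u2 y * cos (t * (y - s')) - u1 y * sin (t * (y - s')).
    by rewrite cImM /= cosN sinN -/(u1 y) -/(u2 y); ring.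
  split.
    split; [under eq_fun do rewrite q1|under eq_fun do rewrite q2].
      exact: (integrableD measurableT i1 i2).
    exact: (integrableB measurableT i3 i4).
  apply: cplxP => /=.
    by under eq_Rintegral do rewrite q1; rewrite RintegralD // e1 e2.
  by under eq_Rintegral do rewrite q2; rewrite RintegralB // e3 e4.
have [_ <-] := key s; rewrite /inv_fourier -mulrA; congr (_ * _).
have [i0 _] := key 0; rewrite mulrC.
have -> : (fun y => F y * expi (- (t * y))) = (fun y => F y * expi (- (t * (y - 0)))).
  by apply/funext => y; rewrite subr0.
have [_ <-] := cintegralZ (expi (t * s)) i0.
congr cintegral; apply/funext => y; rewrite mulrCA -expiD; congr (_ * expi _); ring.
Qed.

Let pi2 : 0 < (2 * pi)^-1 :> R.
Proof. by rewrite invr_gt0 mulr_gt0 // pi_gt0. Qed.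

Lemma inv_fourier_decay : exists2 K : R, 0 <= K &
  forall t, cmod (inv_fourier F t) <= K * (oneDsqr t)^-1.
Proof.
have D0 w : 0 <= decayC M w by rewrite addr_ge0 // Rintegral_ge0.
exists ((2 * pi)^-1 * (2 * (decayC M u1 + decayC M u2))).
  by rewrite mulr_ge0 ?(ltW pi2) // mulr_ge0 // addr_ge0.
move=> t; have := inv_fourier_phase 0 t; rewrite mulr0 expi0 mulr1 => ->.
rewrite cmodM cmod_ofR (gtr0_norm pi2) -mulrA ler_wpM2l ?(ltW pi2) //.
apply: le_trans (cmod_le _) _ => /=.
have h1 := cosI_decay 0 M0 t t1; have h2 := sinI_decay 0 M0 t t1.
have h3 := cosI_decay 0 M0 t t2; have h4 := sinI_decay 0 M0 t t2.
have n1 := ler_normD (cosI M 0 u1 t) (sinI M 0 u2 t).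
have n2 := ler_normB (cosI M 0 u2 t) (sinI M 0 u1 t).
apply: le_trans (lerD n1 n2) _; apply: le_trans (lerD (lerD h1 h4) (lerD h3 h2)) _.
rewrite le_eqVlt; apply/orP; left; apply/eqP.
generalize (decayC M u1) (decayC M u2) ((oneDsqr t)^-1) => a b c; ring.
Qed.

Lemma inv_fourier_integral (s : R) :
  cintegrable (fun t => inv_fourier F t * expi (t * s)) /\
  cintegral (fun t => inv_fourier F t * expi (t * s)) =
  ofR (2 * pi)^-1 * ((\int[mu]_t cosI M s u1 t + \int[mu]_t sinI M s u2 t) +i*
    (\int[mu]_t cosI M s u2 t - \int[mu]_t sinI M s u1 t))%C.
Proof.
have c1 := test_continuous t1; have c2 := test_continuous t2.
have i1 := integrable_decay (@continuous_cosI _ M s _ c1) (fun t => cosI_decay s M0 t t1).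
have i2 := integrable_decay (@continuous_cosI _ M s _ c2) (fun t => cosI_decay s M0 t t2).
have i3 := integrable_decay (@continuous_sinI _ M s _ c1) (fun t => sinI_decay s M0 t t1).
have i4 := integrable_decay (@continuous_sinI _ M s _ c2) (fun t => sinI_decay s M0 t t2).
pose g t : C := ((cosI M s u1 t + sinI M s u2 t) +i* (cosI M s u2 t - sinI M s u1 t))%C.
have ig : cintegrable g.
  by split; [exact: (integrableD measurableT i1 i4)|exact: (integrableB measurableT i2 i3)].
have [] := cintegralZ (ofR (2 * pi)^-1) ig.
rewrite (_ : (fun t => _ * g t) = fun t => inv_fourier F t * expi (t * s)); last first.
  by apply/funext => t; rewrite inv_fourier_phase.
move=> h ->; split => //; congr (_ * _); apply: cplxP => /=.
  by rewrite RintegralD.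
by rewrite RintegralB.
Qed.

(** Both parts of [F] vanish near [s], so they are divisible by [y - s] and all four integrals over
    the line are zero. *)
Lemma inv_fourier_integral0 (s : R) : ~ fsupp F s ->
  cintegral (fun t => inv_fourier F t * expi (t * s)) = 0.
Proof.
move=> Fs; have near : \forall y \near s, F y = 0.
  have : nbhs s (~` fsupp F).
    by apply: open_nbhs_nbhs; split => //; apply: closed_openC; exact: closed_closure.
  by apply: filterS => y; exact: F0.
have n1 : \forall y \near s, u1 y = 0 by apply: filterS near => y; rewrite /u1 => ->.
have n2 : \forall y \near s, u2 y = 0 by apply: filterS near => y; rewrite /u2 => ->.
have [v1 tv1 e1] := exists_quotient t1 n1; have [v2 tv2 e2] := exists_quotient t2 n2.
have [_ ->] := inv_fourier_integral s.
rewrite (cosI_integral0 M0 t1 tv1 e1) (sinI_integral0 M0 t2 tv2 e2).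
rewrite (cosI_integral0 M0 t2 tv2 e2) (sinI_integral0 M0 t1 tv1 e1).
by rewrite addr0 subr0 mulr0.
Qed.
End FourierTransform.

Section FourierInversion.
Context {R : realType}.
Notation C := (Cplx R).

Lemma inv_fourier_integrable (F : R -> C) (s : R) : smooth F -> compact (fsupp F) ->
  cintegrable (fun t => inv_fourier F t * expi (t * s)).
Proof.
by move=> sF cF; have [M M0 [t1 t2]] := smooth_test sF cF; have [] := inv_fourier_integral M0 t1 t2 s.
Qed.

Lemma inv_fourier_off_support (F : R -> C) (s : R) : smooth F -> compact (fsupp F) ->
  ~ fsupp F s -> cintegral (fun t => inv_fourier F t * expi (t * s)) = 0.
Proof.
by move=> sF cF Fs; have [M M0 [t1 t2]] := smooth_test sF cF; exact: (inv_fourier_integral0 M0 t1 t2).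
Qed.

Lemma inv_fourier_bound (F : R -> C) : smooth F -> compact (fsupp F) ->
  exists2 K : R, 0 <= K & forall t, cmod (inv_fourier F t) <= K * (oneDsqr t)^-1.
Proof.
by move=> sF cF; have [M M0 [t1 t2]] := smooth_test sF cF; exact: (inv_fourier_decay M0 t1 t2).
Qed.

Lemma rsmooth0 : @rsmooth R (fun=> 0).
Proof.
apply: (@rsmooth_of_class _ (fun f => f = fun=> 0)) => // f ->.
  by move=> x; exact: derivable_cst.
by apply/funext => x; rewrite derive1_cst.
Qed.

(** For a nonnegative real bump around [s], the real part of the integral is a nonzero multiple of
    the one in [cosI_integral_neq0]. *)
Lemma exists_inv_fourier_neq0 (s : R) : s < 0 -> exists F : R -> C,
  [/\ smooth F, compact (fsupp F), fsupp F `<=` [set x | x < 0] &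
      cintegral (fun t => inv_fourier F t * expi (t * s)) != 0].
Proof.
(* With this radius the support ends at [s / 2], still negative. *)
move=> s0; pose r := - s / 2; have r0 : 0 < r by rewrite divr_gt0 // oppr_gt0.
pose F x : C := ofR (bump s r x).
have supp : fsupp F `<=` `[s - r, s + r]%classic.
  have cl : closed `[s - r, s + r]%classic by exact: itv_closed.
  rewrite [X in _ `<=` X]((closure_id _).1 cl); apply: closure_subset => x /= Fx.
  rewrite in_itv /=; apply/negPn/negP => h; move/eqP: Fx; apply.
  rewrite /F (@bump0 _ s r x r0) // leNgt; apply: contra h.
  by rewrite ltr_norml => /andP[? ?]; apply/andP; split; lra.
have sF : smooth F.
  move=> n x; split; first exact: (@rsmooth_bump _ s r n x).
  exact: (@rsmooth0 n x).
have cF : compact (fsupp F).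
  by apply: (subclosed_compact _ (@segment_compact _ (s - r) (s + r)) supp); exact: closed_closure.
exists F; split => //.
  by move=> x /supp; rewrite /= in_itv /= => /andP[_ h]; apply: le_lt_trans h _; rewrite /r; lra.
pose M := `|s| + r + 1; have M0 : 0 < M by apply: addr_gt0 => //; rewrite ltr_wpDl.
have rM : `|s| + r < M by rewrite ltrDl.
have t1 : test M (fun x => cRe (F x)) by exact: (test_bump r0 rM).
have t2 : test M (fun x => cIm (F x)).
  by split; [exact: rsmooth0|exists (`|s| + r) => //; rewrite rM ltr_wpDl].
have [_ ->] := inv_fourier_integral M0 t1 t2 s.
have z t : sinI M s (fun x => cIm (F x)) t = 0.
  by rewrite /sinI; under eq_Rintegral do rewrite cImofR mul0r; rewrite Rintegral_cst // mul0r.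
have -> : \int[@lebesgue_measure R]_t sinI M s (fun x => cIm (F x)) t = 0.
  by under eq_Rintegral do rewrite z; rewrite Rintegral_cst // mul0r.
have w0 : 0 < expR (- (3 / 4 * r ^+ 2)^-1) by rewrite expR_gt0.
have hs : - M <= s /\ s + r / 2 <= M.
  by have := ler_norm s; have := ler_norm (- s); rewrite normrN /M; split; lra.
have := cosI_integral_neq0 M0 t1 (half_gt0 r0) w0 hs (bump_ge0 s r) (fun y => bump_ge r0).
apply: contra => /eqP /(congr1 (@cRe R)); rewrite cReM cReofR cImofR mul0r subr0 /= addr0 => /eqP.
by rewrite mulf_eq0 invr_eq0 mulf_eq0 pnatr_eq0 /= gt_eqF ?pi_gt0.
Qed.
End FourierInversion.

(** * Ground states *)

Section StateCauchySchwarz.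
Context {R : realType} {A : cstarAlgebra R}.
Implicit Types (phi : A -> Cplx R) (b x : A).

Lemma state_cauchy_schwarz0 phi b x : state_space phi ->
  phi (cmul (cstar x) x) = 0 -> phi (cmul (cstar b) x) = 0.
Proof.
move=> [lin pos _] x0; apply: cmod_eq0; apply/eqP; rewrite -sqrf_eq0 eq_le sqr_ge0 andbT.
have h := @cauchy_schwarz_of_ge0 R (phi (cmul (cstar b) b)) (phi (cmul (cstar x) x))
  (phi (cmul (cstar b) x)) (phi (cmul (cstar x) b)) (pos b) (pos x).
apply: le_trans (h _) _; last by rewrite x0 cRe0 mulr0.
move=> l; have := pos (b + l *: x).
rewrite cstarD cstarZ !cmulDl !cmulDr !cmulZl !cmulZr !(lfD _ _ lin) !(lfZ _ _ lin).
by rewrite !mulrA !addrA.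
Qed.
End StateCauchySchwarz.

Section GroundStates.
Context {R : realType} {Gam : groupType} {X : topologicalType}.
Context {act : Gam -> X -> X} {Y : set X} {N : Gam -> R}.
Hypothesis N_pos : forall g, 0 < N g.
Context (irG : invariant_reduction act Y setT Y).
Notation C := (Cplx R).
Notation G := (box act setT Y).
Notation el := (@elem R Gam X act setT Y).
Notation conv := Defs.conv.
Context {A : cstarAlgebra R} {iota : (arr G -> C) -> A} {sigma : R -> A -> A}.
Hypothesis hA : is_groupoid_Cstar iota.
Hypothesis hs : is_cocycle_dynamics iota (@log_cocycle R Gam X act N Y) sigma.
Implicit Types (phi : A -> C) (F : R -> C).

Let sigma_lin t (k : C) a b : sigma t (k *: a + b) = k *: sigma t a + sigma t b.
Proof. by case: hs => [[_ _ h _ _] _]. Qed.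

Let sigmaD t a b : sigma t (a + b) = sigma t a + sigma t b.
Proof. exact: star_homD (sigma_lin t) a b. Qed.

Let sigmaZ t k a : sigma t (k *: a) = k *: sigma t a.
Proof. exact: star_homZ (sigma_lin t) k a. Qed.

Let sigma_le t a : nA (sigma t a) <= nA a.
Proof.
case: hs => [[_ _ _ h _] _]; have [h1 h2] := h t.
exact: (star_hom_contractive (sigma_lin t) h1 h2).
Qed.

Lemma sigma_elem t g a : cc a ->
  sigma t (iota (el g a)) = expi (t * ln (N g)) *: iota (el g a).
Proof.
move=> ca; have sp : span (el g a) by apply: (span_elem (L := setT) act Y I ca).
case: hs => _ h; rewrite h; last exact/(CcP irG).
rewrite -(iotaZ irG hA) //; congr iota; apply/funext => p.
rewrite /elem; case: (gam p =P g) => [<- //|_]; by rewrite !mulr0.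
Qed.

(* The integral of [sigma_t x] against [inv_fourier F] is a multiple of [x], since
   [x] is an eigenvector of the dynamics with negative frequency [ln (N g)]. *)
Lemma ground_elem phi : ground_states sigma phi -> forall g a, cc a -> N g < 1 ->
  phi (iota (conv (invol (el g a)) (el g a))) = 0.
Proof.
move=> [[lin _ _] hg] g a ca Ng1.
have sp : span (el g a) by apply: (span_elem (L := setT) act Y I ca).
have s0 : ln (N g) < 0 by rewrite ln_lt0 // N_pos.
have [F [sF cF supp K0]] := exists_inv_fourier_neq0 s0.
have iF := inv_fourier_integrable (ln (N g)) sF cF.
set K := cintegral _ in K0; set x := iota (el g a).
have wi : is_weak_integral (fun t => inv_fourier F t *: sigma t x) (K *: x).
  move=> omega olin _.
  have -> : (fun t => omega (inv_fourier F t *: sigma t x)) =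
      fun t => omega x * (inv_fourier F t * expi (t * ln (N g))).
    by apply/funext => t; rewrite sigma_elem // scalerA lfZ // mulrC.
  by have [? ->] := cintegralZ (omega x) iF; split => //; rewrite lfZ // mulrC.
have := hg F sF cF supp x _ wi; rewrite cstarZ cmulZl cmulZr !lfZ // => /eqP.
rewrite !mulf_eq0 conjC_eq0 (negbTE K0) /= => /eqP <-.
by rewrite (iotaM irG hA) ?(iota_invol irG hA) //; exact: (span_invol irG).
Qed.

(* For [N g >= 1] the orbit of [el g c] integrates to [0] against [inv_fourier F],
   its frequency [ln (N g)] being outside the support of [F]; for [N g < 1] the
   functional [phi (b^* * _)] kills [el g c] by Cauchy-Schwarz. *)
Lemma elem_ground phi : state_space phi ->
  (forall g a, cc a -> N g < 1 -> phi (iota (conv (invol (el g a)) (el g a))) = 0) ->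
  ground_states sigma phi.
Proof.
move=> sphi gphi; split => // F sF cF supp a b hb; have [lin pos _] := sphi.
have [K K0 FK] := inv_fourier_bound sF cF.
(* Testing the weak integral against [omega] turns the goal into the vanishing of a scalar
   integral. *)
pose omega x := phi (cmul (cstar b) x).
have olin : linear_functional omega by move=> k x y; rewrite /omega cmul_linr lin.
have ole x : cmod (omega x) <= nA b * nA x.
  by apply: le_trans (state_le _ sphi) _; apply: le_trans (nAM _ _) _; rewrite nA_star.
have [ia eb] := hb omega olin (bounded_continuous olin ole).
pose h x t := omega (inv_fourier F t *: sigma t x).
have hD x y t : h (x + y) t = h x t + h y t by rewrite /h sigmaD scalerDr lfD.
have hZ k x t : h (k *: x) t = k * h x t.
  by rewrite /h sigmaZ scalerA mulrC -scalerA lfZ.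
have hspan f : span f -> cintegrable (h (iota f)) /\ cintegral (h (iota f)) = 0.
  elim=> [|g c k _ cc_c sk [i1 e1]].
    have [i0 e0] := cintegralZ 0 (inv_fourier_integrable 0 sF cF).
    rewrite (_ : h _ = fun t => 0 * (inv_fourier F t * expi (t * 0))) ?e0 ?mul0r //.
    by apply/funext => t; rewrite (iota0 irG hA) mul0r -[X in h X](scale0r 0) hZ mul0r.
  have sp : span (el g c) by apply: (span_elem (L := setT) act Y I cc_c).
  have [i2 e2] := cintegralZ (omega (iota (el g c))) (inv_fourier_integrable (ln (N g)) sF cF).
  have he : h (iota (el g c)) = fun t => omega (iota (el g c)) * (inv_fourier F t * expi (t * ln (N g))).
    by apply/funext => t; rewrite /h sigma_elem // scalerA lfZ // mulrC.
  have e3 : cintegral (h (iota (el g c))) = 0.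
    rewrite he e2; have [Ng|Ng] := ltP (N g) 1.
      rewrite (_ : omega _ = 0) ?mul0r //; apply: state_cauchy_schwarz0 => //.
      by rewrite -(iota_invol irG hA) // -(iotaM irG hA) ?gphi //; exact: (span_invol irG).
    rewrite inv_fourier_off_support ?mulr0 // => /supp /=.
    by rewrite ltNge ln_ge0.
  rewrite -he in i2; have [i4 e4] := cintegralD i2 i1.
  rewrite (_ : h _ = fun t => h (iota (el g c)) t + h (iota k) t).
    by rewrite e4 e3 e1 addr0.
  by apply/funext => t; rewrite (iotaD irG hA).
rewrite -[LHS]/(omega b); apply: cmod_eq0; apply/eqP; rewrite eq_le cmod_ge0 andbT.
apply/ler_addgt0Pl => e e0; rewrite addr0.
pose J := 2 * \int[@lebesgue_measure R]_t (oneDsqr t)^-1.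
have J0 : 0 <= J by rewrite mulr_ge0 // Rintegral_ge0.
have B0 : 0 <= K * nA b * J by rewrite mulr_ge0 // mulr_ge0 // nA_ge0.
(* Each [sigma t] is contractive, so approximating [a] to this accuracy changes the integral by at
   most [K * nA b * J] times as much. *)
have e1 : 0 < e / (K * nA b * J + 1) by rewrite divr_gt0 // ltr_wpDl.
have [f sf fe] := iota_approx irG hA a e1.
have [i1 c1] := hspan f sf; have [i2 c2] := cintegralZ (-1) i1.
have [i3 c3] := cintegralD ia i2.
have ed : (fun t => omega (inv_fourier F t *: sigma t a) + -1 * h (iota f) t) = h (a - iota f).
  by apply/funext => t; rewrite hD -(scaleN1r (iota f)) hZ.
rewrite ed in i3 c3.
have -> : omega b = cintegral (h (a - iota f)) by rewrite c3 c2 c1 mulr0 addr0 eb.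
apply: le_trans (cintegral_le (c := K * nA b * (e / (K * nA b * J + 1))) _ i3 _) _.
- by apply: mulr_ge0 (ltW e1); rewrite mulr_ge0 // nA_ge0.
- move=> t; apply: le_trans (ole _) _; rewrite nAZ.
  have l1 := FK t; have l2 : nA (sigma t (a - iota f)) <= e / (K * nA b * J + 1).
    by apply: le_trans (sigma_le _ _) _; rewrite nAB.
  have l3 := ler_pM (cmod_ge0 _) (nA_ge0 _) l1 l2.
  apply: le_trans (ler_wpM2l (nA_ge0 b) l3) _; rewrite le_eqVlt; apply/orP; left; apply/eqP.
  generalize (nA b) (e / (K * nA b * J + 1)) ((oneDsqr t)^-1) => p q r; ring.
rewrite -/J mulrAC mulrA ler_pdivrMr ?ltr_wpDl // mulrC ler_wpM2l ?(ltW e0) //.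
by rewrite lerDl.
Qed.
End GroundStates.

Section ConvexityOfStates.
Context {R : realType} {Gam : groupType} {X : topologicalType}.
Context {act : Gam -> X -> X} {Y : set X} {L : set Gam} {W : set X}.
Context (ir : invariant_reduction act Y L W).
Notation C := (Cplx R).
Notation G := (box act L W).
Notation conv := Defs.conv.
Context {A : cstarAlgebra R} {iota : (arr G -> C) -> A}.
Hypothesis hA : is_groupoid_Cstar iota.

Lemma convex_lt (t e x y : R) : 0 <= t <= 1 -> e < x -> e < y -> e < t * x + (1 - t) * y.
Proof.
move=> /andP[t0 t1] ex ey; have [->|tn] := eqVneq t 0; first by rewrite mul0r add0r subr0 mul1r.
have tp : 0 < t by rewrite lt_neqAle eq_sym tn.
have : 0 < t * (x - e) by rewrite mulr_gt0 // subr_gt0.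
have : 0 <= (1 - t) * (y - e) by rewrite mulr_ge0 // subr_ge0 // ltW.
by lra.
Qed.

(** The delicate point is that the norm stays equal to [1], a supremum not being affine. The cutoff
    conditions are preserved, taking the union of two compact sets; extension and uniqueness then
    identify the combination with a state. *)
Lemma state_space_convex (t : R) (phi1 phi2 : A -> C) : 0 <= t <= 1 ->
  state_space phi1 -> state_space phi2 ->
  state_space (fun a => ofR t * phi1 a + ofR (1 - t) * phi2 a).
Proof.
move=> t01 s1 s2; have /andP[t0 t1] := t01.
set phi := (fun a => _); have [lin1 pos1 _] := s1; have [lin2 pos2 _] := s2.
have lin : linear_functional phi.
  by move=> k a b; rewrite /phi lin1 lin2; ring.
have bnd a : cmod (phi a) <= nA a.
  apply: le_trans (cmodD _ _) _; rewrite !cmodM !cmod_ofR !ger0_norm ?subr_ge0 //.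
  have := ler_wpM2l t0 (state_le a s1).
  have : (1 - t) * cmod (phi2 a) <= (1 - t) * nA a.
    by apply: ler_wpM2l; [rewrite subr_ge0|exact: state_le].
  by move=> h1 h2; apply: le_trans (lerD h2 h1) _; rewrite -mulrDl addrC subrK mul1r.
have a1 := state_algebraic ir hA s1; have a2 := state_algebraic ir hA s2.
have cRe_phi a : cRe (phi a) = t * cRe (phi1 a) + (1 - t) * cRe (phi2 a).
  by rewrite cReD !cReM !cReofR !cImofR !mul0r !subr0.
have alg : algebraic_state (act := act) (L := L) (W := W) (fun f => phi (iota f)).
  split.
  - by move=> k f1 f2 h1 h2; rewrite (iota_lin ir hA) // lin.
  - move=> f sf; have p1 := as_pos a1 sf; have p2 := as_pos a2 sf.
    by rewrite /phi addr_ge0 // mulr_ge0 // -[0]/(ofR 0) ler_ofR // subr_ge0.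
  - move=> e he; rewrite cRe_phi; have l1 := as_le1 a1 he; have l2 := as_le1 a2 he.
    have h1 : t * cRe (phi1 (iota (el_sq (act := act) (L := L) (W := W) e))) <= t * 1 by rewrite ler_wpM2l.
    have h2 : (1 - t) * cRe (phi2 (iota (el_sq (act := act) (L := L) (W := W) e))) <= (1 - t) * 1.
      by rewrite ler_wpM2l // subr_ge0.
    by apply: le_trans (lerD h1 h2) _; rewrite !mulr1 addrC subrK.
  - move=> eps e0; have [K1 cK1 h1] := as_approx a1 e0; have [K2 cK2 h2] := as_approx a2 e0.
    exists (K1 `|` K2); first exact: compactU.
    move=> e he eK; rewrite cRe_phi; apply: convex_lt => //.
      by apply: h1 => // x Kx; apply: eK; left.
    by apply: h2 => // x Kx; apply: eK; right.
have [phi' sphi' e'] := algebraic_state_extend ir hA alg.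
suff -> : phi = phi' by [].
apply: (lf_eq ir hA) => //.
- by case: sphi'.
- by move=> a; exact: state_le.
- by move=> f sf; rewrite e'.
Qed.
End ConvexityOfStates.

(** * The boundary set, the boundary groupoid and the kernel of the cocycle *)

Section BoundaryGroupoid.
Context {R : realType} {Gam : groupType} {X : topologicalType}.
Context {act : Gam -> X -> X} {Y : set X} {N : Gam -> R}.
Hypothesis ac : continuous_action act.
Hypothesis N_pos : forall g, 0 < N g.
Hypothesis N_mul : forall g h, N (g * h)%g = N g * N h.
Notation c := (@log_cocycle R Gam X act N Y).
Notation Y0 := (Yzero act N Y).

(** If [act g x] lies in [Y], then [g^-1] at the point [act g x] is an arrow with range [x], and all
    arrows with range [x] arise so. Positive cocycle values correspond to [N g < 1]. *)
Lemma boundary_setP x : boundary_set c x <-> Y0 (set_val x).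
Proof.
split=> [h|/(YzeroP ac N_pos N_mul) [Yx h] p px].
  apply/(YzeroP ac N_pos N_mul); split; first exact: set_valP.
  move=> g g1 Yg; have B : boxset act setT Y (g^-1%g, act g (set_val x)).
    by split => //=; rewrite actK //; exact: set_valP.
  pose p : arr (box act setT Y) := exist _ (g^-1%g, act g (set_val x)) (mem_set B).
  have := h p; rewrite /log_cocycle /= => H.
  have : ln (N g^-1%g) <= 0 by apply: H; apply: val_inj; rewrite /= actK.
  by rewrite leNgt ln_gt0 // (NV N_pos N_mul) invf_gt1.
rewrite /log_cocycle; apply: ln_le0; rewrite leNgt; apply/negP => g1.
have [_ /= Yp Ygp] := set_valP p.
apply: (h (set_val p).1^-1%g); first by rewrite (NV N_pos N_mul) invf_lt1.
by rewrite -px /= actK.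
Qed.

Lemma image_boundary_set : set_val @` boundary_set c = Y0.
Proof.
apply/seteqP; split=> [_ [x /boundary_setP h <-] //|y Yy].
have Yy' : Y y by case: Yy.
by exists (exist _ y (mem_set Yy') : obj (box act setT Y)) => //; exact/boundary_setP.
Qed.

Lemma image_boundary_groupoid : set_val @` boundary_groupoid c = boxset act setT Y0.
Proof.
apply/seteqP; split=> [_ [p [/boundary_setP h1 /boundary_setP h2] <-]|p [_ h2 h1]].
  by split.
have B : boxset act setT Y p by split => //; [case: h2|case: h1].
exists (exist _ p (mem_set B) : arr (box act setT Y)) => //.
by split; exact/boundary_setP.
Qed.

(** For an arrow between points of [Y0], [N g < 1] is excluded at its source and [N g > 1] at its
    range, through the inverse arrow. *)
Lemma boxset_Yzero : boxset act setT Y0 = boxset act (kerN N) Y0.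
Proof.
apply/seteqP; split=> [[g y] [_ /= h1 h2]|p [_ h1 h2]]; last by split.
split => //=; have [Yy hy] := (YzeroP ac N_pos N_mul y).1 h1.
have [Ygy hgy] := (YzeroP ac N_pos N_mul _).1 h2.
rewrite /kerN /=; apply/eqP; rewrite eq_le; apply/andP; split; rewrite leNgt; apply/negP => Ng.
  by apply: (hgy g^-1%g); rewrite ?(NV N_pos N_mul) ?invf_lt1 // actK.
exact: (hy g Ng).
Qed.

Lemma image_cocycle_kernel : set_val @` [set p | c p = 0] = boxset act (kerN N) Y.
Proof.
apply/seteqP; split=> [_ [p /= c0 <-]|p [k h1 h2]].
  have [_ h1 h2] := set_valP p; split => //; rewrite /kerN /=.
  by apply/eqP; rewrite -ln_eq0 //; apply/eqP.
have B : boxset act setT Y p by split.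
exists (exist _ p (mem_set B) : arr (box act setT Y)) => //=.
by rewrite /log_cocycle /= k ln1.
Qed.
End BoundaryGroupoid.

(** * The bijection between states and ground states *)

Section Parametrization.
Context {R : realType} {Gam : groupType} {X : topologicalType}.
Context {act : Gam -> X -> X} {Y : set X} {N : Gam -> R}.
Hypothesis X_lc : locally_compact [set: X].
Hypothesis X_haus : hausdorff_space X.
Hypothesis ac : continuous_action act.
Hypothesis Y_clopen : open Y /\ closed Y.
Hypothesis N_pos : forall g, 0 < N g.
Hypothesis N_mul : forall g h, N (g * h)%g = N g * N h.
Notation Y0 := (Yzero act N Y).
Notation C := (Cplx R).
Context {A : cstarAlgebra R} {iotaA : (arr (box act setT Y) -> C) -> A}.
Context {B : cstarAlgebra R} {iotaB : (arr (box act (kerN N) Y0) -> C) -> B}.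
Context {sigma : R -> A -> A}.
Hypothesis hA : is_groupoid_Cstar iotaA.
Hypothesis hB : is_groupoid_Cstar iotaB.
Hypothesis hs : is_cocycle_dynamics iotaA (@log_cocycle R Gam X act N Y) sigma.
Let irG := ir_full X_lc X_haus ac Y_clopen.
Let irH := ir_Yzero X_lc X_haus ac Y_clopen N_pos N_mul.
Notation rst := (@restrict_ker R Gam X act N Y).

Lemma exists_parametrization : exists Phi : (B -> C) -> (A -> C), forall psi,
  state_space psi -> state_space (Phi psi) /\
  forall f, span f -> Phi psi (iotaA f) = psi (iotaB (rst f)).
Proof.
have ex psi : exists phi, state_space psi -> state_space phi /\
    forall f, span f -> phi (iotaA f) = psi (iotaB (rst f)).
  (* A total map is wanted; off the state space the value is arbitrary. *)
  have [spsi|?] := pselect (state_space psi); last by exists (fun=> 0).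
  have a1 := push_state X_lc X_haus ac Y_clopen N_pos N_mul (state_algebraic irH hB spsi).
  by have [phi sphi e] := algebraic_state_extend irG hA a1; exists phi.
by have [Phi h] := choice ex; exists Phi.
Qed.

(** A state is determined on [C_c], so affinity and surjectivity are checked there. Injectivity
    holds because every function in [C_c] of the boundary groupoid is a restriction. *)
Lemma parametrization_affine_iso (Phi : (B -> C) -> (A -> C)) :
  (forall psi, state_space psi -> state_space (Phi psi) /\
    forall f, span f -> Phi psi (iotaA f) = psi (iotaB (rst f))) ->
  affine_iso (@state_space R B) (ground_states sigma) Phi.
Proof.
move=> hPhi; have unique phi psi : state_space psi -> state_space phi ->
    (forall f, span f -> phi (iotaA f) = psi (iotaB (rst f))) -> Phi psi = phi.
  move=> spsi sphi e; have [s1 e1] := hPhi psi spsi; apply: (lf_eq irG hA).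
  - by case: s1.
  - by move=> a; exact: state_le.
  - by case: sphi.
  - by move=> a; exact: state_le.
  - by move=> f sf; rewrite e1 // e.
split; last first.
  move=> t psi1 psi2 t01 s1 s2; have [p1 e1] := hPhi psi1 s1; have [p2 e2] := hPhi psi2 s2.
  apply: unique.
  - exact: (state_space_convex irH hB).
  - exact: (state_space_convex irG hA).
  - by move=> f sf; rewrite e1 // e2.
split.
- move=> psi spsi; have [s1 e1] := hPhi psi spsi.
  apply: (elem_ground irG hA hs s1) => g a ca Ng.
  have sp : span (@elem R Gam X act setT Y g a) by exact: span_elem.
  rewrite e1; last by apply: (span_conv irG) => //; exact: (span_invol irG).
  exact: (push_ground X_lc X_haus ac Y_clopen N_pos N_mul (state_algebraic irH hB spsi)).
- move=> psi1 psi2 /set_mem s1 /set_mem s2 e12.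
  have [_ e1] := hPhi psi1 s1; have [_ e2] := hPhi psi2 s2.
  apply: (lf_eq irH hB).
  - by case: s1.
  - by move=> a; exact: state_le.
  - by case: s2.
  - by move=> a; exact: state_le.
  move=> h /span_lifts [f lf]; rewrite -(lifts_rst lf) -e1 ?e12 ?e2 //; exact: lifts_spanl lf.
- move=> phi gphi; have sphi : state_space phi by case: gphi.
  have [psi0 a0 e0] := pull_state X_lc X_haus ac Y_clopen N_pos N_mul
    (state_algebraic irG hA sphi) (ground_elem N_pos irG hA hs gphi).
  have [psi spsi e1] := algebraic_state_extend irH hB a0.
  exists psi => //; apply: unique => // f sf.
  by rewrite e1 ?e0 //; exact: rst_span.
Qed.

Lemma ground_states_nonempty_boundary phi : ground_states sigma phi -> Y0 !=set0.
Proof.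
move=> gphi; have sphi : state_space phi by case: gphi.
exact: (ground_Yzero_neq0 X_lc X_haus ac Y_clopen N_pos N_mul
  (state_algebraic irG hA sphi) (ground_elem N_pos irG hA hs gphi)).
Qed.
End Parametrization.

Theorem theorem1p9 (R : realType) (Gam : groupType) (X : topologicalType)
    (act : Gam -> X -> X) (Y : set X) (N : Gam -> R)
    (Gam_countable : countable [set: Gam])
    (X_lc : locally_compact [set: X])
    (X_sc : @second_countable X)
    (X_haus : hausdorff_space X)
    (act_cont : continuous_action act)
    (Y_clopen : open Y /\ closed Y)
    (Y_full : \bigcup_(g in [set: Gam]) (act g @` Y) = [set: X])
    (N_pos : forall g, 0 < N g)
    (N_mul : forall g h, N (g * h)%g = N g * N h) :
  let Y0 := Yzero act N Y in
  let c := @log_cocycle R Gam X act N Y in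
  (* (1) *)
  set_val @` boundary_set c = Y0 /\
  (* (2) *)
  (set_val @` boundary_groupoid c = boxset act setT Y0 /\
   boxset act setT Y0 = boxset act (kerN N) Y0) /\
  (* (3) *)
  (set_val @` [set g | c g = 0] = boxset act (kerN N) Y /\
   etale_groupoid (box act (kerN N) Y) /\
   etale_groupoid (box act (kerN N) Y0)) /\
  (* (4) *)
  (Y0 !=set0 ->
   forall (A : cstarAlgebra R) (iotaA : (arr (box act setT Y) -> Cplx R) -> A)
          (B : cstarAlgebra R)
          (iotaB : (arr (box act (kerN N) Y0) -> Cplx R) -> B)
          (sigma : R -> A -> A),
     is_groupoid_Cstar iotaA -> is_groupoid_Cstar iotaB ->
     is_cocycle_dynamics iotaA c sigma ->
   exists Phi : (B -> Cplx R) -> (A -> Cplx R),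
     (forall psi, state_space psi ->
        forall f, Cc f -> Phi psi (iotaA f) = psi (iotaB (restrict_ker f))) /\
     affine_iso (@state_space R B) (ground_states sigma) Phi) /\
  (* (5) *)
  (Y0 = set0 ->
   forall (A : cstarAlgebra R) (iotaA : (arr (box act setT Y) -> Cplx R) -> A)
          (sigma : R -> A -> A),
     is_groupoid_Cstar iotaA -> is_cocycle_dynamics iotaA c sigma ->
     ground_states sigma = set0).
Proof.
move=> Y0 c; split; first exact: (image_boundary_set act_cont N_pos N_mul).
split.
  split; first exact: (image_boundary_groupoid act_cont N_pos N_mul).
  exact: (boxset_Yzero act_cont N_pos N_mul).
split.
  split; first exact: (image_cocycle_kernel N_pos).
  split; last first.
    exact: (box_etale (ir_Yzero X_lc X_haus act_cont Y_clopen N_pos N_mul) Gam_countable X_sc).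
  exact: (box_etale (ir_kerN X_lc X_haus act_cont Y_clopen N_pos N_mul) Gam_countable X_sc).
split=> [_ A iotaA B iotaB sigma hA hB hs|Y00 A iotaA sigma hA hs].
  have [Phi hPhi] := exists_parametrization X_lc X_haus act_cont Y_clopen N_pos N_mul hA hB.
  exists Phi; split; last first.
    exact: (parametrization_affine_iso X_lc X_haus act_cont Y_clopen N_pos N_mul hA hB hs hPhi).
  move=> psi /hPhi [_ e] f /(CcP (ir_full X_lc X_haus act_cont Y_clopen)); exact: e.
apply/seteqP; split=> // phi gphi.
have [y] := ground_states_nonempty_boundary X_lc X_haus act_cont Y_clopen N_pos N_mul hA hs gphi.
by rewrite -/Y0 Y00.
Qed.
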